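(* Let $n\ge 3$, $K>0$, and let $X:\mathcal M^n\times[0,T)\to\mathbb S_K^{n+1}$ be a solution to mean curvature flow ($\mathcal M$ closed) such that, for some $\alpha\in(0,1)$, the inequality \[ |A|^2\le\frac{1}{n-2+\alpha}H^2+2(2-\alpha)K \] holds on $\mathcal M^n\times\{0\}$. If $n\ge 4$, or if $n=3$ and $\alpha\ge\frac23$, then the same inequality holds on $\mathcal M^n\times\{t\}$ for all $t\in[0,T)$.
   Context: $\mathbb S^{n+1}_K$ is the round sphere of dimension $n+1$ and constant sectional curvature $K>0$. A solution to mean curvature flow is a smooth family of immersions $X(\cdot,t):\mathcal M\to\mathbb S_K^{n+1}$ with $\partial_tX=-H\nu$, where $\nu$ is a (local) unit normal field, $A(u,v)=\langle D_u\nu,v\rangle$ is the second fundamental form of $X(\cdot,t)$ and $H=\operatorname{tr}A$ is its mean curvature. $|A|^2$ is the squared norm of $A$ with respect to the induced metric. Closed means compact without boundary. *)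

(* Defs.v *)
From HB Require Import structures.
From mathcomp Require Import all_boot all_order all_algebra.
From mathcomp Require Import all_classical all_reals all_analysis.
Set Implicit Arguments.
Unset Strict Implicit.
Unset Printing Implicit Defensive.
Import Order.TTheory GRing.Theory Num.Theory.
Import numFieldNormedType.Exports.
Local Open Scope classical_set_scope.
Local Open Scope ring_scope.

Section Smooth.
Context {R : realType} {V W : normedModType R}.

Definition iter_derive (f : V -> W) (vs : seq V) : V -> W :=
  foldr (fun v (g : V -> W) x => 'D_v g x) f vs.

(* C^oo on an open set U: every iterated directional derivative exists and is
   continuous on U. *)
Definition smooth_on (U : set V) (f : V -> W) : Prop :=
  forall (vs : seq V) (x : V), U x ->
    {for x, continuous (iter_derive f vs)} /\
    forall v : V, derivable (iter_derive f vs) x v.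

(* Smoothness on an arbitrary set A (used for sets with boundary, such as
   U x [0, T)): local existence of a C^oo extension to an open set. *)
Definition smooth_on_set (A : set V) (f : V -> W) : Prop :=
  forall p, A p -> exists (U : set V) (g : V -> W),
    [/\ open U, U p, smooth_on U g & forall q, A q -> U q -> f q = g q].

End Smooth.

Section Manifold.
Context {R : realType} {n : nat}.

(* chart_inv is only meaningful on the open set chart_map @` chart_dom. *)
Record chart (M : topologicalType) := Chart {
  chart_dom : set M;
  chart_map : M -> 'rV[R]_n;
  chart_inv : 'rV[R]_n -> M;
  chart_dom_open : open chart_dom;
  chart_img_open : open (chart_map @` chart_dom);
  chart_mapK : forall p, chart_dom p -> chart_inv (chart_map p) = p;
  chart_map_cont : {within chart_dom, continuous chart_map};
  chart_inv_cont : {within chart_map @` chart_dom, continuous chart_inv}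
}.

Definition smooth_transition (M : topologicalType) (c d : chart M) : Prop :=
  smooth_on (chart_map c @` (chart_dom c `&` chart_dom d))
            (chart_map d \o chart_inv c).

End Manifold.
Arguments chart R n M : clear implicits.

(* Charts take values in the whole of R^n, so the manifolds have no boundary. *)
Record smooth_manifold (R : realType) (n : nat) := SmoothManifold {
  mfd_carrier :> topologicalType;
  mfd_hausdorff : hausdorff_space mfd_carrier;
  mfd_second_countable : @second_countable mfd_carrier;
  mfd_atlas : set (chart R n mfd_carrier);
  mfd_cover : forall p : mfd_carrier, exists2 c, mfd_atlas c & chart_dom c p;
  mfd_compat : forall c d, mfd_atlas c -> mfd_atlas d -> smooth_transition c d
}.

Definition dot {R : realType} {m : nat} (x y : 'rV[R]_m) : R := (x *m y^T) 0 0.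

(* The round sphere S^{n+1}_K, as the sphere of radius K^{-1/2} in R^{n+2}. *)
Definition sphere {R : realType} (n : nat) (K : R) : set 'rV[R]_n.+2 :=
  [set x | dot x x = K^-1].
Arguments sphere {R} n K.

(* Extrinsic geometry of a parametrised hypersurface F of the sphere S^{n+1}_K,
   in the coordinates u of R^n. *)
Section Hypersurface.
Context {R : realType} {n : nat}.
Variables (K : R) (F : 'rV[R]_n -> 'rV[R]_n.+2).
Implicit Types (N : 'rV[R]_n -> 'rV[R]_n.+2) (u : 'rV[R]_n).

Definition partial (G : 'rV[R]_n -> 'rV[R]_n.+2) (i : 'I_n) u : 'rV[R]_n.+2 :=
  'D_(delta_mx 0 i) G u.

Definition immersive_at u : Prop :=
  row_free (\matrix_(i < n) partial F i u).

Definition induced_metric u : 'M[R]_n :=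
  \matrix_(i, j) dot (partial F i u) (partial F j u).

(* Normal to the hypersurface and tangent to the sphere (orthogonal to F). *)
Definition unit_normal_at N u : Prop :=
  [/\ dot (N u) (N u) = 1, dot (N u) (F u) = 0
    & forall i, dot (N u) (partial F i u) = 0].

Definition local_unit_normal N u : Prop :=
  exists W : set 'rV[R]_n,
    [/\ open W, W u, smooth_on W N & forall v, W v -> unit_normal_at N v].

(* Levi-Civita derivative of the sphere along the i-th coordinate direction:
   the Euclidean derivative projected orthogonally to the unit vector
   sqrt K * F. *)
Definition sphere_deriv N (i : 'I_n) u : 'rV[R]_n.+2 :=
  partial N i u - (K * dot (partial N i u) (F u)) *: F u.

Definition second_ff N u : 'M[R]_n :=
  \matrix_(i, j) dot (sphere_deriv N i u) (partial F j u).

Definition mean_curvature N u : R :=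
  \tr (invmx (induced_metric u) *m second_ff N u).

(* |A|^2 = g^{ik} g^{jl} A_ij A_kl *)
Definition sqnorm_second_ff N u : R :=
  let g' := invmx (induced_metric u) in
  \sum_i \sum_j \sum_k \sum_l
    g' i k * g' j l * second_ff N u i j * second_ff N u k l.

End Hypersurface.

Section Flow.
Context {R : realType} {n : nat}.
Variables (M : smooth_manifold R n) (K : R) (T : \bar R).
Variable X : M -> R -> 'rV[R]_n.+2.

Definition time_interval : set R := [set t | 0 <= t /\ (t%:E < T)%E].

Definition in_chart (c : chart R n M) (t : R) : 'rV[R]_n -> 'rV[R]_n.+2 :=
  fun u => X (chart_inv c u) t.

Definition smooth_family : Prop :=
  forall c, mfd_atlas c ->
    smooth_on_set ((chart_map c @` chart_dom c) `*` time_interval)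
      (fun z : 'rV[R]_n * R => in_chart c z.2 z.1).

(* v is the derivative of X p at t relative to [0, T): one-sided at t = 0. *)
Definition is_velocity (p : M) (t : R) (v : 'rV[R]_n.+2) : Prop :=
  h^-1 *: (X p (t + h) - X p t)
    @[h --> within [set h | time_interval (t + h)] 0^'] --> v.

(* The vector H nu does not depend on the choice of the local unit normal. *)
Definition mcf_equation : Prop :=
  forall c p t, mfd_atlas c -> chart_dom c p -> time_interval t ->
    let F := in_chart c t in let u := chart_map c p in
    exists2 N, local_unit_normal F N u
             & is_velocity p t (- mean_curvature K F N u *: N u).

Definition mcf_solution : Prop :=
  [/\ forall p t, time_interval t -> sphere n K (X p t),
      smooth_family,
      forall c p t, mfd_atlas c -> chart_dom c p -> time_interval t ->
        immersive_at (in_chart c t) (chart_map c p)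
    & mcf_equation].

(* Both sides are unchanged under N |-> - N and under change of chart. *)
Definition pinched (a : R) (t : R) : Prop :=
  forall c p N, mfd_atlas c -> chart_dom c p ->
    let F := in_chart c t in let u := chart_map c p in
    local_unit_normal F N u ->
    sqnorm_second_ff K F N u <=
      (n%:R - 2 + a)^-1 * mean_curvature K F N u ^+ 2 + 2 * (2 - a) * K.

End Flow.

(* Main.v *)
Require Import Defs.
From HB Require Import structures.
From mathcomp Require Import all_boot all_order all_algebra.
From mathcomp Require Import all_classical all_reals all_analysis.
From mathcomp Require Import perm ring lra.
Set Implicit Arguments.
Unset Strict Implicit.
Unset Printing Implicit Defensive.
Import Order.TTheory GRing.Theory Num.Theory.
Import numFieldNormedType.Exports.
Local Open Scope classical_set_scope.
Local Open Scope ring_scope.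

(** Regard every tensor on the hypersurface as a tensor on the ambient R^(n+2).
    Let x be the position, nu the unit normal and F = dx; the tangential
    operators D_a = sum_j G_aj d_j with G = F^T (F F^T)^-1 satisfy
    D_a x_b = delta_ab - nu_a nu_b - K x_a x_b, the matrix A_ab = D_a nu_b is
    symmetric with tr A = H and sum_ab A_ab^2 = |A|^2, and sum_a D_a D_a is the
    Laplacian. The commutators of the D_a with each other and with d/dt are
    explicit, so Simons' identity and the evolution equations
      (dt - Lap) |A|^2 = 2 |A|^4 - 2 n K |A|^2 + 4 K H^2 - 2 |T|^2,
      (dt - Lap) H^2 = 2 H^2 (|A|^2 + n K) - 2 |DH|^2,
    where T is the covariant derivative of A, become algebra in the ring of
    smooth functions. Codazzi makes T totally symmetric, whence
    |T|^2 >= 3/(n+2) |DH|^2. For f = |A|^2 - H^2/(n-2+a) the gradient terms are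
    therefore nonpositive, and at a first maximum of f above the level
    2(2-a)K, attained by compactness, the reaction terms are strictly
    negative, contradicting dt f >= 0 >= Lap f. *)

(** * Evolution equations in a ring with derivations *)

(** With ambient indices no Christoffel symbols or moving frames occur: differentiation is
    componentwise, and the price is extra components along nu and x, all explicit and of lower
    order. Two obstacles shape the analytic half. The flow equation supplies a unit normal
    separately for each point and time, with no relation between different times, so a normal smooth
    in space-time has to be constructed. Moreover a global normal need not exist, so only the even
    quantities |A|^2 and H^2 are treated as functions on the manifold. The contradiction is run at a
    level 2(2-a)K + e with e > 0: the initial data then lie strictly below the level, so a first
    time at which it is reached exists and is positive. The reaction term is strictly negative at e
    = 0; taking e small against an upper bound of |A|^2 on a compact time interval keeps it so. *)

Definition derivation (S : comPzRingType) (d : S -> S) : Prop :=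
  {morph d : f g / f + g} /\ forall f g, d (f * g) = d f * g + f * d g.

Section Derivation.
Variables (S : comPzRingType) (d : S -> S).
Hypothesis dd : derivation d.

Lemma derivationD f g : d (f + g) = d f + d g. Proof. exact: dd.1. Qed.
Lemma derivationM f g : d (f * g) = d f * g + f * d g. Proof. exact: dd.2. Qed.

Lemma derivation0 : d 0 = 0.
Proof. by apply: (addrI (d 0)); rewrite -derivationD !addr0. Qed.

Lemma derivationN f : d (- f) = - d f.
Proof. by apply: (addrI (d f)); rewrite -derivationD !subrr derivation0. Qed.

Lemma derivationB f g : d (f - g) = d f - d g.
Proof. by rewrite derivationD derivationN. Qed.

Lemma derivation1 : d 1 = 0.
Proof. by apply: (addrI (d 1)); rewrite addr0 -{3}(mulr1 1) derivationM mulr1 mul1r. Qed.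

Lemma derivation_sum I (r : seq I) (P : pred I) F :
  d (\sum_(i <- r | P i) F i) = \sum_(i <- r | P i) d (F i).
Proof. exact: (big_morph d derivationD derivation0). Qed.

Lemma derivation_nat k : d k%:R = 0.
Proof.
elim: k => [|k IH]; first exact: derivation0.
by rewrite -natr1 derivationD IH derivation1 addr0.
Qed.

End Derivation.

(** * Simons' identity and the evolution equations from commutation rules *)

Section Evolution.
Variables (S : comPzRingType) (n : nat).
Notation m := n.+2.
Variables (D : 'I_m -> S -> S) (Dt : S -> S) (K : S) (x nu : 'I_m -> S).
Hypothesis dD : forall a, derivation (D a).
Hypothesis dDt : derivation Dt.
Hypothesis DK : forall a, D a K = 0.
(** The ring has no division, so |x|^2 = 1/K is written multiplicatively. *)
Hypothesis xx : K * (\sum_a x a * x a) = 1.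
Hypothesis nunu : \sum_a nu a * nu a = 1.
Hypothesis nux : \sum_a nu a * x a = 0.
Hypothesis Dx : forall a b,
  D a (x b) = (a == b)%:R - nu a * nu b - K * x a * x b.
Let A a b := D a (nu b).
Let H := \sum_a A a a.
Hypothesis Asym : forall a b, A a b = A b a.
Hypothesis nuD : forall f, \sum_a nu a * D a f = 0.
Hypothesis xD : forall f, \sum_a x a * D a f = 0.
Hypothesis Dcomm : forall a b f, D a (D b f) = D b (D a f)
  + nu a * (\sum_c A b c * D c f) - nu b * (\sum_c A a c * D c f)
  + K * (x a * D b f - x b * D a f).
Hypothesis DtD : forall a f, Dt (D a f) = D a (Dt f)
  + H * (\sum_c A a c * D c f) - nu a * (\sum_c D c H * D c f).
Hypothesis Dtnu : forall b, Dt (nu b) = D b H + K * H * x b.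

(** Matrix square and cube of [A]; [B2] is tr A^4. It appears only because [lap] acts on ambient
    components, and it cancels between [contract_heatA] and [norm_DA]. *)
Let B a b := \sum_c A a c * A c b.
Let C a b := \sum_c A a c * B c b.
Let A2 := \sum_a \sum_b A a b * A a b.
Let B2 := \sum_a \sum_b B a b * B a b.
Let lap f := \sum_c D c (D c f).

Lemma nuA b : \sum_a nu a * A a b = 0. Proof. exact: nuD. Qed.
Lemma xA b : \sum_a x a * A a b = 0. Proof. exact: xD. Qed.

Lemma sum_delta (a : 'I_m) (f : 'I_m -> S) : \sum_b (a == b)%:R * f b = f a.
Proof.
rewrite (bigD1 a) //= eqxx mul1r big1 ?addr0 // => b ne.
by rewrite eq_sym (negPf ne) mul0r.
Qed.

Lemma traceB : \sum_a B a a = A2.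
Proof. by apply: eq_bigr => a _; apply: eq_bigr => b _; rewrite [A b a]Asym. Qed.

Lemma nuB b : \sum_a nu a * B a b = 0.
Proof.
under eq_bigr => a _ do rewrite mulr_sumr.
rewrite exchange_big big1 //= => c _.
by under eq_bigr => a _ do rewrite mulrA; rewrite -mulr_suml nuA mul0r.
Qed.

Lemma xB b : \sum_a x a * B a b = 0.
Proof.
under eq_bigr => a _ do rewrite mulr_sumr.
rewrite exchange_big big1 //= => c _.
by under eq_bigr => a _ do rewrite mulrA; rewrite -mulr_suml xA mul0r.
Qed.

Lemma Bsym a b : B a b = B b a.
Proof. by apply: eq_bigr => c _; rewrite mulrC [A c b]Asym [A a c]Asym. Qed.

Lemma trace_Dx : \sum_a D a (x a) = n%:R.
Proof.
under eq_bigr => a _ do rewrite Dx eqxx -mulrA.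
rewrite !big_split /= !sumrN -mulr_sumr xx nunu sumr_const card_ord.
by rewrite -addn2 natrD; ring.
Qed.

Lemma Dx_contract a (f : 'I_m -> S) :
  \sum_b nu b * f b = 0 -> \sum_b x b * f b = 0 -> \sum_b D a (x b) * f b = f a.
Proof.
move=> hn hx.
under eq_bigr => b _ do rewrite Dx !mulrBl -!mulrA.
by rewrite !big_split /= !sumrN sum_delta -!mulr_sumr hn hx !mulr0 !subr0.
Qed.

(** This is [Dcomm] for the function [nu b]; the corrections come from extending tangential tensors
    by zero to the ambient space. *)
Lemma codazzi c a b : D c (A a b) = D a (A c b)
  + nu c * B a b - nu a * B c b + K * (x c * A a b - x a * A c b).
Proof. exact: Dcomm. Qed.

Lemma divA b : \sum_c D c (A c b) = D b H - nu b * A2 - K * H * x b.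
Proof.
transitivity (\sum_c (D b (A c c) + nu c * B c b - nu b * B c c
    + K * (x c * A c b - x b * A c c))).
  by apply: eq_bigr => c _; rewrite Asym codazzi [B b c]Bsym [A b c]Asym.
rewrite !big_split /= sumrN -!mulr_sumr sumrB -mulr_sumr nuB xA traceB.
by rewrite -(derivation_sum (dD b)) -/H; ring.
Qed.

(** Differentiating [nuA] trades the normal component of a derivative of [A] for an undifferentiated
    product; [xDA] does the same for the radial component. *)
Lemma nuDA d b : \sum_c nu c * D d (A c b) = - B d b.
Proof.
apply/eqP; rewrite -addr_eq0; apply/eqP.
rewrite -[RHS](derivation0 (dD d)) -{2}(nuA b) (derivation_sum (dD d)).
by under [RHS]eq_bigr => c _ do rewrite (derivationM (dD d)); rewrite big_split addrC.
Qed.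

Lemma xDA d b : \sum_c x c * D d (A c b) = - A d b.
Proof.
apply/eqP; rewrite -addr_eq0; apply/eqP.
rewrite -[RHS](derivation0 (dD d)) -{2}(xA b) (derivation_sum (dD d)).
under [RHS]eq_bigr => c _ do rewrite (derivationM (dD d)).
rewrite big_split addrC /= (@Dx_contract d (A ^~ b)) //; [exact: nuA|exact: xA].
Qed.

(** Simons' identity in ambient form: [codazzi] exchanges the inner derivative index, [Dcomm] the
    two outer derivatives, and the remaining divergence is [divA]. The fields [U V Y Z] stay
    anonymous because every term containing them dies on contraction with [A] ([contract_junk]). *)
Lemma laplaceA : exists U V Y Z : 'I_m -> S, forall a b, lap (A a b) =
  D a (D b H) + H * B a b - (C a b + C a b) + (n%:R - 2%:R) * K * A a b - A2 * A a b
  - K * H * (a == b)%:R + nu a * U b + nu b * V a + x a * Y b + x b * Z a.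
Proof.
exists (fun b => - (\sum_c D c (B c b)) - (\sum_c \sum_d A c d * D d (A c b)) + K * H * nu b).
exists (fun a => - D a A2).
exists (fun b => - (K * \sum_c D c (A c b) + K * \sum_c D c (A c b)) + K * H * K * x b).
exists (fun a => - (K * D a H)) => a b.
transitivity (\sum_c (D a (D c (A c b))
    + nu c * (\sum_d A a d * D d (A c b)) - nu a * (\sum_d A c d * D d (A c b))
    + K * (x c * D a (A c b) - x a * D c (A c b))
    + (A c c * B a b + nu c * D c (B a b)) - (A a c * B c b + nu a * D c (B c b))
    + K * (D c (x c) * A a b + x c * D c (A a b) - D a (x c) * A c b - x a * D c (A c b)))).
  apply: eq_bigr => c _; rewrite {1}codazzi.
  have dc := dD c.
  rewrite (derivationD dc) (derivationB dc) (derivationD dc) !(derivationM dc) DK.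
  rewrite (derivationB dc) !(derivationM dc) (Dcomm c a (A c b)) [D c (x a)]Dx [D a (x c)]Dx.
  rewrite [c == a]eq_sym [A a c]Asym -/(A c c) -/(A c a); ring.
have E1 : \sum_c nu c * (\sum_d A a d * D d (A c b)) = - C a b.
  under eq_bigr => c _ do rewrite mulr_sumr.
  rewrite exchange_big /= -sumrN; apply: eq_bigr => d _.
  rewrite -mulrN -nuDA mulr_sumr; apply: eq_bigr => c _; ring.
have E2 := Dx_contract a (nuA b) (xA b).
rewrite !(big_split, sumrN, sumrB) /= -?(mulr_sumr, mulr_suml).
rewrite !(big_split, sumrN, sumrB) /= -?(mulr_sumr, mulr_suml).
rewrite E1 nuD xD xDA E2 trace_Dx -/(C a b) -(derivation_sum (dD a)) divA -/H.
rewrite (derivationB (dD a)) (derivationB (dD a)) !(derivationM (dD a)) DK Dx -/(A a b).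
ring.
Qed.

(** The second derivative of [H] and the term [H * B a b] occur exactly as in [laplaceA], so they
    cancel in the heat operator. *)
Lemma DtA : exists U Z : 'I_m -> S, forall a b, Dt (A a b) =
  D a (D b H) + H * B a b + K * H * (a == b)%:R + nu a * U b + x b * Z a.
Proof.
exists (fun b => - (K * H * nu b) - \sum_c D c H * A c b).
exists (fun a => K * D a H - K * H * K * x a) => a b.
rewrite DtD Dtnu (derivationD (dD a)) !(derivationM (dD a)) DK Dx -/(B a b).
ring.
Qed.

Lemma contract_junk (U V Y Z : 'I_m -> S) :
  \sum_a \sum_b A a b * (nu a * U b + nu b * V a + x a * Y b + x b * Z a) = 0.
Proof.
under eq_bigr => a _ do under eq_bigr => b _ do rewrite !mulrDr.
under eq_bigr => a _ do rewrite !big_split.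
rewrite !big_split /= exchange_big /= [X in _ + _ + X + _]exchange_big /=.
rewrite !big1 ?addr0 // => a _.
- transitivity ((\sum_b x b * A b a) * Z a); last by rewrite xA mul0r.
  by rewrite mulr_suml; apply: eq_bigr => b _; rewrite [A a b]Asym; ring.
- transitivity ((\sum_b x b * A b a) * Y a); last by rewrite xA mul0r.
  by rewrite mulr_suml; apply: eq_bigr => b _; rewrite /=; ring.
- transitivity ((\sum_b nu b * A b a) * V a); last by rewrite nuA mul0r.
  by rewrite mulr_suml; apply: eq_bigr => b _; rewrite [A a b]Asym; ring.
- transitivity ((\sum_b nu b * A b a) * U a); last by rewrite nuA mul0r.
  by rewrite mulr_suml; apply: eq_bigr => b _; rewrite /=; ring.
Qed.

Lemma contractC : \sum_a \sum_b A a b * C a b = B2.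
Proof.
rewrite /B2 /C.
transitivity (\sum_a \sum_c \sum_b A a b * (A a c * B c b)).
  apply: eq_bigr => a _; rewrite exchange_big; apply: eq_bigr => b _.
  by rewrite mulr_sumr.
rewrite exchange_big; apply: eq_bigr => c _.
rewrite exchange_big; apply: eq_bigr => b _ /=.
rewrite [X in _ = X * _]/B mulr_suml; apply: eq_bigr => a _.
by rewrite [A c a]Asym; ring.
Qed.

Lemma contract_delta : \sum_a \sum_b A a b * (a == b)%:R = H.
Proof.
apply: eq_bigr => a _; under eq_bigr => b _ do rewrite mulrC.
by rewrite sum_delta.
Qed.

Lemma contract_heatA : \sum_a \sum_b A a b * (Dt (A a b) - lap (A a b)) =
  B2 + B2 - (n%:R - 2%:R) * K * A2 + A2 * A2 + K * H * H + K * H * H.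
Proof.
have [U [V [Y [Z hl]]]] := laplaceA; have [U' [Z' ht]] := DtA.
transitivity (\sum_a \sum_b (A a b * C a b + A a b * C a b
   - (n%:R - 2%:R) * K * (A a b * A a b) + A2 * (A a b * A a b)
   + K * H * (A a b * (a == b)%:R) + K * H * (A a b * (a == b)%:R)
   + A a b * (nu a * (U' b - U b) + nu b * (- V a) + x a * (- Y b) + x b * (Z' a - Z a)))).
  by apply: eq_bigr => a _; apply: eq_bigr => b _; rewrite hl ht; ring.
under eq_bigr => a _ do rewrite !(big_split, sumrN) /= -!mulr_sumr.
rewrite !(big_split, sumrN) /= contract_junk -!mulr_sumr contractC contract_delta.
rewrite -/A2; ring.
Qed.

(* The covariant derivative of A: the tangential part of D_c A_ab. *)
Let T c a b := D c (A a b) + nu a * B c b + nu b * B c a + K * x a * A c b + K * x b * A c a.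
Let T2 := \sum_c \sum_a \sum_b T c a b * T c a b.

Lemma Tsym c a b : T c a b = T c b a.
Proof. by rewrite /T [A a b]Asym; ring. Qed.

Lemma Tsym' c a b : T c a b = T a c b.
Proof. by rewrite /T codazzi [B a c]Bsym [A a c]Asym; ring. Qed.

Lemma nuT c b : \sum_a nu a * T c a b = 0.
Proof.
transitivity (\sum_a (nu a * D c (A a b) + nu a * nu a * B c b + nu b * (nu a * B a c)
  + K * A c b * (nu a * x a) + K * x b * (nu a * A a c))).
  by apply: eq_bigr => a _; rewrite /T [B c a]Bsym [A c a]Asym; ring.
rewrite !big_split /= -!mulr_sumr -mulr_suml nuDA nunu nuB nux nuA; ring.
Qed.

Lemma xT c b : \sum_a x a * T c a b = 0.
Proof.
transitivity (\sum_a (x a * D c (A a b) + nu a * x a * B c b + nu b * (x a * B a c)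
  + K * (x a * x a) * A c b + K * x b * (x a * A a c))).
  by apply: eq_bigr => a _; rewrite /T [B c a]Bsym [A c a]Asym; ring.
rewrite !big_split /= -!mulr_suml -!mulr_sumr xDA nux xB xx xA; ring.
Qed.

(** Each term of [T] minus the ambient derivative has a factor nu or x with index a or b, so pairing
    with a symmetric [f] sees only the contractions of [f] with nu and x. These vanish for [f = T c]
    and are [nuDA] and [xDA] for the derivative of [A]. *)
Lemma contract_normal c (f : 'I_m -> 'I_m -> S) : (forall a b, f a b = f b a) ->
  \sum_a \sum_b (T c a b - D c (A a b)) * f a b =
  (\sum_b B c b * (\sum_a nu a * f a b)) *+ 2
  + (K * \sum_b A c b * (\sum_a x a * f a b)) *+ 2.
Proof.
move=> fs.
transitivity (\sum_a \sum_b (B c b * (nu a * f a b))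
  + \sum_b \sum_a (B c a * (nu b * f b a))
  + K * (\sum_a \sum_b (A c b * (x a * f a b)))
  + K * (\sum_b \sum_a (A c a * (x b * f b a)))).
  rewrite [X in _ + X + _ + _]exchange_big [X in _ + K * X]exchange_big /=.
  rewrite !mulr_sumr -!big_split; apply: eq_bigr => a _ /=.
  rewrite !mulr_sumr -!big_split; apply: eq_bigr => b _ /=.
  by rewrite [f b a]fs /T; ring.
have sw (p : 'I_m -> S) (q : 'I_m -> S) : \sum_a \sum_b p b * (q a * f a b) =
    \sum_b p b * (\sum_a q a * f a b).
  by rewrite exchange_big; apply: eq_bigr => b _; rewrite mulr_sumr.
by rewrite !sw !mulr2n; ring.
Qed.

(** Pythagoras: the non-tangential part of the derivative of [A] is orthogonal to [T], and its
    square involves no derivative of [A]. *)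
Lemma norm_DA : \sum_c \sum_a \sum_b D c (A a b) * D c (A a b) =
  T2 + B2 *+ 2 + (K * A2) *+ 2.
Proof.
rewrite /T2 /B2 /A2 mulr_sumr -!sumrMnl -!big_split /=; apply: eq_bigr => c _.
have Ds a b : D c (A a b) = D c (A b a) by rewrite Asym.
have ET : \sum_a \sum_b (T c a b - D c (A a b)) * T c a b = 0.
  rewrite (contract_normal c (Tsym c)) !big1 => [|b _|b _]; first by ring.
    by rewrite xT mulr0.
  by rewrite nuT mulr0.
have ED : \sum_a \sum_b (T c a b - D c (A a b)) * D c (A a b) =
    (- \sum_b B c b * B c b) *+ 2 + (K * - \sum_b A c b * A c b) *+ 2.
  rewrite (contract_normal c Ds); congr (_ *+ 2 + (_ * _) *+ 2).
    by rewrite -sumrN; apply: eq_bigr => b _; rewrite nuDA mulrN.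
  by rewrite -sumrN; apply: eq_bigr => b _; rewrite xDA mulrN.
transitivity (\sum_a \sum_b T c a b * T c a b
  - \sum_a \sum_b (T c a b - D c (A a b)) * T c a b
  - \sum_a \sum_b (T c a b - D c (A a b)) * D c (A a b)).
  by rewrite -!sumrB; apply: eq_bigr => a _; rewrite -!sumrB; apply: eq_bigr => b _; ring.
by rewrite ET ED; ring.
Qed.

Lemma lap_sqr f : lap (f * f) = (f * lap f) *+ 2 + (\sum_c D c f * D c f) *+ 2.
Proof.
rewrite /lap mulr_sumr -!sumrMnl -big_split; apply: eq_bigr => c _ /=.
by rewrite !(derivationM (dD c)) (derivationD (dD c)) !(derivationM (dD c)); ring.
Qed.

Lemma lap_sum I (r : seq I) F : lap (\sum_(i <- r) F i) = \sum_(i <- r) lap (F i).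
Proof.
rewrite /lap exchange_big; apply: eq_bigr => c _.
by rewrite !(derivation_sum (dD c)).
Qed.

Lemma heat_sqr f : Dt (f * f) - lap (f * f) =
  (f * (Dt f - lap f)) *+ 2 - (\sum_c D c f * D c f) *+ 2.
Proof. by rewrite lap_sqr (derivationM dDt); ring. Qed.

(** The terms in [B2] cancel, and the 2 K |A|^2 of [norm_DA] turns the factor n - 2 of Simons'
    identity into n. *)
Theorem heat_norm_sff : Dt A2 - lap A2 =
  (A2 * A2) *+ 2 - (n%:R * K * A2) *+ 2 + (K * H * H) *+ 4 - T2 *+ 2.
Proof.
have sw : \sum_a \sum_b \sum_c D c (A a b) * D c (A a b) =
    \sum_c \sum_a \sum_b D c (A a b) * D c (A a b).
  by rewrite [RHS]exchange_big; apply: eq_bigr => a _; rewrite [RHS]exchange_big.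
transitivity ((\sum_a \sum_b A a b * (Dt (A a b) - lap (A a b))) *+ 2
  - (\sum_a \sum_b \sum_c D c (A a b) * D c (A a b)) *+ 2).
  rewrite -!sumrMnl -sumrB lap_sum (derivation_sum dDt) -sumrB.
  apply: eq_bigr => a _; rewrite -!sumrMnl -sumrB lap_sum.
  rewrite (derivation_sum dDt) -sumrB; apply: eq_bigr => b _ /=.
  exact: heat_sqr.
by rewrite contract_heatA sw norm_DA; ring.
Qed.

Lemma heat_H : Dt H - lap H = H * A2 + n%:R * K * H.
Proof.
transitivity (\sum_a (D a (D a H) + H * B a a + (K * H * D a (x a) + K * (x a * D a H))
   - nu a * (\sum_c D c H * A c a)) - lap H).
  congr (_ - _); rewrite (derivation_sum dDt); apply: eq_bigr => a _.
  rewrite DtD Dtnu (derivationD (dD a)) !(derivationM (dD a)) DK -/(B a a); ring.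
rewrite !(big_split, sumrN) /= -!mulr_sumr trace_Dx traceB xD -/(lap H).
have -> : \sum_a nu a * (\sum_c D c H * A c a) = 0.
  under eq_bigr => a _ do rewrite mulr_sumr.
  rewrite exchange_big big1 //= => c _.
  transitivity (D c H * \sum_a nu a * A a c); last by rewrite nuA mulr0.
  by rewrite mulr_sumr; apply: eq_bigr => a _; rewrite [A c a]Asym; ring.
ring.
Qed.

Theorem heat_sqr_mean : Dt (H * H) - lap (H * H) =
  (H * H * (A2 + n%:R * K)) *+ 2 - (\sum_c D c H * D c H) *+ 2.
Proof. by rewrite heat_sqr heat_H; ring. Qed.

Let h c := D c H.
(** [D a (x b)] is the induced metric as an ambient tensor. A trace of the symmetrised product of
    the metric with [h] is (n + 2) h, so the factor [n.+2] makes [W] trace-free without dividing. *)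
Let W c a b := (n.+2)%:R * T c a b
  - (D a (x b) * h c + D b (x c) * h a + D c (x a) * h b).

Lemma traceT c : \sum_a T c a a = h c.
Proof.
transitivity (\sum_a (D c (A a a) + 2 * (nu a * B a c) + 2 * K * (x a * A a c))).
  by apply: eq_bigr => a _; rewrite /T [B c a]Bsym [A c a]Asym; ring.
rewrite !big_split /= -!mulr_sumr nuB xA -(derivation_sum (dD c)) -/H /h; ring.
Qed.

Lemma Dxsym a b : D a (x b) = D b (x a).
Proof. by rewrite !Dx eq_sym; ring. Qed.

Lemma Dx2 a b : \sum_c D a (x c) * D c (x b) = D a (x b).
Proof.
apply: (@Dx_contract a (fun c => D c (x b))); [exact: nuD|exact: xD].
Qed.

(* [T] minus its trace part: [|T|^2 - 3/(n+2) |h|^2] is a sum of squares. *)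
Theorem kato : \sum_c \sum_a \sum_b W c a b * W c a b =
  n.+2%:R * (n.+2%:R * T2 - (\sum_c h c * h c) *+ 3).
Proof.
have PT c : \sum_a \sum_b D a (x b) * T c a b = h c.
  rewrite -traceT; apply: eq_bigr => a _; rewrite (@Dx_contract a (T c a)) //.
    by rewrite -[RHS](nuT c a); apply: eq_bigr => b _; rewrite Tsym.
  by rewrite -[RHS](xT c a); apply: eq_bigr => b _; rewrite Tsym.
have Ph a : \sum_b D a (x b) * h b = h a by rewrite (@Dx_contract a h) //; [exact: nuD|exact: xD].
have PP : \sum_a \sum_b D a (x b) * D a (x b) = n%:R.
  rewrite -trace_Dx; apply: eq_bigr => a _; rewrite -[RHS]Dx2.
  by apply: eq_bigr => b _; rewrite [D b _]Dxsym.
have rot (F : 'I_m -> 'I_m -> 'I_m -> S) :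
    \sum_c \sum_a \sum_b F a b c = \sum_c \sum_a \sum_b F c a b.
  by rewrite exchange_big; apply: eq_bigr => a _; rewrite exchange_big.
(* By total symmetry of [T], every product in the expanded square, apart from T^2, is a cyclic
   rotation of one of these three, and rotating the indices does not change the triple sum. *)
pose F1 c a b := D a (x b) * T c a b * h c.
pose F2 c a b := D a (x b) * D a (x b) * (h c * h c).
pose F3 c a b := D a (x b) * D b (x c) * h a * h c.
have S1 : \sum_c \sum_a \sum_b F1 c a b = \sum_c h c * h c.
  apply: eq_bigr => c _.
  transitivity ((\sum_a \sum_b D a (x b) * T c a b) * h c); last by rewrite PT.
  by rewrite mulr_suml; apply: eq_bigr => a _; rewrite mulr_suml.
have S2 : \sum_c \sum_a \sum_b F2 c a b = n%:R * \sum_c h c * h c.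
  rewrite mulr_sumr; apply: eq_bigr => c _; rewrite -PP mulr_suml.
  by apply: eq_bigr => a _; rewrite mulr_suml.
have S3 : \sum_c \sum_a \sum_b F3 c a b = \sum_c h c * h c.
  apply: eq_bigr => c _.
  transitivity ((\sum_a D c (x a) * h a) * h c); last by rewrite Ph.
  rewrite mulr_suml; apply: eq_bigr => a _.
  by rewrite Dxsym -Dx2 !mulr_suml; apply: eq_bigr => b _; rewrite /F3; ring.
transitivity (\sum_c \sum_a \sum_b (n.+2%:R * n.+2%:R * (T c a b * T c a b)
   + (- n.+2%:R *+ 2) * (F1 c a b + F1 a b c + F1 b c a)
   + (F2 c a b + F2 a b c + F2 b c a) + (F3 c a b + F3 a b c + F3 b c a) *+ 2)).
  apply: eq_bigr => c _; apply: eq_bigr => a _; apply: eq_bigr => b _.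
  have T1 : T a b c = T c a b by rewrite Tsym Tsym'.
  have T3 : T b c a = T c a b by rewrite Tsym' Tsym.
  by rewrite /W /F1 /F2 /F3 T1 T3; ring.
pose s (F : 'I_m -> 'I_m -> 'I_m -> S) := \sum_c \sum_a \sum_b F c a b.
transitivity (n.+2%:R * n.+2%:R * T2
   + (- n.+2%:R *+ 2) * (s F1 + s (fun c a b => F1 a b c) + s (fun c a b => F1 b c a))
   + (s F2 + s (fun c a b => F2 a b c) + s (fun c a b => F2 b c a))
   + (s F3 + s (fun c a b => F3 a b c) + s (fun c a b => F3 b c a)) *+ 2).
  rewrite /T2 /s -!big_split !mulr_sumr -sumrMnl -!big_split; apply: eq_bigr => c _ /=.
  rewrite -!big_split !mulr_sumr -sumrMnl -!big_split; apply: eq_bigr => a _ /=.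
  rewrite -!big_split !mulr_sumr -sumrMnl -!big_split; apply: eq_bigr => b _ //=.
have rots F : s (fun c a b => F a b c) = s F by exact: rot.
have rots' F : s (fun c a b => F b c a) = s F by exact: etrans (rots (fun c a b => F a b c)) (rots F).
rewrite (rots F1) (rots F2) (rots F3) (rots' F1) (rots' F2) (rots' F3) /s S1 S2 S3.
have -> : n.+2%:R = n%:R + 2 :> S by rewrite -addn2 natrD.
ring.
Qed.

Theorem sphere_evolution : exists (T2 : S) (W : 'I_m -> 'I_m -> 'I_m -> S),
  [/\ Dt A2 - lap A2 =
        (A2 * A2) *+ 2 - (n%:R * K * A2) *+ 2 + (K * H * H) *+ 4 - T2 *+ 2,
      Dt (H * H) - lap (H * H) =
        (H * H * (A2 + n%:R * K)) *+ 2 - (\sum_c D c H * D c H) *+ 2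
    & \sum_c \sum_a \sum_b W c a b * W c a b =
        n.+2%:R * (n.+2%:R * T2 - (\sum_c D c H * D c H) *+ 3)].
Proof.
exists T2; exists W; split; [exact: heat_norm_sff|exact: heat_sqr_mean|exact: kato].
Qed.

End Evolution.

(** * The commutation rules derived from coordinate derivatives *)

Section TangentialDerivatives.
Variables (S : comPzRingType) (n : nat).
Notation m := n.+2.
Variables (d : 'I_n -> S -> S) (Dt : S -> S) (K : S) (x nu : 'I_m -> S).
Variable G : 'I_m -> 'I_n -> S.
Hypothesis dd : forall j, derivation (d j).
Hypothesis dDt : derivation Dt.
Hypothesis two_regular : forall f : S, f + f = 0 -> f = 0.
Hypothesis ddC : forall i j f, d i (d j f) = d j (d i f).
Hypothesis dDtC : forall i f, Dt (d i f) = d i (Dt f).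
Hypothesis dK : forall j, d j K = 0.
Hypothesis DtK : Dt K = 0.
Hypothesis xx : K * (\sum_a x a * x a) = 1.
Hypothesis nunu : \sum_a nu a * nu a = 1.
Hypothesis nux : \sum_a nu a * x a = 0.
Hypothesis FG : forall j k, \sum_c d j (x c) * G c k = (j == k)%:R.
Hypothesis GF : forall a b, \sum_j G a j * d j (x b) =
  (a == b)%:R - nu a * nu b - K * x a * x b.
Let D a f := \sum_j G a j * d j f.
Let A a b := D a (nu b).
Let H := \sum_a A a a.
Hypothesis Dtx : forall b, Dt (x b) = - H * nu b.

Lemma tangential_derivation a : derivation (D a).
Proof.
split=> f g; rewrite /D.
  by rewrite -big_split; apply: eq_bigr => j _; rewrite (derivationD (dd j)) mulrDr.
rewrite mulr_suml mulr_sumr -big_split; apply: eq_bigr => j _ /=.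
by rewrite (derivationM (dd j)); ring.
Qed.

Lemma d_of_D j f : d j f = \sum_c d j (x c) * D c f.
Proof.
transitivity (\sum_k (\sum_c d j (x c) * G c k) * d k f).
  under eq_bigr => k _ do rewrite FG.
  by rewrite (bigD1 j) //= eqxx mul1r big1 ?addr0 // => k /negPf; rewrite eq_sym => ->; rewrite mul0r.
under eq_bigr => k _ do rewrite mulr_suml.
rewrite exchange_big; apply: eq_bigr => c _; rewrite mulr_sumr.
by apply: eq_bigr => k _; rewrite mulrA.
Qed.

Let P a b : S := (a == b)%:R - nu a * nu b - K * x a * x b.

Lemma nuP b : \sum_a nu a * P a b = 0.
Proof.
transitivity (\sum_a ((b == a)%:R * nu a - nu b * (nu a * nu a) - K * x b * (nu a * x a))).
  by apply: eq_bigr => a _; rewrite /P eq_sym; ring.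
rewrite !(big_split, sumrN) /= sum_delta -!mulr_sumr nunu nux; ring.
Qed.

Lemma xP b : \sum_a x a * P a b = 0.
Proof.
transitivity (\sum_a ((b == a)%:R * x a - nu b * (nu a * x a) - x b * (K * (x a * x a)))).
  by apply: eq_bigr => a _; rewrite /P eq_sym; ring.
rewrite !(big_split, sumrN) /= sum_delta -!mulr_sumr xx nux; ring.
Qed.

(** [GF] and [FG] together give P G = G, so whatever annihilates [P] from the left annihilates
    [G]. *)
Lemma contractG (p : 'I_m -> S) k : (forall b, \sum_a p a * P a b = 0) ->
  \sum_a p a * G a k = 0.
Proof.
move=> pP.
transitivity (\sum_c (\sum_a p a * P a c) * G c k).
  under [RHS]eq_bigr => c _ do rewrite mulr_suml.
  rewrite [RHS]exchange_big; apply: eq_bigr => a _.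
  transitivity (p a * \sum_j G a j * (\sum_c d j (x c) * G c k)).
    under eq_bigr => j _ do rewrite FG.
    congr (_ * _); rewrite (bigD1 k) //= eqxx mulr1 big1 ?addr0 //.
    by move=> j /negPf ->; rewrite mulr0.
  rewrite mulr_sumr; under [LHS]eq_bigr => j _ do [rewrite 2!mulr_sumr].
  rewrite exchange_big; apply: eq_bigr => c _ /=.
  rewrite -[P a c]GF !(mulr_sumr, mulr_suml); apply: eq_bigr => j _; ring.
by rewrite big1 // => c _; rewrite pP mul0r.
Qed.

Lemma contractD (p : 'I_m -> S) f : (forall b, \sum_a p a * P a b = 0) ->
  \sum_a p a * D a f = 0.
Proof.
move=> pP; under eq_bigr => a _ do rewrite /D mulr_sumr.
rewrite exchange_big big1 //= => j _.
under eq_bigr => a _ do rewrite mulrA.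
by rewrite -mulr_suml contractG ?mul0r.
Qed.

Lemma normal_nuF j : \sum_b nu b * d j (x b) = 0.
Proof.
transitivity (\sum_c d j (x c) * (\sum_b nu b * P b c)); last first.
  by rewrite big1 // => c _; rewrite nuP mulr0.
transitivity (\sum_b nu b * \sum_c d j (x c) * D c (x b)).
  by apply: eq_bigr => b _; rewrite {1}d_of_D.
under eq_bigr => b _ do rewrite mulr_sumr.
rewrite exchange_big; apply: eq_bigr => c _; rewrite mulr_sumr; apply: eq_bigr => b _.
by rewrite /D GF /P [c == b]eq_sym; ring.
Qed.

Lemma DxE a b : D a (x b) = P a b. Proof. exact: GF. Qed.

(** Differentiating |nu|^2 = 1 yields twice this sum; this is what [two_regular] is for. *)
Lemma derivation_nunu E : derivation E -> \sum_a nu a * E (nu a) = 0.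
Proof.
move=> dE; apply: two_regular; rewrite -big_split /=.
transitivity (E (\sum_a nu a * nu a)); last by rewrite nunu (derivation1 dE).
by rewrite (derivation_sum dE); apply: eq_bigr => a _; rewrite (derivationM dE); ring.
Qed.

Lemma derivation_nux E : derivation E ->
  \sum_a x a * E (nu a) = - \sum_a nu a * E (x a).
Proof.
move=> dE; apply/eqP; rewrite -addr_eq0 -big_split /=.
apply/eqP; transitivity (E (\sum_a nu a * x a)); last by rewrite nux (derivation0 dE).
by rewrite (derivation_sum dE); apply: eq_bigr => a _; rewrite (derivationM dE); ring.
Qed.

Lemma decompose a (v : 'I_m -> S) :
  v a = \sum_b P a b * v b + nu a * (\sum_b nu b * v b) + K * x a * (\sum_b x b * v b).
Proof.
rewrite -{1}(sum_delta a v) !mulr_sumr -!big_split; apply: eq_bigr => b _ /=.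
by rewrite /P; ring.
Qed.

Lemma contractP a (v : 'I_m -> S) :
  \sum_b P a b * v b = \sum_j G a j * (\sum_b d j (x b) * v b).
Proof.
under eq_bigr => b _ do rewrite -[P a b]GF mulr_suml.
rewrite exchange_big; apply: eq_bigr => j _; rewrite mulr_sumr.
by apply: eq_bigr => b _; rewrite mulrA.
Qed.

(** Differentiating nu . d_i x = 0 moves the derivative from nu to d_i x, where mixed derivatives
    commute. *)
Lemma second_form_sym j k :
  \sum_b d k (x b) * d j (nu b) = \sum_b d j (x b) * d k (nu b).
Proof.
have key i l : \sum_b d i (x b) * d l (nu b) = - \sum_b nu b * d l (d i (x b)).
  apply/eqP; rewrite -addr_eq0 -big_split /=; apply/eqP.
  transitivity (d l (\sum_b nu b * d i (x b))).
    rewrite (derivation_sum (dd l)); apply: eq_bigr => b _.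
    by rewrite (derivationM (dd l)); ring.
  by rewrite normal_nuF (derivation0 (dd l)).
by rewrite !key; congr (- _); apply: eq_bigr => b _; rewrite ddC.
Qed.

Lemma d_nu j b : d j (nu b) = \sum_k G b k * (\sum_c d k (x c) * d j (nu c)).
Proof.
rewrite {1}(decompose b (fun c => d j (nu c))) derivation_nunu // derivation_nux //.
by rewrite normal_nuF contractP; ring.
Qed.

Lemma shape_sym a b : A a b = A b a.
Proof.
rewrite /A /D.
under eq_bigr => j _ do rewrite d_nu mulr_sumr.
rewrite exchange_big; apply: eq_bigr => k _ /=; rewrite d_nu mulr_sumr.
by apply: eq_bigr => j _; rewrite second_form_sym; ring.
Qed.

(** This avoids differentiating the inverse metric inside [G]: by [d_of_D] only the products E(G) .
    dx occur, and Leibniz applied to G . dx = P expresses them through E(P) and E(dx). *)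
Lemma derivation_D (E : S -> S) b f : derivation E ->
  E (D b f) = \sum_j G b j * E (d j f)
    + \sum_c (E (P b c) - \sum_j G b j * E (d j (x c))) * D c f.
Proof.
move=> dE; rewrite /D (derivation_sum dE).
under eq_bigr => j _ do rewrite (derivationM dE) addrC.
rewrite big_split /=; congr (_ + _).
transitivity (\sum_c (\sum_j E (G b j) * d j (x c)) * D c f).
  under [RHS]eq_bigr => c _ do rewrite mulr_suml.
  rewrite [RHS]exchange_big; apply: eq_bigr => j _; rewrite d_of_D mulr_sumr.
  by apply: eq_bigr => c _; rewrite mulrA.
apply: eq_bigr => c _; congr (_ * _).
rewrite -[P b c]GF (derivation_sum dE) -sumrB; apply: eq_bigr => j _.
by rewrite (derivationM dE); ring.
Qed.

Lemma nuDf f : \sum_a nu a * D a f = 0.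
Proof. by apply: contractD => b; exact: nuP. Qed.

Lemma xDf f : \sum_a x a * D a f = 0.
Proof. by apply: contractD => b; exact: xP. Qed.

Lemma PDf a f : \sum_c P a c * D c f = D a f.
Proof.
by rewrite [RHS](decompose a (D ^~ f)) nuDf xDf; ring.
Qed.

Lemma D_K a : D a K = 0.
Proof. by rewrite /D big1 // => j _; rewrite dK mulr0. Qed.

Lemma D_P a b c : D a (P b c) = - (A a b * nu c) - nu b * A a c
  - K * P a b * x c - K * x b * P a c.
Proof.
have da := tangential_derivation a.
rewrite {1}/P !(derivationB da) !(derivationM da) (derivation_nat da) D_K !DxE -!/(A _ _).
ring.
Qed.

Lemma D_comm a b f : D a (D b f) = D b (D a f)
  + nu a * (\sum_c A b c * D c f) - nu b * (\sum_c A a c * D c f)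
  + K * (x a * D b f - x b * D a f).
Proof.
have da := tangential_derivation a; have db := tangential_derivation b.
have Q g : \sum_j G a j * D b (d j g) = \sum_j G b j * D a (d j g).
  under eq_bigr => j _ do rewrite /D mulr_sumr.
  rewrite exchange_big; apply: eq_bigr => k _ /=; rewrite /D mulr_sumr.
  by apply: eq_bigr => j _; rewrite ddC; ring.
rewrite (derivation_D b f da) (derivation_D a f db) Q -!addrA; congr (_ + _).
(* [u] and [v] multiply the vanishing sums [nuDf] and [xDf]; adding them makes the identity hold
   summand by summand, without the symmetry of [A] and [P]. They are kept opaque so that
   distributing over the sums leaves them intact. *)
have [u Eu] : exists u, u = A b a - A a b by eexists.
have [v Ev] : exists v, v = K * (P b a - P a b) by eexists.
transitivity (\sum_c (D b (P a c) - \sum_j G a j * D b (d j (x c))) * D c f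
  + nu a * (\sum_c A b c * D c f) - nu b * (\sum_c A a c * D c f)
  + K * x a * (\sum_c P b c * D c f) - K * x b * (\sum_c P a c * D c f)
  + u * (\sum_c nu c * D c f) + v * (\sum_c x c * D c f)); last first.
  by rewrite nuDf xDf !PDf; ring.
rewrite !mulr_sumr -!sumrN -!big_split; apply: eq_bigr => c _ /=.
by rewrite Q !D_P Eu Ev; ring.
Qed.

Lemma Dt_nu b : Dt (nu b) = D b H + K * H * x b.
Proof.
rewrite (decompose b (fun c => Dt (nu c))) derivation_nunu // derivation_nux //.
rewrite contractP.
have -> : \sum_c nu c * Dt (x c) = - H.
  under eq_bigr => c _ do rewrite Dtx mulrCA.
  by rewrite -mulr_sumr nunu mulr1.
(* The tangential part of [Dt nu] comes from differentiating nu . d_j x = 0 in time, with [Dtx] for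
   the velocity. *)
have key j : \sum_c d j (x c) * Dt (nu c) = d j H.
  transitivity (Dt (\sum_c nu c * d j (x c)) - \sum_c nu c * Dt (d j (x c))).
    rewrite (derivation_sum dDt) -sumrB; apply: eq_bigr => c _.
    by rewrite (derivationM dDt); ring.
  rewrite normal_nuF (derivation0 dDt) sub0r.
  transitivity (d j H * (\sum_c nu c * nu c) + H * \sum_c nu c * d j (nu c)).
    rewrite !mulr_sumr -big_split -sumrN; apply: eq_bigr => c _ /=.
    by rewrite dDtC Dtx (derivationM (dd j)) (derivationN (dd j)); ring.
  by rewrite nunu derivation_nunu // mulr1 mulr0 addr0.
under eq_bigr => j _ do rewrite key.
rewrite -/(D b H); ring.
Qed.

Lemma Dt_D a f : Dt (D a f) = D a (Dt f)
  + H * (\sum_c A a c * D c f) - nu a * (\sum_c D c H * D c f).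
Proof.
rewrite (derivation_D a f dDt).
under eq_bigr => j _ do rewrite dDtC.
rewrite -/(D a (Dt f)) -!addrA; congr (_ + _).
have E c : \sum_j G a j * Dt (d j (x c)) = - (D a H * nu c) - H * A a c.
  under eq_bigr => j _ do rewrite dDtC.
  rewrite -/(D a (Dt (x c))) Dtx (derivationM (tangential_derivation a)).
  by rewrite (derivationN (tangential_derivation a)) -/(A a c); ring.
rewrite !mulr_sumr -sumrB; apply: eq_bigr => c _ /=.
rewrite E /P !(derivationB dDt) !(derivationM dDt) (derivation_nat dDt) DtK.
rewrite !Dt_nu !Dtx; ring.
Qed.

Let A2 := \sum_a \sum_b A a b * A a b.
Let lap f := \sum_c D c (D c f).

Theorem mcf_evolution : exists (T2 : S) (W : 'I_m -> 'I_m -> 'I_m -> S),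
  [/\ Dt A2 - lap A2 =
        (A2 * A2) *+ 2 - (n%:R * K * A2) *+ 2 + (K * H * H) *+ 4 - T2 *+ 2,
      Dt (H * H) - lap (H * H) =
        (H * H * (A2 + n%:R * K)) *+ 2 - (\sum_c D c H * D c H) *+ 2
    & \sum_c \sum_a \sum_b W c a b * W c a b =
        n.+2%:R * (n.+2%:R * T2 - (\sum_c D c H * D c H) *+ 3)].
Proof.
exact (@sphere_evolution S n D Dt K x nu tangential_derivation dDt D_K xx nunu nux GF shape_sym nuDf xDf D_comm Dt_D Dt_nu).
Qed.

End TangentialDerivatives.

(** * Smooth functions *)

Section FiniteOrder.
Context {R : realType} {V : normedModType R}.
Implicit Types (U : set V) (f g : V -> R) (k : nat).

(** [smooth_on] quantifies over lists of directions, along which products and inverses have no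
    convenient closed formula. Recursion on the order makes closure properties provable by
    induction. *)
Fixpoint Ck k U f : Prop :=
  (forall x, U x -> {for x, continuous f}) /\
  if k is k'.+1 then
    forall v, (forall x, U x -> derivable f x v) /\ Ck k' U ('D_v f)
  else True.

Lemma smooth_onD {W : normedModType R} U (f : V -> W) v :
  smooth_on U f -> smooth_on U ('D_v f).
Proof.
move=> sf vs x Ux; have := sf (rcons vs v) x Ux.
by rewrite /iter_derive foldr_rcons.
Qed.

Lemma smooth_onW {W : normedModType R} U U' (f : V -> W) :
  U' `<=` U -> smooth_on U f -> smooth_on U' f.
Proof. by move=> sub sf vs x Ux; apply: sf; exact: sub. Qed.

Lemma smooth_on_continuous {W : normedModType R} U (f : V -> W) x :
  smooth_on U f -> U x -> {for x, continuous f}.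
Proof. by move=> sf Ux; have [] := sf [::] x Ux. Qed.

Lemma smooth_on_derivable {W : normedModType R} U (f : V -> W) x v :
  smooth_on U f -> U x -> derivable f x v.
Proof. by move=> sf Ux; have [_] := sf [::] x Ux; exact. Qed.

Lemma smooth_onP U f : smooth_on U f <-> forall k, Ck k U f.
Proof.
split=> [sf k|].
  elim: k f sf => [|k IH] f sf; split => //; try by move=> x; exact: smooth_on_continuous.
  move=> v; split; first by move=> x; exact: smooth_on_derivable.
  by apply: IH; exact: smooth_onD.
(* [Ck] peels off the innermost derivative, which is the last direction in the list. *)
move=> cf vs; elim/last_ind: vs f cf => [|vs v IH] f cf x Ux.
  split; first by have [h _] := cf 0%N; exact: h.
  by move=> v; have [_ /(_ v)[h _]] := cf 1%N; exact: h.
rewrite /iter_derive foldr_rcons; apply: IH Ux => k.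
by have [_ /(_ v)[]] := cf k.+1.
Qed.

Lemma near_eq_on U f g x : open U -> {in U, f =1 g} -> U x -> \forall y \near x, f y = g y.
Proof.
move=> oU fg Ux; apply: filterS (open_nbhs_nbhs (conj oU Ux)) => y Uy.
by apply: fg; rewrite inE.
Qed.

Lemma near_eq_continuous {T S : topologicalType} (f g : T -> S) x :
  (\forall y \near x, f y = g y) -> {for x, continuous f} -> {for x, continuous g}.
Proof.
move=> fg cf; rewrite /prop_for /continuous_at -(nbhs_singleton fg).
apply: cvg_trans cf; apply: near_eq_cvg.
by apply: filterS fg => y ->.
Qed.

Lemma Ck_ext k U f g : open U -> {in U, f =1 g} -> Ck k U f -> Ck k U g.
Proof.
move=> oU; elim: k f g => [|k IH] f g fg [cf df].
  by split=> // x Ux; apply: near_eq_continuous (cf x Ux); exact: near_eq_on Ux.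
split=> [x Ux|v]; first by apply: near_eq_continuous (cf x Ux); exact: near_eq_on Ux.
have [dfv cdf] := df v; split=> [x Ux|].
  by apply: near_eq_derivable (dfv x Ux); exact: near_eq_on Ux.
apply: IH cdf => x; rewrite inE => Ux.
by apply: near_eq_derive; exact: near_eq_on Ux.
Qed.

Lemma Ck_pred k U f : Ck k.+1 U f -> Ck k U f.
Proof.
elim: k f => [|k IH] f [cf df]; first by split.
by split=> // v; have [dv c] := df v; split=> //; exact: IH.
Qed.

Lemma Ck_cst k U c : open U -> Ck k U (cst c).
Proof.
move=> oU; elim: k c => [|k IH] c; split=> //; try by move=> x _; exact: cst_continuous.
move=> v; split; first by move=> x _; exact: derivable_cst.
by apply: (Ck_ext oU _ (IH 0)) => x _; rewrite derive_cst.
Qed.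

Lemma Ck_add k U f g : open U -> Ck k U f -> Ck k U g -> Ck k U (f + g).
Proof.
move=> oU; elim: k f g => [|k IH] f g [cf df] [cg dg].
  by split=> // x Ux; apply: continuousD; [exact: cf|exact: cg].
split=> [x Ux|v]; first by apply: continuousD; [exact: cf|exact: cg].
have [dfv cdf] := df v; have [dgv cdg] := dg v.
split=> [x Ux|]; first by apply: derivableD; [exact: dfv|exact: dgv].
apply: (Ck_ext oU _ (IH _ _ cdf cdg)) => x; rewrite inE => Ux.
by rewrite deriveD //; [exact: dfv|exact: dgv].
Qed.

Lemma Ck_mul k U f g : open U -> Ck k U f -> Ck k U g -> Ck k U (f * g).
Proof.
move=> oU; elim: k f g => [|k IH] f g Cf Cg; have [cf df] := Cf; have [cg dg] := Cg.
  by split=> // x Ux; apply: continuousM; [exact: cf|exact: cg].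
split=> [x Ux|v]; first by apply: continuousM; [exact: cf|exact: cg].
have [dfv cdf] := df v; have [dgv cdg] := dg v.
split=> [x Ux|]; first by apply: derivableM; [exact: dfv|exact: dgv].
apply: (Ck_ext oU _ (Ck_add oU (IH _ _ (Ck_pred Cf) cdg) (IH _ _ (Ck_pred Cg) cdf))) => x.
by rewrite inE => Ux; rewrite deriveM //; [exact: dfv|exact: dgv].
Qed.

Lemma Ck_inv k U f : open U -> (forall x, U x -> f x != 0) -> Ck k U f ->
  Ck k U (fun x => (f x)^-1).
Proof.
move=> oU f0; elim: k => [|k IH] Cf; have [cf df] := Cf.
  by split=> // x Ux; apply: (@cvgV _ _ _ _ f); [exact: f0|exact: cf].
split=> [x Ux|v]; first by apply: (@cvgV _ _ _ _ f); [exact: f0|exact: cf].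
have [dfv cdf] := df v.
split=> [x Ux|]; first by apply: derivableV; [exact: f0|exact: dfv].
have Ci := IH (Ck_pred Cf).
apply: (Ck_ext oU _ (Ck_mul oU (Ck_mul oU (Ck_cst k (- 1) oU) (Ck_mul oU Ci Ci)) cdf)) => x.
rewrite inE => Ux; rewrite deriveV //; [|exact: f0|exact: dfv].
by rewrite -[LHS]/(- 1 * ((f x)^-1 * (f x)^-1) * 'D_v f x) mulN1r -expr2 exprVn.
Qed.

Lemma derive_line {W : normedModType R} (f : V -> W) x v :
  'D_v f x = 'D_1 (fun h : R => f (h *: v + x)) 0.
Proof.
rewrite /derive; set g1 := fun h => h^-1 *: _; set g2 := fun h => h^-1 *: _.
suff -> : g1 = g2 by [].
by rewrite funeqE /g1 /g2 => h /=; rewrite addr0 scale0r add0r [_%:A]mulr1.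
Qed.

Lemma is_derive_sqrt f x v : 0 < f x -> derivable f x v ->
  is_derive x v (fun y => Num.sqrt (f y)) ((2 * Num.sqrt (f x))^-1 * 'D_v f x).
Proof.
move=> f0 df; have dl := (derivable1P _ _ _).1 df.
have d0 : is_derive (0 : R) 1 (fun h : R => f (h *: v + x)) ('D_v f x).
  by rewrite derive_line; exact: derivableP.
have ds : is_derive (f (0 *: v + x)) 1 Num.sqrt (2 * Num.sqrt (f x))^-1.
  by rewrite scale0r add0r; exact: is_derive1_sqrt.
have [h1 h2] := @is_derive1_comp _ _ _ _ _ _ ds d0.
split; first exact/derivable1P.
by rewrite derive_line.
Qed.

Lemma Ck_sqrt k U f : open U -> (forall x, U x -> 0 < f x) -> Ck k U f ->
  Ck k U (fun x => Num.sqrt (f x)).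
Proof.
move=> oU f0; elim: k => [|k IH] Cf; have [cf df] := Cf.
  by split=> // x Ux; apply: continuous_comp; [exact: cf|exact: sqrt_continuous].
split=> [x Ux|v]; first by apply: continuous_comp; [exact: cf|exact: sqrt_continuous].
have [dfv cdf] := df v.
split=> [x Ux|]; first by case: (is_derive_sqrt (f0 x Ux) (dfv x Ux)).
have Ci := IH (Ck_pred Cf).
have C2 : Ck k U (fun x => (2 * Num.sqrt (f x))^-1).
  apply: Ck_inv => //; last exact: (Ck_mul oU (Ck_cst k 2 oU) Ci).
  by move=> x Ux; rewrite mulf_neq0 // gt_eqF // sqrtr_gt0 f0.
apply: (Ck_ext oU _ (Ck_mul oU C2 cdf)) => x; rewrite inE => Ux.
by case: (is_derive_sqrt (f0 x Ux) (dfv x Ux)) => _ ->.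
Qed.

End FiniteOrder.

Section SmoothClosure.
Context {R : realType} {V : normedModType R} (U : set V).
Hypothesis oU : open U.
Implicit Types f g : V -> R.

Lemma smooth_on_ext {W : normedModType R} (f g : V -> W) :
  {in U, f =1 g} -> smooth_on U f -> smooth_on U g.
Proof.
move=> fg sf.
have near_U x : U x -> nbhs x U by move=> Ux; exact: open_nbhs_nbhs.
have E vs x : U x -> iter_derive f vs x = iter_derive g vs x.
  elim: vs x => [|v vs IH] x Ux; first by apply: fg; rewrite inE.
  by rewrite /=; apply: near_eq_derive; apply: filterS (near_U x Ux) => y; exact: IH.
move=> vs x Ux; have [cf df] := sf vs x Ux.
have nE : \forall y \near x, iter_derive f vs y = iter_derive g vs y.
  by apply: filterS (near_U x Ux) => y; exact: E.
split; first exact: near_eq_continuous cf.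
by move=> v; exact: near_eq_derivable (df v).
Qed.

Lemma smooth_on_cst (c : R) : smooth_on U (cst c).
Proof. by apply/smooth_onP => k; exact: Ck_cst. Qed.

Lemma smooth_on_add f g : smooth_on U f -> smooth_on U g -> smooth_on U (f + g).
Proof. by move=> /smooth_onP sf /smooth_onP sg; apply/smooth_onP => k; exact: Ck_add. Qed.

Lemma smooth_on_mul f g : smooth_on U f -> smooth_on U g -> smooth_on U (f * g).
Proof. by move=> /smooth_onP sf /smooth_onP sg; apply/smooth_onP => k; exact: Ck_mul. Qed.

Lemma smooth_on_opp f : smooth_on U f -> smooth_on U (- f).
Proof.
move=> sf; apply: (smooth_on_ext _ (smooth_on_mul (smooth_on_cst (- 1)) sf)) => x _.
by rewrite -[LHS]/(- 1 * f x) mulN1r.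
Qed.

Lemma smooth_on_inv f : (forall x, U x -> f x != 0) -> smooth_on U f ->
  smooth_on U (fun x => (f x)^-1).
Proof. by move=> f0 /smooth_onP sf; apply/smooth_onP => k; exact: Ck_inv. Qed.

Lemma smooth_on_sqrt f : (forall x, U x -> 0 < f x) -> smooth_on U f ->
  smooth_on U (fun x => Num.sqrt (f x)).
Proof. by move=> f0 /smooth_onP sf; apply/smooth_onP => k; exact: Ck_sqrt. Qed.

Lemma smooth_on_sum I (r : seq I) (P : pred I) (F : I -> V -> R) :
  (forall i, P i -> smooth_on U (F i)) -> smooth_on U (fun z => \sum_(i <- r | P i) F i z).
Proof.
move=> sF; elim: r => [|i r IH].
  by apply: (smooth_on_ext _ (smooth_on_cst 0)) => z _; rewrite big_nil.
case: (boolP (P i)) => Pi; last first.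
  by apply: (smooth_on_ext _ IH) => z _; rewrite big_cons (negPf Pi).
by apply: (smooth_on_ext _ (smooth_on_add (sF i Pi) IH)) => z _; rewrite big_cons Pi.
Qed.

Lemma smooth_on_prod I (r : seq I) (P : pred I) (F : I -> V -> R) :
  (forall i, P i -> smooth_on U (F i)) -> smooth_on U (fun z => \prod_(i <- r | P i) F i z).
Proof.
move=> sF; elim: r => [|i r IH].
  by apply: (smooth_on_ext _ (smooth_on_cst 1)) => z _; rewrite big_nil.
case: (boolP (P i)) => Pi; last first.
  by apply: (smooth_on_ext _ IH) => z _; rewrite big_cons (negPf Pi).
by apply: (smooth_on_ext _ (smooth_on_mul (sF i Pi) IH)) => z _; rewrite big_cons Pi.
Qed.

End SmoothClosure.

Lemma smooth_on_coord {R : realType} {V : normedModType R} (U : set V) m n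
    (F : V -> 'M[R]_(m, n)) i j :
  open U -> smooth_on U F -> smooth_on U (fun z => F z i j).
Proof.
move=> oU sF; apply/smooth_onP => k; elim: k F sF => [|k IH] F sF.
  split=> // x Ux; apply: (@continuous_comp _ _ _ F (fun M : 'M[R]_(m, n) => M i j)).
    exact: smooth_on_continuous Ux.
  exact: coord_continuous.
split=> [x Ux|v].
  apply: (@continuous_comp _ _ _ F (fun M : 'M[R]_(m, n) => M i j)).
    exact: smooth_on_continuous Ux.
  exact: coord_continuous.
split=> [x Ux|]; first by have /derivable_mxP := @smooth_on_derivable _ _ _ U F x v sF Ux; exact.
apply: (Ck_ext oU _ (IH _ (smooth_onD v sF))) => x; rewrite inE => Ux.
by rewrite derive_mx ?mxE //; exact: smooth_on_derivable Ux.
Qed.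

(** * Directional calculus *)

Section DirectionalCalculus.
Context {R : realType} {V : normedModType R}.
Implicit Types (U : set V) (f g : V -> R) (x v w : V).

Lemma is_derive_along f x v (s : R) : derivable f (x + s *: v) v ->
  is_derive s 1 (fun t : R => f (x + t *: v)) ('D_v f (x + s *: v)).
Proof.
move=> df.
have E : (fun h : R => h^-1 *: (((fun t : R => f (x + t *: v)) \o shift s) (h *: (1 : R)) - f (x + s *: v)))
       = (fun h : R => h^-1 *: ((f \o shift (x + s *: v)) (h *: v) - f (x + s *: v))).
  apply/funext => h /=; congr (_ *: (f _ - _)).
  by rewrite [_%:A]mulr1 scalerDl addrCA.
by split; rewrite /derivable /derive E.
Qed.

Lemma is_derive_dirZ f x v (c : R) : derivable f x v ->
  is_derive x (c *: v) f (c * 'D_v f x).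
Proof.
move=> df.
have d0 : is_derive (c * 0) 1 (fun t : R => f (x + t *: v)) ('D_v f x).
  have E0 : x = x + (c * 0) *: v by rewrite mulr0 scale0r addr0.
  by rewrite {2}E0; apply: is_derive_along; rewrite -E0.
have d1 : is_derive (0 : R) 1 (fun t : R => c * t) c.
  have := @is_deriveZ _ _ _ (@id R) c 0 1 1 (is_derive_id _ _).
  by rewrite [_%:A]mulr1.
have [h1 h2] := @is_derive1_comp _ _ _ _ _ _ d0 d1.
have E : ((fun t : R => f (x + t *: v)) \o (fun t : R => c * t))
       = (fun h : R => f (h *: (c *: v) + x)).
  by apply/funext => h /=; rewrite scalerA [c * h]mulrC addrC.
rewrite E in h1 h2.
by split; [exact/derivable1P|rewrite derive_line h2 mulrC].
Qed.

Lemma dir_MVT f x v : (forall s : R, 0 <= s <= 1 -> derivable f (x + s *: v) v) ->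
  exists2 s : R, 0 < s < 1 & f (x + v) - f x = 'D_v f (x + s *: v).
Proof.
move=> df; pose phi (s : R) := f (x + s *: v).
have dphi (s : R) : 0 <= s <= 1 -> is_derive s 1 phi ('D_v f (x + s *: v)).
  by move=> s01; apply: is_derive_along; exact: df.
have cphi : {within `[0, 1], continuous phi}.
  apply: derivable_within_continuous => s; rewrite in_itv /= => s01.
  by have [] := dphi s s01.
have [|s s01] := @MVT R phi (fun s => 'D_v f (x + s *: v)) 0 1 ltr01 _ cphi.
  move=> s; rewrite in_itv /= => /andP[s0 s1].
  by apply: dphi; rewrite !ltW.
move: s01; rewrite in_itv /= => s01.
rewrite /phi scale1r scale0r addr0 subr0 mulr1 => E.
by exists s.
Qed.

Lemma dir_MVTZ f x v (h : R) :
  (forall s : R, 0 <= s <= 1 -> derivable f (x + (s * h) *: v) v) ->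
  exists2 s : R, 0 < s < 1 & f (x + h *: v) - f x = h * 'D_v f (x + (s * h) *: v).
Proof.
move=> df.
have dfh (s : R) : 0 <= s <= 1 -> is_derive (x + s *: (h *: v)) (h *: v) f
    (h * 'D_v f (x + (s * h) *: v)).
  by move=> s01; rewrite scalerA; apply: is_derive_dirZ; exact: df.
have [s s01 E] := dir_MVT (fun s s01 => @ex_derive _ _ _ _ _ _ _ (dfh s s01)).
exists s => //; rewrite E.
by apply: derive_val; apply: dfh; case/andP: s01 => *; rewrite !ltW.
Qed.

Lemma nbhs_ball_norm x (P : set V) : nbhs x P ->
  exists2 d : R, 0 < d & forall y, `|y - x| < d -> P y.
Proof.
move=> /nbhs_ballP[d /= d0 sub]; exists d => // y yx; apply: sub.
by rewrite -ball_normE /= distrC.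
Qed.

(** A positive derivative at x stays positive nearby by continuity, so the mean value theorem would
    make f increase along v. Only s > 0 is tested, so the lemma also serves for the backward time
    direction. *)
Lemma one_sided_max f x v : (\forall y \near x, derivable f y v) ->
  {for x, continuous ('D_v f)} ->
  (\forall s \near 0^'+, f (x + s *: v) <= f x) -> 'D_v f x <= 0.
Proof.
move=> df cf fm; rewrite leNgt; apply/negP => D0.
have near_pos : \forall y \near x, derivable f y v /\ 0 < 'D_v f y.
  by apply: filterS2 df (cvgr_gt _ cf _ D0).
have [d d0 hd] := nbhs_ball_norm near_pos.
near (0 : R)^'+ => s.
have s0 : 0 < s by near: s; exact: nbhs_right_gt.
have fs : f (x + s *: v) <= f x by near: s.
have sd : s * `|v| < d.
  near: s; have [->|v0] := eqVneq v 0; first by near=> s; rewrite normr0 mulr0.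
  have vp : 0 < `|v| by rewrite normr_gt0.
  near=> s; rewrite -ltr_pdivlMr //; near: s; apply: nbhs_right_lt; exact: divr_gt0.
have inb (t : R) : 0 <= t <= 1 -> `|x + (t * s) *: v - x| < d.
  move=> /andP[t0 t1]; rewrite addrAC subrr add0r normrZ ger0_norm ?mulr_ge0 // ?ltW //.
  by apply: le_lt_trans sd; rewrite ler_wpM2r // ler_piMl // ltW.
have dfs (t : R) : 0 <= t <= 1 -> derivable f (x + (t * s) *: v) v.
  by move=> t01; have [] := hd _ (inb t t01).
have [t t01 E] := dir_MVTZ dfs.
have t01' : 0 <= t <= 1 by case/andP: t01 => *; rewrite !ltW.
have [_ Dp] := hd _ (inb t t01').
by move: fs; rewrite -subr_le0 E leNgt mulr_gt0.
Unshelve. all: by end_near. Qed.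

(** The first derivative vanishes by testing v and -v. For the second, the mean value theorem
    applied to f and then to ['D_v f] replaces Taylor's formula. *)
Lemma second_order_max U f x v : open U -> smooth_on U f -> U x ->
  (\forall s \near (0 : R), f (x + s *: v) <= f x) ->
  'D_v f x = 0 /\ 'D_v ('D_v f) x <= 0.
Proof.
move=> oU sf Ux fm.
have nU : \forall y \near x, U y := open_nbhs_nbhs (conj oU Ux).
have df w : \forall y \near x, derivable f y w.
  by apply: filterS nU => y; exact: smooth_on_derivable.
have cf w : {for x, continuous ('D_w f)}.
  by apply: smooth_on_continuous Ux; exact: smooth_onD.
have Dle w : (\forall s \near (0 : R), f (x + s *: w) <= f x) -> 'D_w f x <= 0.
  move=> h; apply: one_sided_max => //.
  exact: cvg_within h.
have D0 : 'D_v f x = 0.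
  apply/eqP; rewrite eq_le Dle //=.
  have : 'D_(-1 *: v) f x <= 0.
    apply: Dle; have : (fun s : R => - s) @ 0 --> (0 : R).
      by have := @opp_continuous R 0; rewrite /continuous_at oppr0.
    by move=> /(_ _ fm); rewrite nbhs_simpl /=; apply: filterS => s; rewrite scalerA mulrN1.
  have [_ ->] := is_derive_dirZ (-1) (smooth_on_derivable (v := v) sf Ux).
  by rewrite mulN1r oppr_le0.
split=> //; rewrite leNgt; apply/negP => D2.
have c2 : {for x, continuous ('D_v ('D_v f))}.
  by apply: smooth_on_continuous Ux; do 2 apply: smooth_onD.
have near_pos : \forall y \near x, U y /\ 0 < 'D_v ('D_v f) y.
  exact: filterS2 nU (cvgr_gt _ c2 _ D2).
have [d d0 hd] := nbhs_ball_norm near_pos.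
near (0 : R)^'+ => s.
have s0 : 0 < s by near: s; exact: nbhs_right_gt.
have fs : f (x + s *: v) <= f x by near: s; exact: cvg_within fm.
have sd : s * `|v| < d.
  near: s; have [->|v0] := eqVneq v 0; first by near=> s; rewrite normr0 mulr0.
  have vp : 0 < `|v| by rewrite normr_gt0.
  near=> s; rewrite -ltr_pdivlMr //; near: s; apply: nbhs_right_lt; exact: divr_gt0.
have inb (t : R) : 0 <= t <= 1 -> `|x + (t * s) *: v - x| < d.
  move=> /andP[t0 t1]; rewrite addrAC subrr add0r normrZ ger0_norm ?mulr_ge0 // ?ltW //.
  by apply: le_lt_trans sd; rewrite ler_wpM2r // ler_piMl // ltW.
have dfs (t : R) : 0 <= t <= 1 -> derivable f (x + (t * s) *: v) v.
  by move=> t01; have [Uy _] := hd _ (inb t t01); exact: smooth_on_derivable Uy.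
have [t /andP[t0 t1] E] := dir_MVTZ dfs.
have ts0 : 0 < t * s by exact: mulr_gt0.
have rg (r : R) : 0 <= r <= 1 -> 0 <= r * t <= 1.
  by move=> /andP[r0 r1]; rewrite mulr_ge0 ?(ltW t0) //= mulr_ile1 // ltW.
have dds (r : R) : 0 <= r <= 1 -> derivable ('D_v f) (x + (r * (t * s)) *: v) v.
  move=> /rg r01; rewrite mulrA; have [Uy _] := hd _ (inb _ r01).
  by apply: smooth_on_derivable Uy; exact: smooth_onD.
have [r /andP[r0 r1] E2] := dir_MVTZ dds.
have r01 : 0 <= r <= 1 by rewrite !ltW.
have [_] := hd _ (inb _ (rg _ r01)); rewrite -mulrA => Dp.
move: E2; rewrite D0 subr0 => E2.
by move: fs; rewrite -subr_le0 E E2 leNgt !mulr_gt0.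
Unshelve. all: by end_near. Qed.

Lemma second_difference U f x v w (h : R) : smooth_on U f ->
  (forall s t : R, 0 <= s <= 1 -> 0 <= t <= 1 -> U (x + (s * h) *: v + (t * h) *: w)) ->
  exists s t : R, [/\ 0 <= s <= 1, 0 <= t <= 1 &
    f (x + h *: v + h *: w) - f (x + h *: v) - f (x + h *: w) + f x =
    h * h * 'D_w ('D_v f) (x + (s * h) *: v + (t * h) *: w)].
Proof.
move=> sf hU.
have i01 (s : R) : 0 < s < 1 -> 0 <= s <= 1 by case/andP=> *; rewrite !ltW.
pose psi z := f (z + h *: w) - f z.
have shift_derive (s : R) : 0 <= s <= 1 -> is_derive (x + (s * h) *: v) v psi
    ('D_v f (x + (s * h) *: v + h *: w) - 'D_v f (x + (s * h) *: v)).
  move=> s01.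
  have d1 : is_derive (x + (s * h) *: v) v (fun z => f (z + h *: w)) ('D_v f (x + (s * h) *: v + h *: w)).
    have dz : derivable f (x + (s * h) *: v + h *: w) v.
      apply: (smooth_on_derivable sf); have := hU s 1 s01; rewrite mul1r; apply.
      by rewrite ler01 lexx.
    set z0 := x + (s * h) *: v in dz *.
    have E : (fun k : R => k^-1 *: (((fun z => f (z + h *: w)) \o shift z0) (k *: v) - f (z0 + h *: w)))
       = (fun k : R => k^-1 *: ((f \o shift (z0 + h *: w)) (k *: v) - f (z0 + h *: w))).
      by apply/funext => k /=; congr (_ *: (f _ - _)); exact/esym/addrA.
    by split; rewrite /derivable /derive E.
  have d2 : is_derive (x + (s * h) *: v) v f ('D_v f (x + (s * h) *: v)).
    apply: derivableP; apply: (smooth_on_derivable sf).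
    by have := hU s 0 s01; rewrite mul0r scale0r addr0; apply; rewrite ler01 lexx.
  exact: is_deriveB.
have [s s01 E] := dir_MVTZ (fun s s01 => @ex_derive _ _ _ _ _ _ _ (shift_derive s s01)).
have s01' := i01 _ s01.
have dw (t : R) : 0 <= t <= 1 -> derivable ('D_v f) (x + (s * h) *: v + (t * h) *: w) w.
  move=> t01; apply: (smooth_on_derivable (smooth_onD v sf)); exact: hU.
have [t t01 E2] := dir_MVTZ dw.
exists s, t; split=> //; first exact: i01.
rewrite -mulrA -E2; have [_ <-] := shift_derive s s01'; rewrite -E /psi.
by rewrite [x + h *: v + h *: w]addrAC; ring.
Qed.

(** Schwarz's theorem: the second difference over a parallelogram is symmetric in v and w, so the
    two mixed derivatives agree at suitable points near x, and continuity carries the equality to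
    x. *)
Lemma derive_comm U f x v w : open U -> smooth_on U f -> U x ->
  'D_v ('D_w f) x = 'D_w ('D_v f) x.
Proof.
move=> oU sf Ux.
apply/eqP; rewrite -subr_eq0 -normr_le0; apply/ler_addgt0Pr => e e0; rewrite add0r.
have e2 : 0 < e / 2 by exact: divr_gt0.
have cD a b : {for x, continuous ('D_a ('D_b f))}.
  by apply: smooth_on_continuous Ux; do 2 apply: smooth_onD.
have near_all : \forall y \near x, [/\ U y, `|'D_v ('D_w f) x - 'D_v ('D_w f) y| < e / 2
    & `|'D_w ('D_v f) x - 'D_w ('D_v f) y| < e / 2].
  have nU : \forall y \near x, U y := open_nbhs_nbhs (conj oU Ux).
  have n1 a b : \forall y \near x, `|'D_a ('D_b f) x - 'D_a ('D_b f) y| < e / 2.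
    by have /cvgrPdist_lt := cD a b; apply.
  by apply: filterS2 nU (filterI (n1 v w) (n1 w v)) => y Uy [].
have [d d0 hd] := nbhs_ball_norm near_all.
(* A step for which the whole parallelogram lies in the ball of radius d; the 1 added to the norms
   covers v = w = 0. *)
have [h h0 hlt] : exists2 h, 0 < h & h * (`|v| + `|w|) < d.
  have N1 : 0 < `|v| + `|w| + 1 by rewrite ltr_wpDl // addr_ge0.
  exists (d / (2 * (`|v| + `|w| + 1))); first by rewrite divr_gt0 // mulr_gt0.
  rewrite -mulrA -[ltRHS]mulr1 ltr_pM2l // mulrC ltr_pdivrMr ?mulr_gt0 // mul1r.
  by move: (`|v| + `|w|) N1 => r N1; lra.
have inb (s t : R) : 0 <= s <= 1 -> 0 <= t <= 1 ->
    `|x + (s * h) *: v + (t * h) *: w - x| < d.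
  move=> /andP[s0 s1] /andP[t0 t1].
  rewrite -[x + _ + _]addrA [x + _]addrC addrK (le_lt_trans (ler_normD _ _)) //.
  rewrite !normrZ !ger0_norm ?mulr_ge0 // ?(ltW h0) //.
  apply: le_lt_trans hlt; rewrite mulrDr; apply: lerD; apply: ler_wpM2r => //;
  by apply: ler_piMl => //; exact: ltW.
have inb' (s t : R) : 0 <= s <= 1 -> 0 <= t <= 1 ->
    `|x + (s * h) *: w + (t * h) *: v - x| < d.
  by move=> s01 t01; rewrite [x + _ + _]addrAC; exact: inb.
have [|s [t [s01 t01 E]]] := @second_difference U f x v w h sf _.
  by move=> s t s01 t01; have [] := hd _ (inb s t s01 t01).
have [|s' [t' [s01' t01' E']]] := @second_difference U f x w v h sf _.
  by move=> s' t' s01' t01'; have [] := hd _ (inb' s' t' s01' t01').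
have [_ _ C1] := hd _ (inb s t s01 t01).
have [_ C2 _] := hd _ (inb' s' t' s01' t01').
have eqD : 'D_w ('D_v f) (x + (s * h) *: v + (t * h) *: w) =
          'D_v ('D_w f) (x + (s' * h) *: w + (t' * h) *: v).
  apply: (@mulfI _ (h * h)); first by rewrite mulf_neq0 // gt_eqF.
  apply: etrans (esym E) (etrans _ E').
  by rewrite [x + h *: w + h *: v]addrAC; congr (_ + _); exact: addrAC.
rewrite eqD in C1.
apply: le_trans (ler_distD _ _ _) _; rewrite [leRHS](splitr e).
by apply: lerD (ltW C2) _; rewrite distrC; exact: ltW C1.
Qed.

End DirectionalCalculus.

(** * The chain rule for directional derivatives *)

Section ChainRule.
Context {R : realType} {V : normedModType R}.
Implicit Types (f : V -> R) (x v : V).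

Lemma cvg_dnbhs_scale (w : R -> R) (c : R) v : w s @[s --> 0^'] --> c ->
  (s * w s) *: v @[s --> 0^'] --> (0 : V).
Proof.
move=> wc; have s0 : s @[s --> 0^'] --> (0 : R) by exact: cvg_within.
rewrite [X in _ --> X](_ : 0 = (0 * c) *: v); last by rewrite mul0r scale0r.
by apply: cvgZr_tmp; exact: (@cvgM _ _ _ _ id w 0 c).
Qed.

(** The base point [y s] moves with s, so that increments along several directions can be added one
    after the other in [chart]-free form by telescoping. *)
Lemma curve_step f x v (y : R -> V) (w : R -> R) (c : R) :
  (\forall z \near x, derivable f z v) -> {for x, continuous ('D_v f)} ->
  y s @[s --> 0^'] --> x -> w s @[s --> 0^'] --> c ->
  s^-1 * (f (y s + (s * w s) *: v) - f (y s)) @[s --> 0^'] --> c * 'D_v f x.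
Proof.
move=> df cf yx wc.
(* The increment may vanish for s != 0; the default value keeps the limit of [q] and the product
   [w s * q s] correct there. *)
pose q s := if s * w s == 0 then 'D_v f x else
  (s * w s)^-1 * (f (y s + (s * w s) *: v) - f (y s)).
have qD : q s @[s --> 0^'] --> 'D_v f x.
  apply/cvgrPdist_lt => e e0.
  have nx : \forall z \near x, derivable f z v /\ `|'D_v f x - 'D_v f z| < e.
    by apply: filterS2 df (_ : \forall z \near x, `|'D_v f x - 'D_v f z| < e) => //;
       have /cvgrPdist_lt := cf; apply.
  have [d d0 hd] := nbhs_ball_norm nx.
  have d2 : 0 < d / 2 by exact: divr_gt0.
  have n1 : \forall s \near 0^', `|x - y s| < d / 2.
    by have /cvgrPdist_lt := yx; apply.
  have n2 : \forall s \near 0^', `|0 - (s * w s) *: v| < d / 2.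
    by have /cvgrPdist_lt := cvg_dnbhs_scale v wc; apply.
  apply: filterS2 n1 n2 => s n1 n2; rewrite /q; case: ifPn => [_|sw0].
    by rewrite subrr normr0.
  have inb (t : R) : 0 <= t <= 1 -> `|y s + (t * (s * w s)) *: v - x| < d.
    move=> /andP[t0 t1]; rewrite addrAC; apply: le_lt_trans (ler_normD _ _) _.
    rewrite [ltRHS](splitr d); apply: ltr_leD; first by rewrite distrC.
    apply: le_trans (ltW n2); rewrite sub0r normrN -scalerA normrZ ger0_norm //.
    by apply: ler_piMl.
  have dfs (t : R) : 0 <= t <= 1 -> derivable f (y s + (t * (s * w s)) *: v) v.
    by move=> t01; have [] := hd _ (inb t t01).
  have [t t01 ->] := dir_MVTZ dfs.
  rewrite mulKf //; have t01' : 0 <= t <= 1 by case/andP: t01 => *; rewrite !ltW.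
  by have [] := hd _ (inb t t01').
have wq : w s * q s @[s --> 0^'] --> c * 'D_v f x by exact: cvgM.
apply: cvg_trans wq; apply: near_eq_cvg.
have : \forall s \near (0 : R)^', s != 0 by exact: nbhs_dnbhs_neq.
apply: filterS => s s0; rewrite /q; case: ifPn => [|sw0].
  rewrite mulf_eq0 (negPf s0) /= => /eqP ->.
  by rewrite mulr0 scale0r addr0 subrr mul0r mulr0.
rewrite mulrA; congr (_ * _).
by rewrite invfM mulrCA mulrV ?mulr1 // unitfE; move: sw0; rewrite mulf_eq0 negb_or => /andP[].
Qed.

Lemma chain_rule_curve f x I (r : seq I) (v : I -> V) (w : I -> R -> R) (c : I -> R) :
  (forall i, \forall z \near x, derivable f z (v i)) ->
  (forall i, {for x, continuous ('D_(v i) f)}) ->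
  (forall i, w i s @[s --> 0^'] --> c i) ->
  s^-1 * (f (x + \sum_(i <- r) (s * w i s) *: v i) - f x) @[s --> 0^'] -->
    \sum_(i <- r) c i * 'D_(v i) f x.
Proof.
move=> df cf wc.
pose y r s := x + \sum_(i <- r) (s * w i s) *: v i.
have yx r' : y r' s @[s --> 0^'] --> x.
  elim: r' => [|i r' IH].
    have -> : y [::] = cst x by apply/funext => s; rewrite /y big_nil addr0.
    exact: cvg_cst.
  have -> : y (i :: r') = (fun s => y r' s + (s * w i s) *: v i).
    by apply/funext => s; rewrite /y big_cons addrCA addrC.
  rewrite [X in _ --> X](_ : x = x + 0); last by rewrite addr0.
  by apply: cvgD => //; exact: cvg_dnbhs_scale.
elim: r => [|i r IH].
  rewrite big_nil.
  have -> : (fun s => s^-1 * (f (x + \sum_(i <- [::]) (s * w i s) *: v i) - f x)) = cst 0.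
    by apply/funext => s; rewrite big_nil addr0 subrr mulr0.
  exact: cvg_cst.
rewrite big_cons.
have -> : (fun s => s^-1 * (f (x + \sum_(i <- i :: r) (s * w i s) *: v i) - f x)) =
  (fun s => s^-1 * (f (y r s + (s * w i s) *: v i) - f (y r s)) + s^-1 * (f (y r s) - f x)).
  apply/funext => s; rewrite -mulrDr addrA subrK; congr (_ * (f _ - _)).
  by rewrite big_cons /y addrCA addrC.
apply: cvgD => //; exact: curve_step.
Qed.

(** Linearity in the direction is not built into directional derivatives; it follows from the chain
    rule along a straight line, thanks to continuity of the derivatives. *)
Lemma is_derive_dir_sum f x I (r : seq I) (v : I -> V) (c : I -> R) :
  (forall i, \forall z \near x, derivable f z (v i)) ->
  (forall i, {for x, continuous ('D_(v i) f)}) ->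
  is_derive x (\sum_(i <- r) c i *: v i) f (\sum_(i <- r) c i * 'D_(v i) f x).
Proof.
move=> df cf.
have cc i : (fun _ : R => c i) s @[s --> 0^'] --> c i by exact: cvg_cst.
have := @chain_rule_curve f x I r v (fun i _ => c i) c df cf cc.
set g := (fun s => _); set l := (\sum_(i <- r) c i * _) => gl.
have E : (fun h : R => h^-1 *: ((f \o shift x) (h *: (\sum_(i <- r) c i *: v i)) - f x)) = g.
  apply/funext => h /=; rewrite /g; congr (_ * (f _ - _)).
  by rewrite addrC scaler_sumr; congr (_ + _); apply: eq_bigr => i _; rewrite scalerA.
split; first by rewrite /derivable E; apply/cvg_ex; exists l.
by rewrite /derive E; apply/cvg_lim.
Qed.

End ChainRule.

Lemma is_derive_comp_rV {R : realType} {V : normedModType R} n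
    (phi : V -> 'rV[R]_n) (f : 'rV[R]_n -> R) (u : V) (e : V) :
  derivable phi u e ->
  (forall j, \forall z \near phi u, derivable f z (delta_mx 0 j)) ->
  (forall j, {for phi u, continuous ('D_(delta_mx 0 j) f)}) ->
  is_derive u e (f \o phi) (\sum_j 'D_e phi u 0 j * 'D_(delta_mx 0 j) f (phi u)).
Proof.
move=> dphi df cf.
pose w (j : 'I_n) (s : R) := s^-1 * (phi (s *: e + u) 0 j - phi u 0 j).
have wc j : w j s @[s --> 0^'] --> 'D_e phi u 0 j.
  rewrite derive_mx // mxE.
  by have /derivable_mxP /(_ 0 j) := dphi.
have := @chain_rule_curve _ _ f (phi u) _ (index_enum (ordinal n)) _ w _ df cf wc.
set g := (fun s => _); set l := (\sum_j _) => gl.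
have gl' : h^-1 *: (((f \o phi) \o shift u) (h *: e) - (f \o phi) u) @[h --> 0^'] --> l.
  apply: cvg_trans gl; apply: near_eq_cvg.
  have : \forall s \near (0 : R)^', s != 0 by exact: nbhs_dnbhs_neq.
  apply: filterS => s s0; rewrite /g /=; congr (_ * (f _ - _)).
  apply/rowP => k; rewrite mxE summxE (bigD1 k) //= big1.
    by rewrite !mxE !eqxx addr0 mulr1 /w mulVKf // addrC subrK.
  by move=> j jk; rewrite !mxE eqxx eq_sym (negPf jk) mulr0.
split; first by apply/cvg_ex; exists l.
by rewrite /derive; apply/cvg_lim.
Qed.

(** * The ring of smooth functions on an open set *)

Section SmoothRing.
Context {R : realType} {V : normedModType R}.
Variables (U : set V) (oU : open U).

(** Ring elements are functions on the subtype, so that equality in the ring means equality on U and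
    nothing else. The value 0 outside is harmless because derivatives at points of the open set U do
    not see it. *)
Definition ext0 (f : sig U -> R) (z : V) : R :=
  if pselect (U z) is left h then f (exist _ z h) else 0.

Lemma ext0E f (z : sig U) : ext0 f (sval z) = f z.
Proof.
case: z => z Uz; rewrite /ext0; case: pselect => // h.
by congr f; congr exist; exact: Prop_irrelevance.
Qed.

(** The proof of openness is an argument so that the type [sfun] records it: the subring property
    depends on it. *)
Definition smooth_pred (_ : open U) : {pred (sig U -> R)} :=
  fun f => `[< smooth_on U (ext0 f) >].

Lemma smooth_pred_subring : subring_closed (smooth_pred oU).
Proof.
split.
- apply/asboolP; apply: smooth_on_ext (smooth_on_cst oU 1) => // z; rewrite inE => Uz.
  by rewrite -[z]/(sval (exist U z Uz)) ext0E.
- move=> f g /asboolP sf /asboolP sg; apply/asboolP.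
  apply: smooth_on_ext (smooth_on_add oU sf (smooth_on_opp oU sg)) => // z; rewrite inE => Uz.
  rewrite -[z]/(sval (exist U z Uz)) ext0E.
  by rewrite -[LHS]/(ext0 f _ - ext0 g _) !ext0E.
- move=> f g /asboolP sf /asboolP sg; apply/asboolP.
  apply: smooth_on_ext (smooth_on_mul oU sf sg) => // z; rewrite inE => Uz.
  rewrite -[z]/(sval (exist U z Uz)) ext0E.
  by rewrite -[LHS]/(ext0 f _ * ext0 g _) !ext0E.
Qed.

Record sfun := Sfun { sfun_val :> sig U -> R; _ : sfun_val \in smooth_pred oU }.

HB.instance Definition _ := [isSub for sfun_val].
HB.instance Definition _ := [Choice of sfun by <:].
HB.instance Definition _ := GRing.SubChoice_isSubComPzRing.Build (sig U -> R) (smooth_pred oU) sfun smooth_pred_subring.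

Lemma sfunD (f g : sfun) z : (f + g) z = f z + g z. Proof. by []. Qed.
Lemma sfunM (f g : sfun) z : (f * g) z = f z * g z. Proof. by []. Qed.
Lemma sfunN (f : sfun) z : (- f) z = - f z. Proof. by []. Qed.
Lemma sfun0 z : (0 : sfun) z = 0. Proof. by []. Qed.
Lemma sfun1 z : (1 : sfun) z = 1. Proof. by []. Qed.

Lemma sfun_sum I (r : seq I) (P : pred I) (F : I -> sfun) z :
  (\sum_(i <- r | P i) F i) z = \sum_(i <- r | P i) F i z.
Proof. by apply: (big_morph (fun f : sfun => f z)). Qed.

Lemma sfunMn (f : sfun) k z : (f *+ k) z = f z *+ k.
Proof. by elim: k => // k IH; rewrite !mulrS sfunD IH. Qed.

Lemma sfunP (f g : sfun) : f =1 g -> f = g.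
Proof. by move=> fg; apply: val_inj; apply/funext. Qed.

Lemma sfun_smooth (f : sfun) : smooth_on U (ext0 f).
Proof. by case: f => f sf /=; apply/asboolP. Qed.

Lemma restrict_smooth (g : V -> R) : smooth_on U g ->
  (fun z : sig U => g (sval z)) \in smooth_pred oU.
Proof.
move=> sg; apply/asboolP; apply: smooth_on_ext sg => // z; rewrite inE => Uz.
by rewrite -[z]/(sval (exist U z Uz)) ext0E.
Qed.

Definition to_sfun (g : V -> R) (sg : smooth_on U g) : sfun :=
  Sfun (restrict_smooth sg).

Definition sder (v : V) (f : sfun) : sfun :=
  to_sfun (smooth_onD v (sfun_smooth f)).

Lemma sder_to_sfun v g (sg : smooth_on U g) (z : sig U) :
  sder v (to_sfun sg) z = 'D_v g (sval z).
Proof.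
case: z => z Uz; rewrite /= ; apply: near_eq_derive.
apply: near_eq_on Uz => // y; rewrite inE => Uy.
by rewrite -[y]/(sval (exist U y Uy)) ext0E.
Qed.

Lemma derive_ext0 (f : sfun) g v (z : sig U) :
  (forall y : sig U, f y = g (sval y)) -> sder v f z = 'D_v g (sval z).
Proof.
move=> fg; case: z => z Uz; rewrite /= ; apply: near_eq_derive.
apply: near_eq_on Uz => // y; rewrite inE => Uy.
by rewrite -[y]/(sval (exist U y Uy)) ext0E fg.
Qed.

Lemma sder_derivation v : derivation (sder v).
Proof.
have df (f : sfun) (z : sig U) : derivable (ext0 f) (sval z) v.
  by case: z => z Uz; apply: (smooth_on_derivable (sfun_smooth f)).
split=> f g; apply: sfunP => z.
  rewrite (@derive_ext0 _ (ext0 f + ext0 g)) ?deriveD //.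
  by move=> y; rewrite -[RHS]/(ext0 f _ + ext0 g _) !ext0E.
rewrite (@derive_ext0 _ (ext0 f * ext0 g)) ?deriveM //.
  by rewrite sfunD !sfunM /= !ext0E addrC mulrC.
by move=> y; rewrite -[RHS]/(ext0 f _ * ext0 g _) !ext0E.
Qed.

Lemma sderM_val v (f g : sfun) z :
  sder v (f * g) z = sder v f z * g z + f z * sder v g z.
Proof. by rewrite (derivationM (sder_derivation v)). Qed.

Lemma sder_comm v w f : sder v (sder w f) = sder w (sder v f).
Proof.
apply: sfunP => -[z Uz].
have E a b : sder a (sder b f) (exist _ z Uz) = 'D_a ('D_b (ext0 f)) z.
  exact: (@derive_ext0 (sder b f) ('D_b (ext0 f)) a (exist _ z Uz) (fun=> erefl)).
rewrite !E; exact: derive_comm oU (sfun_smooth f) Uz.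
Qed.

Lemma sfun_two_regular (f : sfun) : f + f = 0 -> f = 0.
Proof.
move=> ff; apply: sfunP => z; have := congr1 (fun f : sfun => f z) ff.
by rewrite sfunD sfun0 => h; lra.
Qed.

End SmoothRing.

(** * Extrinsic geometry of a hypersurface of the sphere *)

Lemma continuous_at_sum {R : realType} (T : topologicalType) I (r : seq I)
    (F : I -> T -> R) (u : T) :
  (forall i, {for u, continuous (F i)}) ->
  {for u, continuous (fun v => \sum_(i <- r) F i v)}.
Proof.
move=> cF; elim: r => [|i r IH].
  rewrite (_ : (fun _ => _) = cst 0); first exact: cst_continuous.
  by apply/funext => v; rewrite big_nil.
rewrite (_ : (fun _ => _) = F i \+ (fun v => \sum_(j <- r) F j v)).
  by apply: cvgD; [exact: cF|exact: IH].
by apply/funext => v; rewrite big_cons.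
Qed.

Lemma continuous_at_coord {R : realType} (T : topologicalType) m n
    (F : T -> 'M[R]_(m, n)) (u : T) i j :
  {for u, continuous F} -> {for u, continuous (fun v => F v i j)}.
Proof.
move=> cF; apply: (@continuous_comp _ _ _ F (fun M : 'M[R]_(m, n) => M i j)) => //.
exact: coord_continuous.
Qed.

Lemma continuous_at_mul {R : realType} (T : topologicalType) (f g : T -> R) (u : T) :
  {for u, continuous f} -> {for u, continuous g} ->
  {for u, continuous (fun v => f v * g v)}.
Proof. by move=> cf cg; exact: cvgM cf cg. Qed.

(** * Linear algebra of the frame formed by tangent vectors, normal and position *)

Section LinearAlgebra.
Context {R : realType}.

Lemma dotE m (x y : 'rV[R]_m) : dot x y = \sum_k x 0 k * y 0 k.
Proof. by rewrite /dot mxE; apply: eq_bigr => k _; rewrite mxE. Qed.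

Lemma dot_mx m (x y : 'rV[R]_m) : x *m y^T = (dot x y)%:M.
Proof. by apply/matrixP => i j; rewrite !ord1 [RHS]mxE eqxx. Qed.

Lemma dotC m (x y : 'rV[R]_m) : dot x y = dot y x.
Proof. by rewrite !dotE; apply: eq_bigr => k _; rewrite mulrC. Qed.

Lemma dotZl m (a : R) (x y : 'rV[R]_m) : dot (a *: x) y = a * dot x y.
Proof. by rewrite /dot -scalemxAl mxE. Qed.

Lemma dot_eq0 m (x : 'rV[R]_m) : dot x x = 0 -> x = 0.
Proof.
rewrite dotE => /eqP; rewrite psumr_eq0 => [/allP x0|k _]; last exact: sqr_ge0.
apply/rowP => k; rewrite mxE; apply/eqP.
by have := x0 k (mem_index_enum k); rewrite /= mulf_eq0 orbb.
Qed.

Lemma gram_unit m n (F : 'M[R]_(m, n)) : row_free F -> F *m F^T \in unitmx.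
Proof.
move=> fF; rewrite -row_free_unit; apply: inj_row_free => v vFF.
have vF : v *m F = 0.
  by apply: dot_eq0; rewrite /dot trmx_mul mulmxA -(mulmxA v) vFF mul0mx mxE.
by apply: (row_free_inj fF); rewrite vF mul0mx.
Qed.

(* The n tangent vectors, the position and the normal span R^(n+2). *)
Lemma frame_projection n (F : 'M[R]_(n, n.+2)) (x nu : 'rV[R]_n.+2) (K : R) :
  K != 0 -> row_free F -> dot x x = K^-1 -> dot nu nu = 1 -> dot nu x = 0 ->
  F *m x^T = 0 -> F *m nu^T = 0 ->
  F^T *m invmx (F *m F^T) *m F = 1%:M - nu^T *m nu - K *: (x^T *m x).
Proof.
move=> K0 fF xx nunu nux Fx Fnu; have ug := gram_unit fF.
have xnu : dot x nu = 0 by rewrite dotC.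
pose B : 'M[R]_(n + (1 + 1), n.+2) := col_mx F (col_mx nu x).
have fB : row_free B.
  apply: inj_row_free => v.
  rewrite -[v]hsubmxK -[rsubmx v]hsubmxK /B !mul_row_col.
  set a := lsubmx v; set b := lsubmx (rsubmx v); set c := rsubmx (rsubmx v) => E.
  have b0 : b = 0.
    have := congr1 (fun y => y *m nu^T) E.
    by rewrite /= mul0mx !mulmxDl -!mulmxA Fnu !dot_mx nunu xnu mulmx0 add0r mulmx1 mul_mx_scalar scale0r addr0.
  have c0 : c = 0.
    have := congr1 (fun y => y *m x^T) E.
    rewrite /= mul0mx !mulmxDl -!mulmxA Fx !dot_mx nux xx mulmx0 add0r !mul_mx_scalar scale0r add0r.
    by move/eqP; rewrite scaler_eq0 invr_eq0 (negPf K0) => /eqP.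
  have a0 : a = 0.
    by apply: (row_free_inj fF); rewrite mul0mx; move: E; rewrite b0 c0 !mul0mx !addr0.
  by rewrite a0 b0 c0 !row_mx0.
have [C CB] : exists C, C *m B = 1%:M.
  by apply/row_fullP; rewrite /row_full (eqP fB) addn2.
set P := _ *m F.
have FP : F *m P = F by rewrite /P !mulmxA mulmxV // mul1mx.
have xFT : x *m F^T = 0 by rewrite -[x]trmxK -trmx_mul Fx trmx0.
have nuFT : nu *m F^T = 0 by rewrite -[nu]trmxK -trmx_mul Fnu trmx0.
have xP : x *m P = 0 by rewrite /P !mulmxA xFT !mul0mx.
have nuP : nu *m P = 0 by rewrite /P !mulmxA nuFT !mul0mx.
(* The sum of the three projections fixes every row of the frame [B]; the left inverse [C] then
   cancels [B]. *)
have BE : B *m (P + nu^T *m nu + K *: (x^T *m x)) = B.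
  rewrite /B !mul_col_mx !mulmxDr FP xP nuP -!scalemxAr !mulmxA Fx Fnu !dot_mx nunu nux xnu xx.
  rewrite !mul1mx !mul_scalar_mx !scale0r !scaler0 scalerA mulfV // scale1r !mul0mx !scaler0.
  by rewrite !addr0 !add0r.
have : P + nu^T *m nu + K *: (x^T *m x) = 1%:M.
  by rewrite -[LHS]mul1mx -CB -mulmxA BE.
by move=> <-; rewrite addrAC !addrK.
Qed.

(** The coordinate expression of |A|^2 is the squared Frobenius norm of the ambient matrix. The last
    hypothesis says that the rows of N are tangential; the rest is cyclicity of the trace. *)
Lemma trace_shape_sqr m n (F N : 'M[R]_(m, n)) (g : 'M[R]_m) : g^T = g ->
  g *m (F *m F^T) = 1%:M -> N *m (F^T *m g *m F) = N ->
  \tr (g *m (N *m F^T *m g *m (N *m F^T)^T)) =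
  \tr ((F^T *m g *m N) *m (F^T *m g *m N)^T).
Proof.
move=> gT gF NP.
have -> : (N *m F^T)^T = F *m N^T by rewrite trmx_mul trmxK.
have -> : (F^T *m g *m N)^T = N^T *m g *m F by rewrite !trmx_mul trmxK gT mulmxA.
have -> : N *m F^T *m g *m (F *m N^T) = N *m N^T.
  by transitivity (N *m (F^T *m g *m F) *m N^T); [rewrite !mulmxA|rewrite NP].
rewrite -[F^T *m g *m N]mulmxA -[F^T *m _ *m _]mulmxA [RHS]mxtrace_mulC.
have -> : g *m N *m (N^T *m g *m F) *m F^T = g *m N *m N^T *m (g *m (F *m F^T)).
  by rewrite !mulmxA.
by rewrite gF mulmx1 mulmxA.
Qed.

End LinearAlgebra.

(** * The Weingarten map and its dependence on the unit normal *)

Section Shape.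
Context {R : realType} {n : nat}.
Implicit Types (F N G : 'rV[R]_n -> 'rV[R]_n.+2) (u : 'rV[R]_n).

Definition jac F u : 'M[R]_(n, n.+2) := \matrix_i partial F i u.

(* The Weingarten map extended by zero to the normal space: a matrix acting on
   the ambient R^(n+2), independent of the coordinates. *)
Definition shape F N u : 'M[R]_n.+2 :=
  (jac F u)^T *m invmx (induced_metric F u) *m jac N u.

Definition coord_derivable F u := forall i : 'I_n, derivable F u (delta_mx 0 i).

Lemma jacE F u i k : coord_derivable F u ->
  jac F u i k = 'D_(delta_mx 0 i) (fun v => F v 0 k) u.
Proof. by move=> dF; rewrite mxE /partial derive_mx ?mxE. Qed.

Lemma coord_derivableP F u i k : coord_derivable F u ->
  derivable (fun v => F v 0 k) u (delta_mx 0 i).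
Proof. by move=> /(_ i)/derivable_mxP; exact. Qed.

Lemma induced_metricE F u : induced_metric F u = jac F u *m (jac F u)^T.
Proof.
apply/matrixP => i j; rewrite mxE dotE mxE; apply: eq_bigr => k _.
by rewrite !mxE.
Qed.

Lemma jac_dot F G u i : coord_derivable F u -> coord_derivable G u ->
  'D_(delta_mx 0 i) (fun v => dot (F v) (G v)) u =
  dot (partial F i u) (G u) + dot (F u) (partial G i u).
Proof.
move=> dF dG.
have -> : (fun v => dot (F v) (G v)) =
    \sum_(k < n.+2) ((fun v => F v 0 k) * (fun v => G v 0 k)).
  by apply/funext => v; rewrite dotE fct_sumE.
rewrite derive_sum; last first.
  by move=> k; apply: derivableM; exact: coord_derivableP.
rewrite !dotE -big_split; apply: eq_bigr => k _ /=.
rewrite deriveM; [|exact: coord_derivableP..].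
rewrite -!jacE // !mxE addrC; congr (_ + _); exact: mulrC.
Qed.

Lemma partial_dot_cst F G u c : coord_derivable F u -> coord_derivable G u ->
  (\forall v \near u, dot (F v) (G v) = c) ->
  forall i, dot (partial F i u) (G u) + dot (F u) (partial G i u) = 0.
Proof.
move=> dF dG fg i; rewrite -jac_dot //.
rewrite (@near_eq_derive _ _ _ _ (cst c)) ?derive_cst //.
Qed.

Lemma jac_mul_tr F u (y : 'rV[R]_n.+2) :
  (forall i, dot (partial F i u) y = 0) -> jac F u *m y^T = 0.
Proof.
move=> h; apply/matrixP => i j; rewrite ord1 !mxE -[RHS](h i) dotE.
by apply: eq_bigr => k _; rewrite !mxE.
Qed.

(** Differentiability is asked only at u, but the algebraic identities hold near u so that they can
    be differentiated. This is weaker than a smooth local normal and fits time slices and normals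
    pulled back by a change of chart. *)
Record adapted (K : R) F N u : Prop := Adapted {
  adapted_dF : coord_derivable F u;
  adapted_dN : coord_derivable N u;
  adapted_imm : immersive_at F u;
  adapted_sph : \forall v \near u, dot (F v) (F v) = K^-1;
  adapted_nrm : \forall v \near u, unit_normal_at F N v
}.

Variable K : R.
Hypothesis K0 : 0 < K.

Section At.
Variables (F N : 'rV[R]_n -> 'rV[R]_n.+2) (u : 'rV[R]_n).
Hypothesis ad : adapted K F N u.

Lemma adapted_dotFx i : dot (partial F i u) (F u) = 0.
Proof.
have := partial_dot_cst (adapted_dF ad) (adapted_dF ad) (adapted_sph ad) i.
by rewrite [X in _ + X]dotC => h; lra.
Qed.

Lemma adapted_Fx : jac F u *m (F u)^T = 0.
Proof. by apply: jac_mul_tr => i; exact: adapted_dotFx. Qed.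

Lemma adapted_FN : jac F u *m (N u)^T = 0.
Proof.
apply: jac_mul_tr => i; rewrite dotC.
by have [_ _] := nbhs_singleton (adapted_nrm ad).
Qed.

Lemma adapted_NN : jac N u *m (N u)^T = 0.
Proof.
apply: jac_mul_tr => i.
have nn : \forall v \near u, dot (N v) (N v) = 1.
  by apply: filterS (adapted_nrm ad) => v [].
have := partial_dot_cst (adapted_dN ad) (adapted_dN ad) nn i.
by rewrite [X in _ + X]dotC => h; lra.
Qed.

Lemma adapted_Nx : jac N u *m (F u)^T = 0.
Proof.
apply: jac_mul_tr => i.
have nn : \forall v \near u, dot (N v) (F v) = 0.
  by apply: filterS (adapted_nrm ad) => v [].
have := partial_dot_cst (adapted_dN ad) (adapted_dF ad) nn i.
by have [_ _ ->] := nbhs_singleton (adapted_nrm ad); rewrite addr0.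
Qed.

Lemma adapted_proj : (jac F u)^T *m invmx (induced_metric F u) *m jac F u =
  1%:M - (N u)^T *m N u - K *: ((F u)^T *m F u).
Proof.
have [nn nx _] := nbhs_singleton (adapted_nrm ad).
rewrite induced_metricE; apply: frame_projection => //; first by rewrite gt_eqF.
- exact: adapted_imm ad.
- exact: nbhs_singleton (adapted_sph ad).
- exact: adapted_Fx.
- exact: adapted_FN.
Qed.

Lemma metric_unit : induced_metric F u \in unitmx.
Proof. by rewrite induced_metricE; apply: gram_unit; exact: adapted_imm ad. Qed.

Lemma second_ffE : second_ff K F N u = jac N u *m (jac F u)^T.
Proof.
apply/matrixP => i j; rewrite /second_ff !mxE /sphere_deriv.
rewrite -[RHS](_ : dot (partial N i u) (partial F j u) = _); last first.
  by rewrite dotE; apply: eq_bigr => k _; rewrite !mxE.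
rewrite /dot mulmxBl mxE -[RHS]addr0; congr (_ + _).
have fx : (F u *m (partial F j u)^T) 0 0 = 0.
  by have := adapted_dotFx j; rewrite dotC.
by rewrite -scalemxAl !mxE; move: fx; rewrite mxE => ->; rewrite mulr0 oppr0.
Qed.

Lemma mean_curvatureE : mean_curvature K F N u = \tr (shape F N u).
Proof.
rewrite /mean_curvature second_ffE /shape -mulmxA [RHS]mxtrace_mulC.
by rewrite mulmxA.
Qed.

Lemma sqnorm_second_ffE : sqnorm_second_ff K F N u =
  \sum_a \sum_b shape F N u a b * shape F N u a b.
Proof.
set g' := invmx (induced_metric F u).
have gT : g'^T = g'.
  by rewrite /g' trmx_inv induced_metricE trmx_mul trmxK.
have NP : jac N u *m ((jac F u)^T *m g' *m jac F u) = jac N u.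
  rewrite adapted_proj !mulmxBr mulmx1 -scalemxAr !mulmxA adapted_NN adapted_Nx.
  by rewrite !mul0mx scaler0 !subr0.
transitivity (\tr (g' *m (second_ff K F N u *m g' *m (second_ff K F N u)^T))).
  rewrite /sqnorm_second_ff -/g' mxtrace_mulC /mxtrace; apply: eq_bigr => i _.
  rewrite [RHS]mxE.
  transitivity (\sum_j \sum_k \sum_l g' i k * g' j l * second_ff K F N u i j * second_ff K F N u k l) => //.
  rewrite exchange_big; apply: eq_bigr => k _ /=.
  rewrite [(_ *m _^T) i k]mxE mulr_suml exchange_big; apply: eq_bigr => l _ /=.
  rewrite [(_ *m g') i l]mxE !mulr_suml; apply: eq_bigr => j _.
  have -> : g' k i = g' i k by rewrite -{1}gT mxE.
  by rewrite [_^T l k]mxE; ring.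
transitivity (\tr (shape F N u *m (shape F N u)^T)); last first.
  rewrite /mxtrace; apply: eq_bigr => a _; rewrite [LHS]mxE; apply: eq_bigr => b _.
  by congr (_ * _); rewrite mxE.
rewrite second_ffE /shape -/g'; apply: trace_shape_sqr => //.
by rewrite -induced_metricE mulVmx // metric_unit.
Qed.

End At.

(** By [frame_projection] both normals give the same matrix nu^T nu, since the other projections do
    not involve the normal. *)
Lemma unit_normal_unique F N N' u : immersive_at F u -> dot (F u) (F u) = K^-1 ->
  jac F u *m (F u)^T = 0 ->
  unit_normal_at F N u -> unit_normal_at F N' u ->
  N' u = dot (N' u) (N u) *: N u /\ dot (N' u) (N u) ^+ 2 = 1.
Proof.
move=> im xx Fx [nn nx nF] [nn' nx' nF'].
have FN : jac F u *m (N u)^T = 0 by apply: jac_mul_tr => i; rewrite dotC.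
have FN' : jac F u *m (N' u)^T = 0 by apply: jac_mul_tr => i; rewrite dotC.
have Kn0 : K != 0 by rewrite gt_eqF.
have := frame_projection Kn0 im xx nn nx Fx FN.
rewrite (frame_projection Kn0 im xx nn' nx' Fx FN') => /addIr /addrI /oppr_inj E.
have EN : N' u = dot (N' u) (N u) *: N u.
  have := congr1 (fun M => N' u *m M) E; rewrite /= !mulmxA !dot_mx nn'.
  by rewrite mul1mx mul_scalar_mx.
split=> //; rewrite expr2 [X in _ * X]dotC -dotZl -EN //.
Qed.

Lemma near_sphere_Fx F u : coord_derivable F u ->
  (\forall v \near u, dot (F v) (F v) = K^-1) -> jac F u *m (F u)^T = 0.
Proof.
move=> dF sp; apply: jac_mul_tr => i.
have := partial_dot_cst dF dF sp i.
by rewrite [X in _ + X]dotC => h; lra.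
Qed.

(* Two unit normals differ by a sign, locally constant by continuity. *)
Lemma shape_sign F N N' u : adapted K F N u -> adapted K F N' u ->
  (\forall v \near u, coord_derivable F v /\ immersive_at F v) ->
  {for u, continuous N} -> {for u, continuous N'} ->
  exists s : R, [/\ s ^+ 2 = 1, N' u = s *: N u & shape F N' u = s *: shape F N u].
Proof.
move=> ad ad' imm cN cN'; pose s v := dot (N' v) (N v).
have near_sign : \forall v \near u, N' v = s v *: N v /\ s v ^+ 2 = 1.
  have sp2 := near_join (adapted_sph ad).
  apply: filterS3 (filterI (adapted_sph ad) sp2) imm (filterI (adapted_nrm ad) (adapted_nrm ad')).
  move=> v [sp spv] [dF im] [nv nv'].
  by have [h1 h2] := unit_normal_unique im sp (near_sphere_Fx dF spv) nv nv'.
have cs : {for u, continuous s}.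
  have -> : s = (fun v => \sum_(k < n.+2) N' v 0 k * N v 0 k).
    by apply/funext => v; rewrite /s dotE.
  by apply: continuous_at_sum => k; apply: continuous_at_mul; exact: continuous_at_coord.
have [Nu su] := nbhs_singleton near_sign.
have near_cst : \forall v \near u, N' v = s u *: N v.
  (* Opposite signs are at distance 2, so within distance 1 the sign is constant. *)
  have : \forall v \near u, `|s u - s v| < 1.
    by have /cvgrPdist_lt := cs; apply.
  apply: filterS2 near_sign => v [-> sv] lt1; congr (_ *: _).
  have /orP[/eqP suv|/eqP suv] : (s v == s u) || (s v == - s u).
    by rewrite -eqf_sqr sv su.
  - exact: suv.
  - move: lt1; rewrite suv opprK => /ltr_normlP[h1 h2].
    by exfalso; move: su; nra.
exists (s u); split=> //.
have jN : jac N' u = s u *: jac N u.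
  apply/row_matrixP => i; rewrite linearZ /= !rowK /partial.
  rewrite (@near_eq_derive _ _ _ N' (s u *: N)) //.
  have dN : coord_derivable N u := adapted_dN ad.
  by rewrite deriveZ //; exact: dN.
by rewrite /shape jN -scalemxAr.
Qed.

End Shape.

(** * Independence of the parametrisation *)

Section Reparametrisation.
Context {R : realType} {n : nat}.
Implicit Types (F N : 'rV[R]_n -> 'rV[R]_n.+2) (u : 'rV[R]_n).

Lemma smooth_on_coord_derivable (W : set 'rV[R]_n) F u :
  smooth_on W F -> W u -> coord_derivable F u.
Proof. by move=> sF Wu i; exact: smooth_on_derivable sF Wu. Qed.

Lemma jac_comp (W : set 'rV[R]_n) F (phi : 'rV[R]_n -> 'rV[R]_n) u :
  open W -> smooth_on W F -> W (phi u) ->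
  (forall i : 'I_n, derivable phi u (delta_mx 0 i)) ->
  coord_derivable (F \o phi) u /\
  jac (F \o phi) u = (\matrix_(i, j) 'D_(delta_mx 0 i) phi u 0 j) *m jac F (phi u).
Proof.
move=> oW sF Wu dphi.
have sFk k : smooth_on W (fun z => F z 0 k) by exact: smooth_on_coord.
have near_W : \forall z \near phi u, W z := open_nbhs_nbhs (conj oW Wu).
have dc i k : is_derive u (delta_mx 0 i) ((fun z => F z 0 k) \o phi)
    (\sum_j 'D_(delta_mx 0 i) phi u 0 j * 'D_(delta_mx 0 j) (fun z => F z 0 k) (phi u)).
  apply: is_derive_comp_rV => //.
    by move=> j; apply: filterS near_W => z Wz; exact: smooth_on_derivable (sFk k) Wz.
  by move=> j; apply: smooth_on_continuous Wu; exact: smooth_onD.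
have dFp : coord_derivable (F \o phi) u.
  by move=> i; apply/derivable_mxP => a k; rewrite (ord1 a); have [] := dc i k.
split=> //; apply/matrixP => i k; rewrite jacE // [RHS]mxE.
have [_ E] := dc i k; apply: etrans E _; apply: eq_bigr => j _.
rewrite [X in _ = X * _]mxE; congr (_ * _).
by apply/esym; apply: jacE; exact: smooth_on_coord_derivable Wu.
Qed.

Lemma near_eq_jac F F' u : {near u, F =1 F'} -> jac F u = jac F' u.
Proof.
move=> FF'; apply/row_matrixP => i; rewrite !rowK; exact: near_eq_derive.
Qed.

(** The Jacobian J of the change of coordinates cancels in J^T (J g J^T)^-1 J = g^-1; it is
    invertible because the reparametrised map is an immersion. *)
Lemma shape_reparam F N F' N' u u' (J : 'M[R]_n) :
  row_free (jac F' u') ->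
  jac F' u' = J *m jac F u -> jac N' u' = J *m jac N u -> shape F' N' u' = shape F N u.
Proof.
move=> fF' EF EN.
have uJ : J \in unitmx.
  rewrite -row_free_unit; apply: inj_row_free => v vJ.
  by apply: (row_free_inj fF'); rewrite EF mulmxA vJ !mul0mx.
have ug : jac F u *m (jac F u)^T \in unitmx.
  have := gram_unit fF'; rewrite EF trmx_mul !mulmxA -(mulmxA J) !unitmx_mul unitmx_tr.
  by rewrite uJ andbT.
have [g Eg] : exists g, g = jac F u *m (jac F u)^T by eexists.
have Eg' : J *m jac F u *m ((jac F u)^T *m J^T) = J *m g *m J^T by rewrite Eg !mulmxA.
rewrite -Eg in ug.
rewrite /shape !induced_metricE EF EN trmx_mul Eg' -Eg.
have -> : invmx (J *m g *m J^T) = invmx J^T *m invmx g *m invmx J.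
  have uJg : J *m g *m J^T \in unitmx by rewrite !unitmx_mul uJ ug unitmx_tr.
  apply: (can_inj (mulKmx uJg)); rewrite mulmxV // !mulmxA.
  by rewrite mulmxK ?unitmx_tr // mulmxK // mulmxV.
by rewrite !mulmxA mulmxKV // mulmxK ?unitmx_tr.
Qed.

End Reparametrisation.

(** * Charts and time slices *)

Section Slices.
Context {R : realType} {V W : normedModType R}.

Lemma slice_quotient (h : V * R -> W) (t : R) (e u : V) :
  (fun k : R => k^-1 *: (((fun v => h (v, t)) \o shift u) (k *: e) - h (u, t))) =
  (fun k : R => k^-1 *: ((h \o shift (u, t)) (k *: (e, 0)) - h (u, t))).
Proof.
apply/funext => k /=; congr (_ *: (h _ - _)).
by rewrite /= -[RHS]/((k *: e + u, k *: 0 + t)) scaler0 add0r.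
Qed.

Lemma derive_slice (h : V * R -> W) (t : R) (e u : V) :
  'D_e (fun v => h (v, t)) u = 'D_((e, 0) : V * R) h (u, t).
Proof. by rewrite /derive slice_quotient. Qed.

Lemma derivable_slice (h : V * R -> W) (t : R) (e u : V) :
  derivable h (u, t) ((e, 0) : V * R) -> derivable (fun v => h (v, t)) u e.
Proof. by rewrite /derivable slice_quotient. Qed.

Lemma continuous_pair_slice (t : R) : continuous (fun v : V => (v, t)).
Proof.
move=> v A [[P Q] /= [Pv Qt] sub]; rewrite nbhs_simpl /=.
by apply: filterS Pv => w Pw; apply: sub; split => //; exact: nbhs_singleton Qt.
Qed.

Lemma open_slice (U : set (V * R)) (t : R) : open U -> open [set v | U (v, t)].
Proof. by move=> oU; apply: open_comp oU => v _; exact: continuous_pair_slice. Qed.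

Lemma smooth_on_slice (U : set (V * R)) (h : V * R -> W) (t : R) :
  smooth_on U h -> smooth_on [set v | U (v, t)] (fun v => h (v, t)).
Proof.
move=> sh.
have E vs : iter_derive (fun v => h (v, t)) vs =
    (fun v => iter_derive h [seq ((e, 0) : V * R) | e <- vs] (v, t)).
  elim: vs => //= v vs IH; apply/funext => x /=.
  by rewrite IH derive_slice.
move=> vs x /= Ux; rewrite E; have [ch dh] := sh [seq ((e, 0) : V * R) | e <- vs] _ Ux.
split; last by move=> v; apply: derivable_slice; exact: dh.
apply: (@continuous_comp _ _ _ (fun v => (v, t))) => //.
exact: continuous_pair_slice.
Qed.

End Slices.

Section Charts.
Context {R : realType} {n : nat} {M : topologicalType}.
Implicit Types c d : chart R n M.

Lemma chart_map_continuous c p : chart_dom c p -> {for p, continuous (chart_map c)}.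
Proof.
move=> cp; have := chart_map_cont (c := c).
by rewrite continuous_open_subspace; [apply; rewrite inE|exact: chart_dom_open].
Qed.

Lemma chart_inv_continuous c u : (chart_map c @` chart_dom c) u ->
  {for u, continuous (chart_inv c)}.
Proof.
move=> cu; have := chart_inv_cont (c := c).
by rewrite continuous_open_subspace; [apply; rewrite inE|exact: chart_img_open].
Qed.

Lemma chart_img_near c p : chart_dom c p ->
  \forall v \near chart_map c p, (chart_map c @` chart_dom c) v.
Proof.
by move=> cp; apply: open_nbhs_nbhs; split; [exact: chart_img_open|exists p].
Qed.

Lemma chart_overlap_near c d p : chart_dom c p -> chart_dom d p ->
  \forall v \near chart_map d p, (chart_map d @` (chart_dom d `&` chart_dom c)) v.
Proof.
move=> cp dp.
have near_c : \forall v \near chart_map d p, chart_dom c (chart_inv d v).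
  have ci : {for chart_map d p, continuous (chart_inv d)}.
    by apply: chart_inv_continuous; exists p.
  apply: ci; rewrite chart_mapK //.
  by apply: open_nbhs_nbhs; split; [exact: chart_dom_open|].
apply: filterS2 (chart_img_near dp) near_c => v [q dq <-].
by rewrite chart_mapK // => cq; exists q.
Qed.

End Charts.

(** * Curvature of the flow, independently of charts and normals *)

Section FlowGeometry.
Context {R : realType} {n : nat} {M : smooth_manifold R n} {K : R} {T : \bar R}.
Context {X : M -> R -> 'rV[R]_n.+2}.
Hypothesis K0 : 0 < K.
Hypothesis sol : mcf_solution K T X.
Implicit Types (c d : chart R n M) (p : M) (t : R).

Lemma in_chart_sphere c t v : time_interval T t ->
  dot (in_chart X c t v) (in_chart X c t v) = K^-1.
Proof. by case: sol => sp _ _ _ Tt; exact: sp. Qed.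

Lemma in_chart_extension c p t : mfd_atlas c -> chart_dom c p -> time_interval T t ->
  exists (U : set ('rV[R]_n * R)) (g : 'rV[R]_n * R -> 'rV[R]_n.+2),
  [/\ open U, U (chart_map c p, t), smooth_on U g &
      forall v s, (chart_map c @` chart_dom c) v -> time_interval T s -> U (v, s) ->
        in_chart X c s v = g (v, s)].
Proof.
move=> ac cp Tt; case: sol => _ sm _ _.
have [|U [g [oU Uz sg E]]] := sm c ac (chart_map c p, t).
  by split=> //=; exists p.
by exists U, g; split=> // v s cv Ts Uvs; rewrite -E.
Qed.

Lemma in_chart_smooth c p t : mfd_atlas c -> chart_dom c p -> time_interval T t ->
  exists W : set 'rV[R]_n, [/\ open W, W (chart_map c p),
    W `<=` chart_map c @` chart_dom c & smooth_on W (in_chart X c t)].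
Proof.
move=> ac cp Tt; have [U [g [oU Uz sg E]]] := in_chart_extension ac cp Tt.
have oW : open ([set v | U (v, t)] `&` (chart_map c @` chart_dom c)).
  by apply: openI; [exact: open_slice|exact: chart_img_open].
exists ([set v | U (v, t)] `&` (chart_map c @` chart_dom c)); split.
- exact: oW.
- by split=> //; exists p.
- by move=> v [].
- have sW : smooth_on ([set v | U (v, t)] `&` (chart_map c @` chart_dom c)) (fun v => g (v, t)).
    by apply: smooth_onW (smooth_on_slice sg) => v [].
  by apply: (smooth_on_ext oW _ sW) => v; rewrite inE => -[/= Uv cv]; rewrite E.
Qed.

Lemma in_chart_regular c v t : mfd_atlas c -> time_interval T t ->
  (chart_map c @` chart_dom c) v ->
  coord_derivable (in_chart X c t) v /\ immersive_at (in_chart X c t) v.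
Proof.
move=> ac Tt [p cp <-]; split; last by case: sol => _ _ im _; exact: im.
have [W [oW Wp _ sW]] := in_chart_smooth ac cp Tt.
exact: smooth_on_coord_derivable Wp.
Qed.

Lemma in_chart_adapted c p t N : mfd_atlas c -> chart_dom c p -> time_interval T t ->
  coord_derivable N (chart_map c p) ->
  (\forall v \near chart_map c p, unit_normal_at (in_chart X c t) N v) ->
  adapted K (in_chart X c t) N (chart_map c p).
Proof.
move=> ac cp Tt dN nN.
have [dF im] : coord_derivable (in_chart X c t) (chart_map c p) /\
    immersive_at (in_chart X c t) (chart_map c p).
  by apply: in_chart_regular => //; exists p.
apply: Adapted; [exact: dF|exact: dN|exact: im| |exact: nN].
by apply: filterE => v; exact: in_chart_sphere.
Qed.

Lemma local_unit_normal_adapted c p t N : mfd_atlas c -> chart_dom c p ->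
  time_interval T t -> local_unit_normal (in_chart X c t) N (chart_map c p) ->
  adapted K (in_chart X c t) N (chart_map c p) /\ {for chart_map c p, continuous N}.
Proof.
move=> ac cp Tt [W [oW Wp sN nN]]; split; last exact: smooth_on_continuous Wp.
apply: in_chart_adapted => //; first exact: smooth_on_coord_derivable Wp.
by apply: filterS (open_nbhs_nbhs (conj oW Wp)) => v; exact: nN.
Qed.

Lemma near_regular c p t : mfd_atlas c -> chart_dom c p -> time_interval T t ->
  \forall v \near chart_map c p,
    coord_derivable (in_chart X c t) v /\ immersive_at (in_chart X c t) v.
Proof.
by move=> ac cp Tt; apply: filterS (chart_img_near cp) => v; exact: in_chart_regular.
Qed.

(** The normal N composed with the transition map is a normal in the chart d with the same
    Weingarten map, and [shape_sign] compares it with N'. The case c = d compares two normals in one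
    chart. *)
Lemma shape_chart c d p t N N' : mfd_atlas c -> mfd_atlas d ->
  chart_dom c p -> chart_dom d p -> time_interval T t ->
  local_unit_normal (in_chart X c t) N (chart_map c p) ->
  adapted K (in_chart X d t) N' (chart_map d p) ->
  {for chart_map d p, continuous N'} ->
  exists s : R, [/\ s ^+ 2 = 1, N' (chart_map d p) = s *: N (chart_map c p) &
    shape (in_chart X d t) N' (chart_map d p) =
    s *: shape (in_chart X c t) N (chart_map c p)].
Proof.
move=> ac ad cp dp Tt [WN [oWN WNp sN nN]] ad' cN'.
set u := chart_map c p; set u' := chart_map d p.
set F := in_chart X c t; set F' := in_chart X d t.
pose phi := chart_map c \o chart_inv d.
have phiu : phi u' = u by rewrite /phi /= chart_mapK.
pose Om := chart_map d @` (chart_dom d `&` chart_dom c).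
have sphi : smooth_on Om phi by exact: mfd_compat.
have nOm : \forall v \near u', Om v := chart_overlap_near cp dp.
have FE v : Om v -> F' v = F (phi v).
  by move=> [q [dq cq] <-]; rewrite /F' /F /in_chart /phi /= !chart_mapK.
have [WF [oWF WFp WFi sF]] := in_chart_smooth ac cp Tt.
have cphi : {for u', continuous phi}.
  by apply: smooth_on_continuous sphi _; exists p.
have nWF : \forall v \near u', WF (phi v).
  by apply: cphi; rewrite phiu; apply: open_nbhs_nbhs.
have nWN : \forall v \near u', WN (phi v).
  by apply: cphi; rewrite phiu; apply: open_nbhs_nbhs.
have jF v : (\forall w \near v, Om w) -> WF (phi v) ->
    jac F' v = (\matrix_(i, j) 'D_(delta_mx 0 i) phi v 0 j) *m jac F (phi v).
  move=> nv Wv; have Ov := nbhs_singleton nv.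
  rewrite (@near_eq_jac _ _ F' (F \o phi)).
    by have [] := @jac_comp _ _ WF F phi v oWF sF Wv (fun i => smooth_on_derivable sphi Ov).
  by apply: filterS nv => w Ow; exact: FE.
have nJ : \forall v \near u', jac F' v =
    (\matrix_(i, j) 'D_(delta_mx 0 i) phi v 0 j) *m jac F (phi v).
  by apply: filterS2 (near_join nOm) nWF => v nv Wv; exact: jF.
have Ou : Om u' := nbhs_singleton nOm.
have [dNphi jN] : coord_derivable (N \o phi) u' /\ jac (N \o phi) u' =
    (\matrix_(i, j) 'D_(delta_mx 0 i) phi u' 0 j) *m jac N (phi u').
  apply: (@jac_comp _ _ WN) => //; first by rewrite phiu.
  by move=> i; exact: smooth_on_derivable sphi Ou.
have adN : adapted K F' (N \o phi) u'.
  apply: in_chart_adapted => //.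
  apply: filterS3 nOm nWN nJ => v Ov WNv Jv.
  have [nn nx nF] := nN _ WNv; split; first exact: nn.
    by have -> : in_chart X d t v = F (phi v) := FE v Ov; exact: nx.
  move=> i; rewrite -/F'.
  have -> : partial F' i v = row i (jac F' v) by rewrite rowK.
  rewrite Jv row_mul dotC /dot -mulmxA jac_mul_tr ?mulmx0 ?mxE //.
  by move=> j; rewrite dotC; exact: nF.
have cNphi : {for u', continuous (N \o phi)}.
  apply: continuous_comp => //; rewrite phiu.
  exact: smooth_on_continuous sN WNp.
have [s [s2 Ns Ss]] := shape_sign K0 adN ad' (near_regular ad dp Tt) cNphi cN'.
have Nphiu : (N \o phi) u' = N u by rewrite -phiu.
exists s; split; [exact: s2|by rewrite Ns Nphiu|].
apply: etrans Ss _; apply: (congr1 (fun A => s *: A)).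
have [_ im] : coord_derivable F' u' /\ immersive_at F' u'.
  by apply: in_chart_regular => //; exists p.
have jF' := nbhs_singleton nJ; rewrite phiu in jF' jN.
exact: shape_reparam im jF' jN.
Qed.

Lemma local_unit_normal_exists c p t : mfd_atlas c -> chart_dom c p ->
  time_interval T t -> exists N, local_unit_normal (in_chart X c t) N (chart_map c p).
Proof.
move=> ac cp Tt; case: sol => _ _ _ eq.
by have [N nN _] := eq c p t ac cp Tt; exists N.
Qed.

(** |A|^2 and H^2 are quadratic in the Weingarten map, so the sign left by [shape_chart] disappears
    and they descend to functions on M, whether or not M is orientable. *)
Lemma curvature_functions : exists a2 h2 : M -> R -> R,
  forall c p t N, mfd_atlas c -> chart_dom c p -> time_interval T t ->
    adapted K (in_chart X c t) N (chart_map c p) ->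
    {for chart_map c p, continuous N} ->
    let S := shape (in_chart X c t) N (chart_map c p) in
    a2 p t = \sum_a \sum_b S a b * S a b /\ h2 p t = (\tr S) ^+ 2.
Proof.
have ex (q : M * R) : exists y : R * R, time_interval T q.2 ->
    forall c N, mfd_atlas c -> chart_dom c q.1 ->
    adapted K (in_chart X c q.2) N (chart_map c q.1) ->
    {for chart_map c q.1, continuous N} ->
    let S := shape (in_chart X c q.2) N (chart_map c q.1) in
    y.1 = \sum_a \sum_b S a b * S a b /\ y.2 = (\tr S) ^+ 2.
  (* Outside [0, T) nothing is required, and (0, 0) is a default value. *)
  case: q => p t /=; have [Tt|nT] := pselect (time_interval T t); last by exists (0, 0).
  have [c ac cp] := mfd_cover p.
  have [N nN] := local_unit_normal_exists ac cp Tt.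
  pose S := shape (in_chart X c t) N (chart_map c p).
  exists (\sum_a \sum_b S a b * S a b, (\tr S) ^+ 2) => _ d N' ad dp aN' cN' /=.
  have [s [s2 _ ->]] := shape_chart ac ad cp dp Tt nN aN' cN'.
  have ss : s * s = 1 by rewrite -expr2.
  rewrite -/S linearZ /= exprMn s2 mul1r; split=> //.
  apply: eq_bigr => a _; apply: eq_bigr => b _.
  have -> : (s *: S) a b = s * S a b by rewrite mxE.
  by rewrite [RHS]mulrACA ss mul1r.
have [y hy] := choice ex.
exists (fun p t => (y (p, t)).1), (fun p t => (y (p, t)).2) => c p t N ac cp Tt aN cN.
exact (hy (p, t) Tt c N ac cp aN cN).
Qed.

End FlowGeometry.

(** * The unit normal in space-time *)

Section SmoothMatrices.
Context {R : realType} {V : normedModType R} (U : set V).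
Hypothesis oU : open U.

Definition smooth_mx m n (A : V -> 'M[R]_(m, n)) :=
  forall i j, smooth_on U (fun z => A z i j).

Lemma smooth_mx_ext m n (A B : V -> 'M[R]_(m, n)) :
  (forall z, U z -> A z = B z) -> smooth_mx A -> smooth_mx B.
Proof.
move=> AB sA i j; apply: (smooth_on_ext oU _ (sA i j)) => z; rewrite inE => Uz.
by rewrite AB.
Qed.

Lemma smooth_mx_cst m n (A : 'M[R]_(m, n)) : smooth_mx (fun=> A).
Proof. by move=> i j; exact: (smooth_on_cst oU). Qed.

Lemma smooth_mx_mul m n p (A : V -> 'M[R]_(m, n)) (B : V -> 'M[R]_(n, p)) :
  smooth_mx A -> smooth_mx B -> smooth_mx (fun z => A z *m B z).
Proof.
move=> sA sB i j.
have := @smooth_on_sum _ _ U oU _ (index_enum (ordinal n)) predT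
   (fun k z => A z i k * B z k j) (fun k _ => smooth_on_mul oU (sA i k) (sB k j)).
by apply: (smooth_on_ext oU) => z _; rewrite mxE.
Qed.

Lemma smooth_mx_tr m n (A : V -> 'M[R]_(m, n)) :
  smooth_mx A -> smooth_mx (fun z => (A z)^T).
Proof.
by move=> sA i j; apply: (smooth_on_ext oU _ (sA j i)) => z _; rewrite mxE.
Qed.

Lemma smooth_mx_sub m n (A B : V -> 'M[R]_(m, n)) :
  smooth_mx A -> smooth_mx B -> smooth_mx (fun z => A z - B z).
Proof.
move=> sA sB i j.
apply: (smooth_on_ext oU _ (smooth_on_add oU (sA i j) (smooth_on_opp oU (sB i j)))) => z _.
by rewrite !mxE.
Qed.

Lemma smooth_mx_scale m n (a : V -> R) (A : V -> 'M[R]_(m, n)) :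
  smooth_on U a -> smooth_mx A -> smooth_mx (fun z => a z *: A z).
Proof.
move=> sa sA i j; apply: (smooth_on_ext oU _ (smooth_on_mul oU sa (sA i j))) => z _.
by rewrite mxE.
Qed.

Lemma smooth_on_det n (A : V -> 'M[R]_n) : smooth_mx A -> smooth_on U (fun z => \det (A z)).
Proof.
move=> sA.
have sp (s : 'S_n) : smooth_on U (fun z => (-1) ^+ s * \prod_i A z i (s i)).
  apply: (smooth_on_mul oU (smooth_on_cst oU ((-1) ^+ s))).
  by apply: (@smooth_on_prod _ _ _ oU _ _ predT (fun i z => A z i (s i))) => i _; exact: sA.
exact: (@smooth_on_sum _ _ U oU _ _ predT (fun (s : 'S_n) z => (-1) ^+ s * \prod_i A z i (s i)) (fun s _ => sp s)).
Qed.

Lemma smooth_mx_inv n (A : V -> 'M[R]_n) : (forall z, U z -> A z \in unitmx) ->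
  smooth_mx A -> smooth_mx (fun z => invmx (A z)).
Proof.
move=> uA sA.
have sadj : smooth_mx (fun z => \adj (A z)).
  move=> i j.
  have sm : smooth_mx (fun z => row' j (col' i (A z))).
    by move=> a b; apply: (smooth_on_ext oU _ (sA (lift j a) (lift i b))) => z _; rewrite !mxE.
  apply: (smooth_on_ext oU _ (smooth_on_mul oU (smooth_on_cst oU ((-1) ^+ (j + i))) (smooth_on_det sm))) => z _.
  by rewrite mxE.
have sdet : smooth_on U (fun z => (\det (A z))^-1).
  apply: (smooth_on_inv oU) (smooth_on_det sA) => z Uz.
  by have := uA z Uz; rewrite unitmxE unitfE.
apply: smooth_mx_ext (smooth_mx_scale sdet sadj) => z Uz.
by rewrite /invmx uA.
Qed.

End SmoothMatrices.

Lemma smooth_mxW {R : realType} {V : normedModType R} (U U' : set V) m n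
    (A : V -> 'M[R]_(m, n)) : U' `<=` U -> smooth_mx U A -> smooth_mx U' A.
Proof. by move=> s sA i j; exact: smooth_onW (sA i j). Qed.

Lemma open_preimage_smooth {R : realType} {V : normedModType R} (U : set V)
    (f : V -> R) (B : set R) :
  open U -> smooth_on U f -> open B -> open (U `&` f @^-1` B).
Proof.
move=> oU sf oB; rewrite openE => z [Uz Bz]; apply: filterI.
  by apply: open_nbhs_nbhs.
by apply: (smooth_on_continuous sf Uz); apply: open_nbhs_nbhs.
Qed.

Section SpaceTime.
Context {R : realType} {n : nat}.
Notation V := ('rV[R]_n * R)%type.
Implicit Types (g nu : V -> 'rV[R]_n.+2) (z : V) (U : set V).

Definition e_space (i : 'I_n) : V := (delta_mx 0 i, 0).
Definition e_time : V := (0, 1).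

Definition sjac g z : 'M[R]_(n, n.+2) := \matrix_(i, k) 'D_(e_space i) (fun z => g z 0 k) z.
Definition smetric g z := sjac g z *m (sjac g z)^T.
(* The coefficients G of the tangential operators D_a = sum_j G_aj d_j. *)
Definition tangent g z : 'M[R]_(n.+2, n) := (sjac g z)^T *m invmx (smetric g z).
Definition sshape g nu z := tangent g z *m sjac nu z.

Lemma smooth_sjac U g : open U -> smooth_mx U g -> smooth_mx U (sjac g).
Proof.
move=> oU sg i k; apply: (smooth_on_ext oU _ (smooth_onD (e_space i) (sg 0 k))) => z _.
by rewrite mxE.
Qed.

Lemma smooth_tangent U g : open U -> smooth_mx U g ->
  (forall z, U z -> smetric g z \in unitmx) -> smooth_mx U (tangent g).
Proof.
move=> oU sg ug; have sj := smooth_sjac oU sg.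
apply: smooth_mx_mul => //; first exact: smooth_mx_tr.
by apply: smooth_mx_inv => //; apply: smooth_mx_mul => //; exact: smooth_mx_tr.
Qed.

Lemma sjac_slice g v s : (forall i : 'I_n, derivable g (v, s) (e_space i)) ->
  coord_derivable (fun v => g (v, s)) v /\ sjac g (v, s) = jac (fun v => g (v, s)) v.
Proof.
move=> dg.
have dF : coord_derivable (fun v => g (v, s)) v.
  by move=> i; apply: derivable_slice; exact: dg.
split=> //; apply/matrixP => i k; rewrite jacE // mxE.
exact/esym/(@derive_slice _ _ _ (fun z => g z 0 k)).
Qed.

(** The normals given by the flow at different times are unrelated, so one fixed normal [w] at [z0]
    is projected to the normal line at nearby points and normalised. The conclusions are conditional
    because [g] is only an extension of the flow: across t = 0 it may leave the sphere. *)
Lemma spacetime_normal (K : R) (U0 : set V) g (z0 : V) (w : 'rV[R]_n.+2) :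
  0 < K -> open U0 -> smooth_mx U0 g -> U0 z0 ->
  row_free (sjac g z0) -> dot (g z0) (g z0) = K^-1 -> sjac g z0 *m (g z0)^T = 0 ->
  dot w w = 1 -> dot w (g z0) = 0 -> sjac g z0 *m w^T = 0 ->
  exists (U1 : set V) (nu : V -> 'rV[R]_n.+2),
  [/\ open U1 /\ U1 z0, U1 `<=` U0, (forall z, U1 z -> smetric g z \in unitmx),
      smooth_mx U1 nu &
      forall z, U1 z -> dot (g z) (g z) = K^-1 -> sjac g z *m (g z)^T = 0 ->
      [/\ dot (nu z) (nu z) = 1, dot (nu z) (g z) = 0 & sjac g z *m (nu z)^T = 0]].
Proof.
move=> K0 oU0 sg Uz0 fz0 xx Fx ww wx Fw.
(* Where the hypotheses on g hold, [Q] is the orthogonal projection onto the normal line and [rho]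
   the squared length of the projected [w]. It is 1 at [z0], hence positive nearby. *)
pose Q z := 1%:M - tangent g z *m sjac g z - K *: ((g z)^T *m g z).
pose rho z := (w *m Q z *m w^T) 0 0.
have sJ0 := smooth_sjac oU0 sg.
have sm0 : smooth_mx U0 (smetric g).
  by apply: smooth_mx_mul => //; exact: smooth_mx_tr.
pose U' := U0 `&` (fun z => \det (smetric g z)) @^-1` [set x : R | x != 0].
have oU' : open U'.
  exact: open_preimage_smooth oU0 (smooth_on_det oU0 sm0) (@open_neq R 0).
have U'0 : U' `<=` U0 by move=> z [].
have uU' z : U' z -> smetric g z \in unitmx by case=> _; rewrite /= unitmxE unitfE.
have sg' := smooth_mxW U'0 sg.
have sT : smooth_mx U' (tangent g) by apply: smooth_tangent.
have sQ : smooth_mx U' Q.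
  apply: smooth_mx_sub => //.
    apply: smooth_mx_sub => //; first exact: smooth_mx_cst.
    exact: (smooth_mx_mul oU' sT (smooth_mxW U'0 sJ0)).
  apply: (smooth_mx_scale oU' (smooth_on_cst oU' K)).
  exact: (smooth_mx_mul oU' (smooth_mx_tr oU' sg') sg').
have swQ : smooth_mx U' (fun z => w *m Q z).
  exact: (smooth_mx_mul oU' (smooth_mx_cst oU' w) sQ).
have srho : smooth_on U' rho.
  exact: (smooth_mx_mul oU' swQ (smooth_mx_cst oU' w^T)).
pose U1 := U' `&` rho @^-1` [set x : R | 0 < x].
have oU1 : open U1 by exact: open_preimage_smooth oU' srho (@open_gt R 0).
have U1' : U1 `<=` U' by move=> z [].
have sr : smooth_on U1 (fun z => (Num.sqrt (rho z))^-1).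
  apply: (smooth_on_inv oU1) (smooth_on_sqrt oU1 _ (smooth_onW U1' srho)).
    by move=> z [_ /= h]; rewrite gt_eqF // sqrtr_gt0.
  by move=> z [].
exists U1, (fun z => (Num.sqrt (rho z))^-1 *: (w *m Q z)); split.
- split; first exact: oU1.
  have Uz0' : U' z0.
    by split=> //=; have := gram_unit fz0; rewrite unitmxE unitfE.
  split=> //=; rewrite /rho /Q.
  have -> : tangent g z0 *m sjac g z0 = 1%:M - w^T *m w - K *: ((g z0)^T *m g z0).
    by apply: frame_projection => //; rewrite gt_eqF.
  have -> : 1%:M - (1%:M - w^T *m w - K *: ((g z0)^T *m g z0)) - K *: ((g z0)^T *m g z0)
      = w^T *m w by rewrite -addrA -opprD subrK opprB addrC subrK.
  by rewrite !mulmxA (dot_mx w w) ww mul1mx -[(w *m w^T) 0 0]/(dot w w) ww ltr01.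
- exact: subset_trans U'0.
- by move=> z /U1' /uU'.
- by apply: (smooth_mx_scale oU1 sr); exact: smooth_mxW swQ.
- move=> z [U'z /= rz] xxz Fxz.
  have ug := uU' z U'z.
  have Kn : K != 0 by rewrite gt_eqF.
  have gxx : g z *m (g z)^T = (K^-1)%:M by rewrite dot_mx xxz.
  have gF : g z *m (sjac g z)^T = 0 by rewrite -[g z]trmxK -trmx_mul Fxz trmx0.
  have Qx : Q z *m (g z)^T = 0.
    rewrite /Q !mulmxBl mul1mx -mulmxA Fxz mulmx0 subr0 -scalemxAl -mulmxA gxx.
    by rewrite mul_mx_scalar scalerA mulfV // scale1r subrr.
  have QF : Q z *m (sjac g z)^T = 0.
    rewrite /Q !mulmxBl mul1mx -scalemxAl -[(g z)^T *m _ *m _]mulmxA gF mulmx0 scaler0 subr0.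
    rewrite -mulmxA -/(smetric g z) /tangent -mulmxA mulVmx // mulmx1 subrr //.
  have gT : (smetric g z)^T = smetric g z by rewrite /smetric trmx_mul trmxK.
  have PT : (tangent g z *m sjac g z)^T = tangent g z *m sjac g z.
    by rewrite trmx_mul {1}/tangent trmx_mul trmxK trmx_inv gT mulmxA.
  have QT : (Q z)^T = Q z.
    by rewrite /Q linearB linearB /= linearZ /= PT trmx1 trmx_mul trmxK.
  have QQ : Q z *m Q z = Q z.
    rewrite {2}/Q !mulmxBr mulmx1 /tangent -scalemxAr !mulmxA QF Qx !mul0mx scaler0 !subr0 //.
  split.
  + rewrite dotZl dotC dotZl mulrA /dot trmx_mul QT mulmxA -(mulmxA w) QQ -/(rho z).
    rewrite -invfM -expr2 sqr_sqrtr ?mulVf ?gt_eqF // ltW //.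
  + by rewrite dotZl /dot -mulmxA Qx mulmx0 mxE mulr0.
  + rewrite linearZ /= -scalemxAr trmx_mul QT mulmxA.
    rewrite -[sjac g z *m Q z]trmxK trmx_mul QT QF trmx0 mul0mx scaler0 //.
Qed.

End SpaceTime.

(** * The maximum principle *)

Section LocalMax.
Context {R : realType} {n : nat}.
Notation V := ('rV[R]_n * R)%type.
Variables (K : R) (Om : set V) (g nu : V -> 'rV[R]_n.+2).
Hypothesis K0 : 0 < K.
Hypothesis oOm : open Om.
Hypothesis sg : smooth_mx Om g.
Hypothesis snu : smooth_mx Om nu.
Hypothesis imm : forall z, Om z -> row_free (sjac g z).
Hypothesis sph : forall z, Om z -> dot (g z) (g z) = K^-1.
Hypothesis tan : forall z, Om z -> sjac g z *m (g z)^T = 0.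
Hypothesis nrm : forall z, Om z ->
  [/\ dot (nu z) (nu z) = 1, dot (nu z) (g z) = 0 & sjac g z *m (nu z)^T = 0].
Hypothesis flow : forall z b, Om z ->
  'D_e_time (fun z => g z 0 b) z = - \tr (sshape g nu z) * nu z 0 b.

Let S : comPzRingType := sfun oOm.
Let ug z : Om z -> smetric g z \in unitmx. Proof. by move=> Oz; exact: gram_unit (imm Oz). Qed.
Let sT : smooth_mx Om (tangent g). Proof. exact: smooth_tangent. Qed.
Let cS (k : R) : S := to_sfun oOm (smooth_on_cst oOm k).
Let xS b : S := to_sfun oOm (sg 0 b).
Let nS b : S := to_sfun oOm (snu 0 b).
Let GS a j : S := to_sfun oOm (sT a j).
Let d (j : 'I_n) : S -> S := sder (e_space j).
Let Dt : S -> S := sder (e_time : V).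
Let DS a f : S := \sum_j GS a j * d j f.
Let AS a b : S := DS a (nS b).
Let HS : S := \sum_a AS a a.
Let A2S : S := \sum_a \sum_b AS a b * AS a b.
Let lapS (f : S) : S := \sum_c DS c (DS c f).

Lemma der_cst v k : sder v (cS k) = 0.
Proof. by apply: sfunP => z; rewrite sder_to_sfun derive_cst. Qed.

Lemma AS_val a b z : AS a b z = sshape g nu (sval z) a b.
Proof.
rewrite /AS /DS sfun_sum [RHS]mxE; apply: eq_bigr => j _.
by rewrite sfunM /d sder_to_sfun [sjac _ _ _ _]mxE.
Qed.

Lemma HS_val z : HS z = \tr (sshape g nu (sval z)).
Proof. by rewrite /HS sfun_sum; apply: eq_bigr => a _; rewrite AS_val. Qed.

Lemma A2S_val z : A2S z = \sum_a \sum_b sshape g nu (sval z) a b * sshape g nu (sval z) a b.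
Proof.
rewrite /A2S sfun_sum; apply: eq_bigr => a _; rewrite sfun_sum.
by apply: eq_bigr => b _; rewrite sfunM AS_val.
Qed.

Lemma dx_val j c z : d j (xS c) z = sjac g (sval z) j c.
Proof. by rewrite /d sder_to_sfun mxE. Qed.

Lemma ring_evolution : exists (T2 : S) (W : 'I_n.+2 -> 'I_n.+2 -> 'I_n.+2 -> S),
  [/\ Dt A2S - lapS A2S =
        (A2S * A2S) *+ 2 - (n%:R * cS K * A2S) *+ 2 + (cS K * HS * HS) *+ 4 - T2 *+ 2,
      Dt (HS * HS) - lapS (HS * HS) =
        (HS * HS * (A2S + n%:R * cS K)) *+ 2 - (\sum_c DS c HS * DS c HS) *+ 2
    & \sum_c \sum_a \sum_b W c a b * W c a b =
        n.+2%:R * (n.+2%:R * T2 - (\sum_c DS c HS * DS c HS) *+ 3)].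
Proof.
have Kn : K != 0 by rewrite gt_eqF.
apply: (@mcf_evolution S n d Dt (cS K) xS nS GS).
- by move=> j; exact: sder_derivation.
- exact: sder_derivation.
- exact: sfun_two_regular.
- by move=> i j f; exact: sder_comm.
- by move=> i f; exact: sder_comm.
- by move=> j; exact: der_cst.
- exact: der_cst.
- apply: sfunP => -[z Oz]; rewrite sfunM sfun_sum sfun1 /=.
  have := sph Oz; rewrite dotE => h; transitivity (K * K^-1); last by rewrite mulfV.
  by congr (_ * _); rewrite -h; apply: eq_bigr => a _.
- apply: sfunP => -[z Oz]; rewrite sfun_sum sfun1 /=.
  by have [h _ _] := nrm Oz; rewrite -h dotE; apply: eq_bigr => a _.
- apply: sfunP => -[z Oz]; rewrite sfun_sum sfun0 /=.
  by have [_ h _] := nrm Oz; apply: etrans h; rewrite dotE; apply: eq_bigr => a _.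
- move=> j k; apply: sfunP => -[z Oz]; rewrite sfun_sum.
  transitivity ((sjac g z *m tangent g z) j k).
    by rewrite mxE; apply: eq_bigr => c _; rewrite sfunM dx_val.
  rewrite /tangent mulmxA mulmxV ?ug // mxE.
  by rewrite -mulr_natr mul1r; case: (j == k).
- move=> a b; apply: sfunP => -[z Oz]; rewrite sfun_sum.
  transitivity ((tangent g z *m sjac g z) a b).
    by rewrite mxE; apply: eq_bigr => j _; rewrite sfunM dx_val.
  have [h1 h2 h3] := nrm Oz.
  rewrite /tangent /smetric (frame_projection Kn (imm Oz) (sph Oz) h1 h2 (tan Oz) h3).
  rewrite !mxE !big_ord1 !mxE; congr (_ - _ - _).
  + by case: (a == b).
  + by rewrite /= mulrA.
- move=> b; apply: sfunP => -[z Oz]; rewrite sfunM sfunN.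
  rewrite [X in - X * _]HS_val /Dt sder_to_sfun; exact: flow.
Qed.

Lemma sder_sum (c : 'I_n -> R) (f : S) :
  sder (\sum_j c j *: e_space j) f = \sum_j cS (c j) * d j f.
Proof.
apply: sfunP => -[z Oz]; rewrite sfun_sum.
have nO : \forall y \near z, Om y := open_nbhs_nbhs (conj oOm Oz).
have [_ E] := @is_derive_dir_sum _ _ (ext0 f) z _ (index_enum (ordinal n)) e_space c
  (fun i => filterS (fun y Oy => smooth_on_derivable (sfun_smooth f) Oy) nO)
  (fun i => smooth_on_continuous (smooth_onD (e_space i) (sfun_smooth f)) Oz).
exact: E.
Qed.

(** The displayed quantity is the reaction part of the heat operator of f. It equals the value of
    that operator, nonnegative at such a maximum, plus 2 (|T|^2 - c |DH|^2). Comparison with later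
    times is never made. *)
Lemma local_max_principle (c : R) (z0 : V) :
  let f z := \sum_a \sum_b sshape g nu z a b * sshape g nu z a b
             - c * (\tr (sshape g nu z)) ^+ 2 in
  let al := \sum_a \sum_b sshape g nu z0 a b * sshape g nu z0 a b in
  let eta := (\tr (sshape g nu z0)) ^+ 2 in
  0 <= c -> c * n.+2%:R <= 3 -> Om z0 ->
  (forall z, Om z -> z.2 <= z0.2 -> f z <= f z0) ->
  0 <= 2 * al ^+ 2 - 2 * n%:R * K * al + 4 * K * eta - 2 * c * eta * (al + n%:R * K).
Proof.
move=> f al eta c0 c3 Oz0 fmax.
pose zS : sig Om := exist _ z0 Oz0.
pose fS : S := A2S - cS c * (HS * HS).
have fE (z : sig Om) : fS z = f (sval z).
  by rewrite /fS sfunD sfunN !sfunM A2S_val !HS_val /f expr2.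
have sf : smooth_on Om (ext0 fS) := sfun_smooth fS.
have extE z : Om z -> ext0 fS z = f z.
  by move=> Oz; rewrite -[z]/(sval (exist Om z Oz)) ext0E fE.
have nO (v : V) : \forall s \near (0 : R), Om (z0 + s *: v).
  have cl : {for (0 : R), continuous (fun s : R => z0 + s *: v)}.
    apply: cvgD; first exact: cvg_cst.
    by apply: cvgZr_tmp; exact: cvg_id.
  by apply: cl; rewrite scale0r addr0; apply: open_nbhs_nbhs.
(* Spatial directions keep the time fixed, so the maximum is two-sided along them. *)
have max_dir v : v.2 = 0 -> 'D_v (ext0 fS) z0 = 0 /\ 'D_v ('D_v (ext0 fS)) z0 <= 0.
  move=> v2; apply: (second_order_max oOm sf Oz0).
  apply: filterS (nO v) => s Os; rewrite !extE //; apply: fmax => //=.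
  by rewrite v2 scaler0 addr0.
have dd j : derivation (d j) := sder_derivation oOm (e_space j).
have d0 j : d j fS zS = 0 by have [] := max_dir (e_space j) erefl.
have lap_le0 : lapS fS zS <= 0.
  rewrite /lapS sfun_sum; apply: sumr_le0 => a _.
  (* The coefficients of [DS a] are frozen at [z0]. As the spatial gradient of f vanishes there,
     derivatives of the coefficients drop out, and [DS a (DS a fS)] is a second derivative in the
     constant direction v. *)
  pose v := \sum_j GS a j zS *: (e_space j : V).
  have v2 : v.2 = 0.
    by rewrite /v; elim/big_rec: _ => //= j w _ w2; rewrite w2 scaler0 addr0.
  have [_] := max_dir v v2.
  have -> : 'D_v ('D_v (ext0 fS)) z0 = sder v (sder v fS) zS.
    by apply/esym; exact: (@derive_ext0 _ _ _ oOm (sder v fS) ('D_v (ext0 fS)) v zS (fun=> erefl)).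
  suff -> : DS a (DS a fS) zS = sder v (sder v fS) zS by [].
  rewrite !sder_sum /DS !sfun_sum; apply: eq_bigr => j _; rewrite !sfunM; congr (_ * _).
  rewrite !(derivation_sum (dd j)) !sfun_sum; apply: eq_bigr => k _.
  transitivity (GS a k zS * d j (d k fS) zS).
    by apply: etrans (sderM_val _ _ _ _) _; rewrite (d0 k) mulr0 add0r.
  apply/esym; apply: etrans (sderM_val _ _ _ _) _.
  by rewrite (der_cst (e_space j) _) sfun0 mul0r add0r.
(* f is compared with earlier times only, so the one-sided argument is applied backwards in time. *)
have Dt_ge0 : 0 <= Dt fS zS.
  have : 'D_((-1) *: (e_time : V)) (ext0 fS) z0 <= 0.
    apply: one_sided_max.
    - have nz : \forall y \near z0, Om y := open_nbhs_nbhs (conj oOm Oz0).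
      by apply: filterS nz => y; exact: smooth_on_derivable.
    - exact: (smooth_on_continuous (smooth_onD _ sf) Oz0).
    - have np : \forall s \near (0 : R)^'+, 0 < s by exact: nbhs_right_gt.
      have nO' : \forall s \near (0 : R)^'+, Om (z0 + s *: ((-1) *: (e_time : V))).
        exact: cvg_within (nO _).
      apply: filterS2 np nO' => s s0 Os; rewrite !extE //; apply: fmax => //=.
      rewrite -[leRHS]addr0 lerD2l /GRing.scale /= mulr1 mulrN1 oppr_le0.
      exact: ltW.
  have [_ ->] := is_derive_dirZ (-1) (smooth_on_derivable (v := e_time) sf Oz0).
  by rewrite mulN1r oppr_le0.
have [T2 [W [E1 E2 E3]]] := ring_evolution.
have dDt := sder_derivation oOm (e_time : V) : derivation Dt.
have Elin : Dt fS - lapS fS = (Dt A2S - lapS A2S) - cS c * (Dt (HS * HS) - lapS (HS * HS)).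
  have -> : Dt fS = Dt A2S - cS c * Dt (HS * HS).
    by rewrite /fS (derivationB dDt) (derivationM dDt) [Dt (cS c)]der_cst mul0r add0r.
  have -> : lapS fS = lapS A2S - cS c * lapS (HS * HS).
    rewrite /lapS mulr_sumr -sumrB; apply: eq_bigr => a _.
    have da : derivation (DS a) by apply: tangential_derivation => j; exact: dd.
    have dc : DS a (cS c) = 0.
      by rewrite /DS big1 // => j _; rewrite /d der_cst mulr0.
    by rewrite /fS !(derivationB da) !(derivationM da) !dc !mul0r !add0r !(derivationM da) dc mul0r add0r.
  ring.
have {Elin} := congr1 (fun h : S => h zS) Elin; rewrite E1 E2.
have : 0 <= (\sum_c \sum_a \sum_b W c a b * W c a b) zS.
  rewrite sfun_sum; apply: sumr_ge0 => i _; rewrite sfun_sum; apply: sumr_ge0 => j _.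
  by rewrite sfun_sum; apply: sumr_ge0 => k _; rewrite sfunM -expr2 sqr_ge0.
rewrite E3.
have natS k : (k%:R : S) zS = k%:R by rewrite sfunMn sfun1.
have : 0 <= (\sum_c DS c HS * DS c HS) zS.
  by rewrite sfun_sum; apply: sumr_ge0 => i _; rewrite sfunM -expr2 sqr_ge0.
move: (\sum_c DS c HS * DS c HS) => h2 h2_ge0.
rewrite [X in 0 <= X](_ : _ = n.+2%:R * (n.+2%:R * T2 zS - h2 zS *+ 3)); last first.
  by rewrite sfunM natS sfunD sfunN sfunM natS sfunMn.
move=> kato; rewrite [LHS](_ : _ = Dt fS zS - lapS fS zS); last by [].
rewrite [RHS](_ : _ =
    (A2S zS * A2S zS) *+ 2 - (n%:R * cS K zS * A2S zS) *+ 2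
    + (cS K zS * HS zS * HS zS) *+ 4 - T2 zS *+ 2
    - cS c zS * ((HS zS * HS zS * (A2S zS + n%:R * cS K zS)) *+ 2 - h2 zS *+ 2)); last first.
  by rewrite -(natS n).
move: kato.
have -> : A2S zS = al by rewrite A2S_val.
have -> : HS zS = \tr (sshape g nu z0) by rewrite HS_val.
have -> : eta = \tr (sshape g nu z0) * \tr (sshape g nu z0) by rewrite /eta expr2.
have -> : cS K zS = K by [].
have -> : cS c zS = c by [].
move: (\tr (sshape g nu z0)) (T2 zS) (h2 zS) h2_ge0 Dt_ge0 lap_le0 => tH t2 hh hh0 D0 L0.
move: (Dt fS zS) (lapS fS zS) D0 L0 => Df Lf D0 L0 kato Eq.
have n2 : (0 : R) < n.+2%:R by rewrite ltr0n.
have kato' : hh *+ 3 <= n.+2%:R * t2 by move: kato; rewrite pmulr_rge0 // subr_ge0.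
(* The bound c (n + 2) <= 3 is exactly what lets [kato] absorb the gradient of H. *)
have key : c * hh <= t2.
  rewrite -(ler_pM2l n2); apply: le_trans kato'.
  by rewrite mulrA -[_ *+ 3]mulr_natl ler_wpM2r // mulrC.
have -> : 2 * al ^+ 2 - 2 * n%:R * K * al + 4 * K * (tH * tH) - 2 * c * (tH * tH) * (al + n%:R * K)
  = (Df - Lf) + 2 * (t2 - c * hh).
  by rewrite Eq; ring.
by rewrite addr_ge0 // ?mulr_ge0 ?subr_ge0 // (le_trans L0).
Qed.

End LocalMax.

Lemma continuous_at_mx {R : realType} (T : topologicalType) m n
    (F : T -> 'M[R]_(m, n)) (u : T) :
  (forall i j, {for u, continuous (fun v => F v i j)}) -> {for u, continuous F}.
Proof.
move=> cF; apply/cvgrPdist_lt => e e0.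
have near_ij (ij : 'I_m * 'I_n) : \forall v \near u, `|F u ij.1 ij.2 - F v ij.1 ij.2| < e.
  by have /cvgrPdist_lt := cF ij.1 ij.2; apply.
have : \forall v \near u, forall ij : 'I_m * 'I_n, `|F u ij.1 ij.2 - F v ij.1 ij.2| < e.
  exact: filter_forall.
apply: filterS => v h; rewrite /Num.Def.normr /= mx_normrE bigmax_lt // => -[i j] _.
by rewrite !mxE; exact: (h (i, j)).
Qed.

Lemma open_time {R : realType} (T : \bar R) : open [set t : R | 0 < t /\ (t%:E < T)%E].
Proof.
have oT : open [set t : R | (t%:E < T)%E].
  case: T => [r| |].
  - rewrite (_ : [set _ | _] = [set t | t < r]); first exact: open_lt.
    by apply/seteqP; split=> t /=; rewrite lte_fin.
  - rewrite (_ : [set _ | _] = setT); first exact: openT.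
    by apply/seteqP; split=> // t _ /=; rewrite ltry.
  - rewrite (_ : [set _ | _] = set0); first exact: open0.
    by apply/seteqP; split=> // t /=; rewrite ltNge leNye.
exact: openI (@open_gt R 0) oT.
Qed.

(** * The flow in space-time coordinates *)

Section FlowLocal.
Context {R : realType} {n : nat} {M : smooth_manifold R n} {K : R} {T : \bar R}.
Context {X : M -> R -> 'rV[R]_n.+2}.
Hypothesis K0 : 0 < K.
Hypothesis sol : mcf_solution K T X.
Notation V := ('rV[R]_n * R)%type.
Implicit Types (c d : chart R n M) (p : M) (t : R).

Section InChart.
(** [g] is a smooth extension of the flow to an open set that may reach below t = 0; it is tied to
    the flow only at times in [0, T). *)
Variables (c : chart R n M) (U0 : set V) (g : V -> 'rV[R]_n.+2).
Hypothesis ac : mfd_atlas c.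
Hypothesis oU0 : open U0.
Hypothesis sg : smooth_on U0 g.
Hypothesis gE : forall v s, (chart_map c @` chart_dom c) v -> time_interval T s ->
  U0 (v, s) -> in_chart X c s v = g (v, s).

Lemma near_slice v s : (chart_map c @` chart_dom c) v -> time_interval T s -> U0 (v, s) ->
  \forall w \near v, in_chart X c s w = g (w, s).
Proof.
move=> cv Ts Uv.
have n1 : \forall w \near v, (chart_map c @` chart_dom c) w.
  by apply: open_nbhs_nbhs; split=> //; exact: chart_img_open.
have n2 : \forall w \near v, U0 (w, s).
  by apply: (@open_nbhs_nbhs _ v [set w | U0 (w, s)]); split=> //; exact: open_slice.
by apply: filterS2 n1 n2 => w cw Uw; exact: gE.
Qed.

Lemma sjac_in_chart v s : (chart_map c @` chart_dom c) v -> time_interval T s -> U0 (v, s) ->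
  sjac g (v, s) = jac (in_chart X c s) v.
Proof.
move=> cv Ts Uv; have [_ ->] : coord_derivable (fun w => g (w, s)) v /\
    sjac g (v, s) = jac (fun w => g (w, s)) v.
  by apply: sjac_slice => i; exact: (smooth_on_derivable sg Uv).
by apply/esym/near_eq_jac; exact: near_slice.
Qed.

Lemma in_chart_point v s : (chart_map c @` chart_dom c) v -> time_interval T s -> U0 (v, s) ->
  [/\ row_free (sjac g (v, s)), dot (g (v, s)) (g (v, s)) = K^-1
    & sjac g (v, s) *m (g (v, s))^T = 0].
Proof.
move=> cv Ts Uv; have [dF im] := in_chart_regular sol ac Ts cv.
have gv := gE cv Ts Uv; rewrite sjac_in_chart // -gv; split=> //.
  exact: in_chart_sphere sol _ _ _ Ts.
apply: near_sphere_Fx => //; apply: filterE => w; exact: in_chart_sphere sol _ _ _ Ts.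
Qed.

Variables (U1 : set V) (nu : V -> 'rV[R]_n.+2).
Hypothesis oU1 : open U1.
Hypothesis U10 : U1 `<=` U0.
Hypothesis snu : smooth_mx U1 nu.
Hypothesis nrm : forall z, U1 z -> dot (g z) (g z) = K^-1 -> sjac g z *m (g z)^T = 0 ->
  [/\ dot (nu z) (nu z) = 1, dot (nu z) (g z) = 0 & sjac g z *m (nu z)^T = 0].

Lemma nu_unit_normal v s : (chart_map c @` chart_dom c) v -> time_interval T s -> U1 (v, s) ->
  unit_normal_at (in_chart X c s) (fun w => nu (w, s)) v.
Proof.
move=> cv Ts Uv; have U0v := U10 Uv.
have [_ xx Fx] := in_chart_point cv Ts U0v.
have [nn nx Fn] := nrm Uv xx Fx.
split; [exact: nn|by rewrite gE|].
move=> i; rewrite sjac_in_chart // in Fn.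
have := congr1 (fun A : 'cV[R]_n => A i 0) Fn; rewrite mxE [RHS]mxE => h.
rewrite dotC dotE -[RHS]h; apply: eq_bigr => k _.
by rewrite [jac _ _ _ _]mxE [_^T _ _]mxE.
Qed.

Lemma nu_adapted q s : chart_dom c q -> time_interval T s -> U1 (chart_map c q, s) ->
  [/\ adapted K (in_chart X c s) (fun w => nu (w, s)) (chart_map c q),
      {for chart_map c q, continuous (fun w => nu (w, s))} &
      shape (in_chart X c s) (fun w => nu (w, s)) (chart_map c q) =
      sshape g nu (chart_map c q, s)].
Proof.
move=> cq Ts Uq; set v := chart_map c q.
have cv : (chart_map c @` chart_dom c) v by exists q.
have dnu (i : 'I_n) : derivable nu (v, s) (e_space i).
  apply/derivable_mxP => a k; exact: (smooth_on_derivable (snu a k) Uq).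
have [dN jN] := sjac_slice dnu.
split.
- apply: (in_chart_adapted sol) => //.
  have n1 : \forall w \near v, U1 (w, s).
    by apply: (@open_nbhs_nbhs _ v [set w | U1 (w, s)]); split=> //; exact: open_slice.
  by apply: filterS2 (chart_img_near cq) n1 => w cw Uw; exact: nu_unit_normal.
- have cn : {for (v, s), continuous nu}.
    by apply: continuous_at_mx => i j; exact: (smooth_on_continuous (snu i j) Uq).
  apply: (@continuous_comp _ _ _ (fun w => (w, s)) nu) => //.
  exact: continuous_pair_slice.
- by rewrite /shape /sshape /tangent /smetric jN (sjac_in_chart cv Ts (U10 Uq)) induced_metricE.
Qed.

(** The velocity is a limit relative to [0, T); for 0 < s < T it is two-sided and equals the time
    derivative of [g]. The normal of the flow equation and [nu] differ by a sign, which squares to 1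
    in H nu. *)
Lemma chart_flow q s b : chart_dom c q -> 0 < s -> (s%:E < T)%E -> U1 (chart_map c q, s) ->
  'D_(e_time : V) (fun z => g z 0 b) (chart_map c q, s) =
  - \tr (sshape g nu (chart_map c q, s)) * nu (chart_map c q, s) 0 b.
Proof.
move=> cq s0 sT Uq; set v := chart_map c q.
have Ts : time_interval T s by split=> //; exact: ltW.
have cv : (chart_map c @` chart_dom c) v by exists q.
have U0q := U10 Uq.
case: (sol) => _ _ _ eqn; have [N nN vel] := eqn c q s ac cq Ts.
have [adnu cnu Snu] := nu_adapted cq Ts Uq.
have [sgn [s2 Nn Sn]] := shape_chart K0 sol ac ac cq cq Ts nN adnu cnu.
have [adN _] := local_unit_normal_adapted sol ac cq Ts nN.
have Hvel : - mean_curvature K (in_chart X c s) N v *: N v =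
    - \tr (sshape g nu (v, s)) *: nu (v, s).
  rewrite -Snu [RHS](_ : _ = - \tr (sgn *: shape (in_chart X c s) N v) *: (sgn *: N v)); last first.
    by rewrite -Sn -Nn.
  have trE : \tr (sgn *: shape (in_chart X c s) N v) = sgn * \tr (shape (in_chart X c s) N v).
    exact: linearZ.
  have ss : sgn * sgn = 1 by rewrite -expr2.
  rewrite trE scalerA (mean_curvatureE adN); congr (_ *: _).
  by rewrite mulNr mulrAC ss mul1r.
rewrite Hvel in vel.
have near_t : \forall h \near (0 : R), time_interval T (s + h) /\ U0 (v, s + h).
  have cl : {for (0 : R), continuous (fun h : R => s + h)}.
    by apply: cvgD; [exact: cvg_cst|exact: cvg_id].
  have nt : \forall h \near (0 : R), 0 < s + h /\ ((s + h)%:E < T)%E.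
    apply: (cl [set x | 0 < x /\ (x%:E < T)%E]); rewrite addr0.
    by apply: open_nbhs_nbhs; split=> //; exact: open_time.
  have cl2 : {for (0 : R), continuous (fun h : R => (v, s + h))}.
    move=> A; rewrite addr0 => -[[P Q] /= [Pv Qs] sub]; rewrite nbhs_simpl /=.
    have := cl Q; rewrite addr0 nbhs_simpl /= => /(_ Qs).
    by apply: filterS => h Qh; apply: sub; split=> //; exact: nbhs_singleton Pv.
  have nU : \forall h \near (0 : R), U0 (v, s + h).
    by apply: (cl2 U0); rewrite addr0; apply: open_nbhs_nbhs.
  by apply: filterS2 nt nU => h [h0 hT] Uh; split=> //; split=> //; exact: ltW.
have gv (h : R) : time_interval T (s + h) -> U0 (v, s + h) -> X q (s + h) = g (v, s + h).
  by move=> Th Uh; rewrite -gE // /in_chart chart_mapK.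
have gv0 : X q s = g (v, s) by rewrite -gE // /in_chart chart_mapK.
have vel' : h^-1 *: ((g \o shift (v, s)) (h *: (e_time : V)) - g (v, s)) @[h --> 0^'] -->
    - \tr (sshape g nu (v, s)) *: nu (v, s).
  apply: cvg_trans vel => A HA; rewrite nbhs_simpl /= in HA *.
  have {}HA : \forall h \near (0 : R), h != 0 -> time_interval T (s + h) ->
      A (h^-1 *: (X q (s + h) - X q s)) by exact: HA.
  suff : \forall h \near (0 : R), h != 0 ->
      A (h^-1 *: (g (h *: (e_time : V) + (v, s)) - g (v, s))) by [].
  apply: filterS2 near_t HA => h [Th Uh] HA h0.
  rewrite (_ : h *: (e_time : V) + (v, s) = (v, s + h)); last first.
    by rewrite -[LHS]/((h *: 0 + v, h *: 1 + s)) scaler0 add0r [_ *: _]mulr1 addrC.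
  by rewrite -gv // -gv0; exact: HA.
have dg : derivable g (v, s) (e_time : V) by exact: smooth_on_derivable sg U0q.
have Dg : 'D_(e_time : V) g (v, s) = - \tr (sshape g nu (v, s)) *: nu (v, s).
  by apply/cvg_lim.
have := congr1 (fun A : 'rV[R]_n.+2 => A 0 b) Dg.
by rewrite derive_mx // mxE [RHS]mxE.
Qed.

End InChart.
End FlowLocal.

(** * Continuity and the maximum principle on the manifold *)

Section FlowGlobal.
Context {R : realType} {n : nat} {M : smooth_manifold R n} {K : R} {T : \bar R}.
Context {X : M -> R -> 'rV[R]_n.+2}.
Hypothesis K0 : 0 < K.
Hypothesis sol : mcf_solution K T X.
Notation V := ('rV[R]_n * R)%type.
Variables a2 h2 : M -> R -> R.
Hypothesis curvE : forall c p t N, mfd_atlas c -> chart_dom c p -> time_interval T t ->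
  adapted K (in_chart X c t) N (chart_map c p) ->
  {for chart_map c p, continuous N} ->
  let S := shape (in_chart X c t) N (chart_map c p) in
  a2 p t = \sum_a \sum_b S a b * S a b /\ h2 p t = (\tr S) ^+ 2.

Lemma flow_normal p t : time_interval T t ->
  exists (c : chart R n M) (U0 U1 : set V) (g nu : V -> 'rV[R]_n.+2),
  [/\ mfd_atlas c /\ chart_dom c p, [/\ open U0, smooth_on U0 g &
      forall v s, (chart_map c @` chart_dom c) v -> time_interval T s ->
        U0 (v, s) -> in_chart X c s v = g (v, s)],
      [/\ open U1, U1 (chart_map c p, t) & U1 `<=` U0],
      smooth_mx U1 nu /\ (forall z, U1 z -> smetric g z \in unitmx) &
      forall z, U1 z -> dot (g z) (g z) = K^-1 -> sjac g z *m (g z)^T = 0 ->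
      [/\ dot (nu z) (nu z) = 1, dot (nu z) (g z) = 0 & sjac g z *m (nu z)^T = 0]].
Proof.
move=> Tt; have [c ac cp] := mfd_cover p.
have [U0 [g [oU0 U0z sg gE]]] := in_chart_extension sol ac cp Tt.
have [N nN] := local_unit_normal_exists sol ac cp Tt.
have [ad _] := local_unit_normal_adapted sol ac cp Tt nN.
have cv : (chart_map c @` chart_dom c) (chart_map c p) by exists p.
have [fF xx Fx] := in_chart_point sol ac oU0 sg gE cv Tt U0z.
have [nn nx _] := nbhs_singleton (adapted_nrm ad).
rewrite (gE _ _ cv Tt U0z) in nx.
have Fn := adapted_FN ad; rewrite -(sjac_in_chart oU0 sg gE cv Tt U0z) in Fn.
have sg' : smooth_mx U0 g by move=> i j; exact: smooth_on_coord.
have [U1 [nu [[oU1 U1z] U10 ug snu nrm]]] :=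
  spacetime_normal K0 oU0 sg' U0z fF xx Fx nn nx Fn.
by exists c, U0, U1, g, nu; split.
Qed.

(** Joint continuity relative to [0, T), including t = 0, where the extension [g] is needed. The
    case k = 0 concerns |A|^2 alone and later provides its upper bound. *)
Lemma curvature_near (k : R) p t (e : R) : time_interval T t -> 0 < e ->
  \forall z \near ((p, t) : M * R), time_interval T z.2 ->
    `|(a2 p t - k * h2 p t) - (a2 z.1 z.2 - k * h2 z.1 z.2)| < e.
Proof.
move=> Tt e0.
have [c [U0 [U1 [g [nu [[ac cp] [oU0 sg gE] [oU1 U1z U10] [snu ug] nrm]]]]]] := flow_normal p Tt.
pose al z := \sum_a \sum_b sshape g nu z a b * sshape g nu z a b - k * (\tr (sshape g nu z)) ^+ 2.
have aE q s : chart_dom c q -> time_interval T s -> U1 (chart_map c q, s) ->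
    a2 q s - k * h2 q s = al (chart_map c q, s).
  move=> cq Ts Uq.
  have [ad cn SE] := nu_adapted sol ac oU0 sg gE oU1 U10 snu nrm cq Ts Uq.
  by have [-> ->] := curvE ac cq Ts ad cn; rewrite SE.
have sgm : smooth_mx U1 g by move=> i j; apply: smooth_onW U10 _; exact: smooth_on_coord.
have sS : smooth_mx U1 (sshape g nu).
  by apply: smooth_mx_mul => //; [exact: smooth_tangent|exact: smooth_sjac].
have cS a b : {for (chart_map c p, t), continuous (fun z => sshape g nu z a b)}.
  exact: smooth_on_continuous (sS a b) U1z.
have cal : {for (chart_map c p, t), continuous al}.
  have ct : {for (chart_map c p, t), continuous (fun z => \tr (sshape g nu z))}.
    exact: continuous_at_sum.
  have c1 : {for (chart_map c p, t), continuous
      (fun z => \sum_a \sum_b sshape g nu z a b * sshape g nu z a b)}.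
    by apply: continuous_at_sum => a; apply: continuous_at_sum => b; exact: continuous_at_mul.
  have c2 : {for (chart_map c p, t), continuous (fun z => k * (\tr (sshape g nu z)) ^+ 2)}.
    apply: (@continuous_at_mul _ _ (fun=> k)); first exact: cst_continuous.
    exact: (continuous_at_mul ct ct).
  exact: cvgB c1 c2.
have cz : {for ((p, t) : M * R), continuous (fun z : M * R => (chart_map c z.1, z.2))}.
  move=> A [[P Q] /= [Pv Qs] sub]; rewrite nbhs_simpl /=.
  have nP : \forall q \near p, P (chart_map c q) by exact: (chart_map_continuous cp).
  by exists ([set q | P (chart_map c q)], Q) => //= -[q s] [/= Pq Qs']; exact: sub.
have n1 : \forall z \near ((p, t) : M * R), `|al (chart_map c p, t) - al (chart_map c z.1, z.2)| < e.
  have na : \forall y \near (chart_map c p, t), `|al (chart_map c p, t) - al y| < e.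
    by have /cvgrPdist_lt := cal; apply.
  exact: (cz _ na).
have n2 : \forall z \near ((p, t) : M * R), U1 (chart_map c z.1, z.2).
  by apply: (cz U1); apply: open_nbhs_nbhs.
have n3 : \forall z \near ((p, t) : M * R), chart_dom c z.1.
  exists (chart_dom c, setT); last by move=> z [].
  by split=> /=; [apply: open_nbhs_nbhs; split=> //; exact: chart_dom_open|exact: filterT].
apply: filterS3 n1 n2 n3 => -[q s] /= lt U1q cq Ts.
by rewrite !aE.
Qed.

Lemma flow_max_principle (k : R) p t : 0 < t -> (t%:E < T)%E ->
  0 <= k -> k * n.+2%:R <= 3 ->
  (forall q s, time_interval T s -> s <= t -> a2 q s - k * h2 q s <= a2 p t - k * h2 p t) ->
  0 <= 2 * a2 p t ^+ 2 - 2 * n%:R * K * a2 p t + 4 * K * h2 p t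
       - 2 * k * h2 p t * (a2 p t + n%:R * K).
Proof.
move=> t0 tT k0 k3 mx; have Tt : time_interval T t by split=> //; exact: ltW.
have [c [U0 [U1 [g [nu [[ac cp] [oU0 sg gE] [oU1 U1z U10] [snu ug] nrm]]]]]] := flow_normal p Tt.
have aE q s : chart_dom c q -> time_interval T s -> U1 (chart_map c q, s) ->
    a2 q s = \sum_a \sum_b sshape g nu (chart_map c q, s) a b * sshape g nu (chart_map c q, s) a b
    /\ h2 q s = (\tr (sshape g nu (chart_map c q, s))) ^+ 2.
  move=> cq Ts Uq.
  have [ad cn SE] := nu_adapted sol ac oU0 sg gE oU1 U10 snu nrm cq Ts Uq.
  by have [-> ->] := curvE ac cq Ts ad cn; rewrite SE.
(* At interior times [g] coincides with the flow, so on this open set the hypotheses of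
   [local_max_principle] hold without conditions. *)
pose Om := U1 `&` ((chart_map c @` chart_dom c) `*` [set s : R | 0 < s /\ (s%:E < T)%E]).
have oOm : open Om.
  apply: openI => //; rewrite openE => -[v s] [/= cv hs].
  exists (chart_map c @` chart_dom c, [set s : R | 0 < s /\ (s%:E < T)%E]) => //.
  split=> /=; apply: open_nbhs_nbhs; split=> //; [exact: chart_img_open|exact: open_time].
have Om1 : Om `<=` U1 by move=> z [].
have OmT z : Om z -> time_interval T z.2 by case=> _ [_ [/ltW]].
have Omc z : Om z -> (chart_map c @` chart_dom c) z.1 by case=> _ [].
have pt z : Om z -> [/\ row_free (sjac g z), dot (g z) (g z) = K^-1 & sjac g z *m (g z)^T = 0].
  case: z => v s Oz.
  have cv : (chart_map c @` chart_dom c) v := Omc _ Oz.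
  have Ts : time_interval T s := OmT _ Oz.
  exact: (in_chart_point sol ac oU0 sg gE cv Ts (U10 _ (Om1 _ Oz))).
have [aE0 hE0] := aE p t cp Tt U1z.
rewrite aE0 hE0; apply: (@local_max_principle _ _ K Om g nu) => //.
- by move=> i j; apply: (smooth_onW (subset_trans Om1 U10)); exact: smooth_on_coord.
- exact: smooth_mxW snu.
- by move=> z /pt[].
- by move=> z /pt[].
- by move=> z /pt[].
- by move=> z Oz; have [_ xx Fx] := pt z Oz; exact: nrm (Om1 _ Oz) xx Fx.
- move=> [v s] b Oz.
  move: Oz => [/= U1z' [[q cq qv] [s0 sT]]]; rewrite -qv in U1z' *.
  exact: (chart_flow K0 sol ac oU0 sg gE oU1 U10 snu nrm).
- by split=> //; split=> //; exists p.
- move=> [v s] Oz st; have Ts := OmT _ Oz.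
  move: Oz => [/= U1z' [[q cq qv] _]]; rewrite -qv in U1z' *.
  have [aq hq] := aE q s cq Ts U1z'.
  by rewrite -aq -hq -aE0 -hE0; exact: mx.
Qed.

End FlowGlobal.

(** * Preservation of pinching *)

Section FirstTime.
Context {R : realType} {M : topologicalType}.
Variables (f : M -> R -> R) (I : set R) (t1 : R).
Hypothesis cM : compact [set: M].
Hypothesis I01 : forall t, 0 <= t <= t1 -> I t.
Hypothesis fc : forall p t e, I t -> 0 < e ->
  \forall z \near ((p, t) : M * R), I z.2 -> `|f p t - f z.1 z.2| < e.

Lemma compact_cylinder : compact ([set: M] `*` `[0, t1]).
Proof. by apply: compact_setX => //; exact: segment_compact. Qed.

Lemma bounded_above_cylinder : exists2 L : R, 0 <= L &
  forall p t, 0 <= t <= t1 -> f p t <= L.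
Proof.
have cov := (@compact_near_coveringP _ _).1 compact_cylinder.
have : \forall L \near +oo, forall z : M * R, ([set: M] `*` `[0, t1]) z -> I z.2 -> f z.1 z.2 <= L.
  apply: (cov R (pinfty_nbhs R) (fun L z => I z.2 -> f z.1 z.2 <= L)).
  move=> [p t] [_ /=]; rewrite in_itv /= => /I01 It.
  (* Near each point, f stays below its value there plus 1. *)
  exists ([set z : M * R | I z.2 -> `|f p t - f z.1 z.2| < 1], [set L : R | f p t + 1 <= L]).
    split=> /=; first exact: fc.
    by exists (f p t + 1); split=> [|L /ltW //]; exact: num_real.
  move=> [z L] [/= h1 h2] Iz; apply: le_trans h2.
  by have /ltr_normlP[h3 h4] := h1 Iz; lra.
move=> [A [_ hA]]; exists (Num.max 0 (A + 1)); first by rewrite le_max lexx.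
move=> p t t01; apply: (hA _ _ (p, t)); last exact: I01.
  by rewrite lt_max ltrDl ltr01 orbT.
by split=> //=; rewrite in_itv.
Qed.

(** The superlevel set [B] is compact, so the time coordinate has a minimum t on it. Before t all
    values are below b, and continuity from the left gives at most b at time t. *)
Lemma first_time (b : R) p1 : 0 <= t1 -> b <= f p1 t1 -> (forall p, f p 0 < b) ->
  exists p t, [/\ 0 < t <= t1, f p t = b & forall q s, 0 <= s <= t -> f q s <= b].
Proof.
move=> t10 fb f0.
pose B := [set z : M * R | 0 <= z.2 <= t1 /\ b <= f z.1 z.2].
have cB : compact B.
  apply: subclosed_compact compact_cylinder _; last first.
    by move=> [p t] [/= h _]; split=> //=; rewrite in_itv.
  (* The continuity hypothesis says nothing outside I, so points whose time lies outside [0, t1] are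
     handled by the time coordinate alone. *)
  rewrite -openC openE => -[p t] /= nB.
  have snd_near (P : set R) : nbhs t P -> \forall z \near ((p, t) : M * R), P z.2.
    by move=> Pt; exists (setT, P) => //=; [split=> //; exact: filterT|case=> q s [] ].
  have [t0|t0] := ltP t 0.
    apply: filterS (snd_near [set s | s < 0] _) => [[q s] /= s0 [/andP[s0' _] _]|].
      by move: s0; rewrite ltNge s0'.
    by apply: open_nbhs_nbhs; split=> //; exact: open_lt.
  have [t2|t2] := ltP t1 t.
    apply: filterS (snd_near [set s | t1 < s] _) => [[q s] /= s0 [/andP[_ s0'] _]|].
      by move: s0; rewrite ltNge s0'.
    by apply: open_nbhs_nbhs; split=> //; exact: open_gt.
  have fl : f p t < b by rewrite ltNge; apply/negP => bf; apply: nB; split=> //=; rewrite t0 t2.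
  have It : I t by apply: I01; rewrite t0 t2.
  have e0 : 0 < b - f p t by rewrite subr_gt0.
  apply: filterS (fc p It e0) => -[q s] /= h [s01 bs].
  by have /ltr_normlP[h1 h2] := h (I01 s01); lra.
have B0 : B !=set0 by exists (p1, t1); split=> //=; rewrite t10 lexx.
have cs : {within B, continuous (fun z : M * R => z.2)}.
  by apply: continuous_subspaceT => z; exact: cvg_snd.
have [[p t] /set_mem[/= /andP[t0 tt1] bt] tmin] := compact_EVT_min B0 cB cs.
have below q s : 0 <= s -> s < t -> f q s < b.
  move=> s0 st; rewrite ltNge; apply/negP => bs.
  have Bq : (q, s) \in B.
    by apply/mem_set; split=> //=; rewrite s0 (le_trans (ltW st)).
  by have := tmin _ Bq; rewrite /= leNgt st.
have tp : 0 < t.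
  by rewrite lt_neqAle t0 andbT; apply/eqP => E; move: bt; rewrite -E leNgt f0.
have It : I t by apply: I01; rewrite t0.
have at_t q : f q t <= b.
  rewrite leNgt; apply/negP => bq.
  have e0 : 0 < f q t - b by rewrite subr_gt0.
  have [[P Q] /= [Pq Qt] sub] := fc q It e0.
  have nl : \forall s \near t^'-, Q s /\ 0 < s.
    near=> s; split; near: s; last exact: nbhs_left_gt.
    exact: cvg_within Qt.
  near t^'- => s.
  have st : s < t by near: s; exact: nbhs_left_lt.
  have [Qs s0] : Q s /\ 0 < s by near: s.
  have Is : I s by apply: I01; rewrite ltW //= (le_trans (ltW st)).
  have := sub (q, s) (conj (nbhs_singleton Pq) Qs) Is; rewrite /= => /ltr_normlP[h1 h2].
  by have := below q s (ltW s0) st; lra.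
exists p, t; split; first by rewrite tp.
  by apply/eqP; rewrite eq_le at_t.
move=> q s /andP[s0]; rewrite le_eqVlt => /orP[/eqP ->|st]; first exact: at_t.
by apply/ltW/below.
Unshelve. all: by end_near. Qed.

End FirstTime.

(* With b = 2 (2 - a) and c = 1 / (n - 2 + a), the reaction term on the level
   set |A|^2 - c H^2 = b K + e is affine in e, and at e = 0 it equals
   2 K^2 b (b - n). *)
Lemma reaction_negative {R : realType} (m K a al eta e L : R) :
  0 < K -> 0 < a < 1 -> 2 * (2 - a) < m -> 2 < m -> 0 <= e -> al <= L ->
  e * (L + m * K) < K ^+ 2 * (2 * (2 - a)) * (m - 2 * (2 - a)) ->
  al - (m - 2 + a)^-1 * eta = 2 * (2 - a) * K + e ->
  2 * al ^+ 2 - 2 * m * K * al + 4 * K * eta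
    - 2 * (m - 2 + a)^-1 * eta * (al + m * K) < 0.
Proof.
move=> K0 /andP[a0 a1] mb m2 e0 aL eL E.
set k := (m - 2 + a)^-1 in E *.
have ke : k * eta = al - 2 * (2 - a) * K - e by lra.
have c0 : m - 2 + a != 0 by rewrite gt_eqF //; lra.
have etaE : eta = (m - 2 + a) * (al - 2 * (2 - a) * K - e) by rewrite -ke /k mulVKf.
have -> : 2 * al ^+ 2 - 2 * m * K * al + 4 * K * eta - 2 * k * eta * (al + m * K) =
  2 * (e * (al + m * K) - K ^+ 2 * (2 * (2 - a)) * (m - 2 * (2 - a)))
  - 4 * K * (m - 2 + a) * e.
  by rewrite -(mulrA 2 k) ke etaE; ring.
(* This makes the smallness condition on e uniform in the point where the maximum occurs. *)
have h1 : e * (al + m * K) <= e * (L + m * K) by rewrite ler_wpM2l // lerD2r.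
have h2 : 0 <= 4 * K * (m - 2 + a) * e.
  by rewrite !mulr_ge0 // ?ltW //; lra.
by lra.
Qed.

Theorem proposition3p1 (R : realType) (n : nat) (K : R)
    (M : smooth_manifold R n) (T : \bar R) (X : M -> R -> 'rV[R]_n.+2) (a : R) :
  (3 <= n)%N -> 0 < K -> compact [set: M] -> (0 < T)%E ->
  mcf_solution K T X ->
  0 < a < 1 ->
  pinched K X a 0 ->
  (4 <= n)%N \/ (n = 3%N /\ 2 / 3 <= a) ->
  forall t : R, time_interval T t -> pinched K X a t.
Proof.
move=> n3 K0 cM T0 sol a01 pin0 ncase t1 Tt1.
have [a0 a1] := andP a01.
have [a2 [h2 curvE]] := curvature_functions K0 sol.
pose k := (n%:R - 2 + a)^-1.
pose b := 2 * (2 - a).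
(* The dimension hypothesis is used here: b < n makes the reaction term negative, and n + 2 <= 3 (n
   - 2 + a) controls the gradient terms. For n >= 4 one has b < 4 and 8 <= 2 n; for n = 3 the second
   condition is exactly a >= 2/3, which also gives b <= 8/3. *)
have [m2 [mb m3]] : 2 < n%:R :> R /\ b < n%:R /\ n.+2%:R <= 3 * (n%:R - 2 + a) :> R.
  rewrite -(ltr_nat R) in n3 *.
  have En : n.+2%:R = n%:R + 2 :> R by rewrite -addn2 natrD.
  rewrite En /b; case: ncase => [n4|[-> a23]].
    have : (4 : R) <= n%:R by rewrite ler_nat.
    by move=> h; split; [lra|split; lra].
  by split; [lra|split; lra].
have c0 : 0 < n%:R - 2 + a by lra.
have k0 : 0 < k by rewrite invr_gt0.
have k3 : k * n.+2%:R <= 3 by rewrite /k mulrC ler_pdivrMr.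
have valE c p t N : mfd_atlas c -> chart_dom c p -> time_interval T t ->
    local_unit_normal (in_chart X c t) N (chart_map c p) ->
    sqnorm_second_ff K (in_chart X c t) N (chart_map c p) = a2 p t /\
    mean_curvature K (in_chart X c t) N (chart_map c p) ^+ 2 = h2 p t.
  move=> ac cp Tt nN; have [ad cN] := local_unit_normal_adapted sol ac cp Tt nN.
  have [-> ->] := curvE c p t N ac cp Tt ad cN.
  by rewrite (sqnorm_second_ffE K0 ad) (mean_curvatureE ad).
have T00 : time_interval T 0 by [].
pose f p t := a2 p t - k * h2 p t.
have f0 p : f p 0 <= b * K.
  have [c ac cp] := mfd_cover p.
  have [N nN] := local_unit_normal_exists sol ac cp T00.
  have := pin0 c p N ac cp nN; rewrite /=.
  by have [-> ->] := valE c p 0 N ac cp T00 nN; rewrite /f -/k -/b; lra.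
suff main p : f p t1 <= b * K.
  move=> c p N ac cp /= nN; have [-> ->] := valE c p t1 N ac cp Tt1 nN.
  by have := main p; rewrite /f -/k -/b; lra.
rewrite leNgt; apply/negP => fp.
have [t10 t1T] := Tt1.
have I01 t : 0 <= t <= t1 -> time_interval T t.
  by move=> /andP[h0 h1]; split=> //; apply: le_lt_trans t1T; rewrite lee_fin.
have cn kk q t e := @curvature_near _ _ _ _ _ _ K0 sol a2 h2 curvE kk q t e.
(* The perturbation e multiplies |A|^2 in the reaction term, so |A|^2 itself must be bounded on
   [0, t1]. *)
have [L L0 aL] : exists2 L : R, 0 <= L & forall q t, 0 <= t <= t1 -> a2 q t <= L.
  apply: (@bounded_above_cylinder _ _ a2 (time_interval T) t1 cM I01).
  move=> q t e Tt e0; apply: filterS (cn 0 q t e Tt e0) => z h Tz.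
  by have := h Tz; rewrite !mul0r !subr0.
pose de := K ^+ 2 * b * (n%:R - b).
have b0 : 0 < b by rewrite /b; lra.
have de0 : 0 < de.
  apply: mulr_gt0; last by rewrite subr_gt0.
  by apply: mulr_gt0 => //; exact: exprn_gt0.
have LK : 0 < L + n%:R * K + 1.
  have : 0 < n%:R * K by rewrite mulr_gt0 //; lra.
  by lra.
(* The first bound ensures that the raised level is reached by time t1, the second that e does not
   spoil the negativity; the 1 in the denominator makes that inequality strict. *)
pose e := Num.min (f p t1 - b * K) (de / (L + n%:R * K + 1)).
have e0 : 0 < e by rewrite lt_min subr_gt0 fp divr_gt0.
have efp : b * K + e <= f p t1.
  have : e <= f p t1 - b * K by rewrite ge_min lexx.
  by lra.
have eL : e * (L + n%:R * K) < de.
  have : e <= de / (L + n%:R * K + 1) by rewrite ge_min lexx orbT.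
  rewrite ler_pdivlMr // => h; apply: lt_le_trans h.
  by rewrite ltr_pM2l // ltrDl.
have [q [t [/andP[t0 tt1] ft mx]]] : exists q t, [/\ 0 < t <= t1, f q t = b * K + e
    & forall q s, 0 <= s <= t -> f q s <= b * K + e].
  apply: (@first_time _ _ f (time_interval T) t1 cM I01 (cn k) _ p t10 efp).
  by move=> q; apply: le_lt_trans (f0 q) _; rewrite ltrDl.
have t01 : 0 <= t <= t1 by rewrite ltW.
have [_ tT] := I01 t t01.
have := flow_max_principle K0 sol curvE t0 tT (ltW k0) k3.
move=> /(_ q); have h : forall q0 s, time_interval T s -> s <= t ->
    a2 q0 s - k * h2 q0 s <= a2 q t - k * h2 q t.
  by move=> q0 s [s0 _] st; rewrite -/(f q0 s) -/(f q t) ft; apply: mx; rewrite s0.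
move=> /(_ h); apply/negP; rewrite -ltNge.
exact: (@reaction_negative _ n%:R K a _ _ e L K0 a01 mb m2 (ltW e0) (aL q t t01) eL ft).
Qed.
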